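(* Let $M$ be a real-analytic real hypersurface in $\mathbb{C}^{n+1}$, with nondegenerate Levi form at the origin, defined near the origin by $v=F(z,\bar z,u)$ with $F|_{0}=0$, $dF|_{0}=0$. Then a normalization $\phi=(f,g)$ of $M$ (with components $f$ in $\mathbb{C}^n$ and $g$ in $\mathbb{C}$) is uniquely determined by the values $$\left.\frac{\partial f}{\partial z}\right|_{0},\quad \left.\frac{\partial f}{\partial w}\right|_{0},\quad \Re\left(\left.\frac{\partial g}{\partial w}\right|_{0}\right),\quad \Re\left(\left.\frac{\partial^{2}g}{\partial w^{2}}\right|_{0}\right);$$ that is, two normalizations of $M$ for which these values coincide are equal near the origin.
   Context: Coordinates on $\mathbb{C}^{n+1}=\mathbb{C}^n\times\mathbb{C}$ are $z=(z^1,\dots,z^n)$ and $w=u+iv$ with $u,v$ real; $F$ is a real-valued real-analytic function near the origin. For an integer $e$ with $\frac n2\le e\le n$ (determined by the signature of the Levi form of $M$), $$\langle z,z\rangle=z^1\overline{z^1}+\cdots+z^e\overline{z^e}-z^{e+1}\overline{z^{e+1}}-\cdots-z^n\overline{z^n},$$ $$\Delta=D_1\overline D_1+\cdots+D_e\overline D_e-D_{e+1}\overline D_{e+1}-\cdots-D_n\overline D_n,\qquad D_k=\frac{\partial}{\partial z^k},\ \overline D_k=\frac{\partial}{\partial\overline{z^k}} .$$ A normalization of $M$ is a biholomorphic mapping $\phi$ defined near the origin, with $\phi(0)=0$, such that $\phi(M)$ is in Chern-Moser normal form, i.e. is defined near the origin by $$v=\langle z,z\rangle+\sum_{s,t\ge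 2}F^{*}_{st}(z,\bar z,u),\qquad \Delta F^{*}_{22}=\Delta^{2}F^{*}_{23}=\Delta^{3}F^{*}_{33}=0,$$ where $F^*_{st}$ is real-analytic of type $(s,t)$: $F^*_{st}(\mu z,\nu\bar z,u)=\mu^s\nu^tF^*_{st}(z,\bar z,u)$ for all complex $\mu,\nu$. *)

(* Defs.v *)
From HB Require Import structures.
From mathcomp Require Import all_boot all_order all_algebra.
From mathcomp Require Import all_classical all_reals all_analysis.
From mathcomp Require Import complex.

Set Implicit Arguments.
Unset Strict Implicit.
Unset Printing Implicit Defensive.

Import Order.TTheory GRing.Theory Num.Theory.
Import numFieldNormedType.Exports.

Local Open Scope classical_set_scope.
Local Open Scope ring_scope.
Local Open Scope complex_scope.

(* [R[i]] carries no topology in the libraries; it receives the one of every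
   [numFieldType], given by the modulus. *)
HB.instance Definition _ (R : rcfType) :=
  NormedModule.copy R[i] (R[i] : numFieldType)^o.

Section Analytic.
Context {K : numFieldType}.

(* Partial sum of a multi-indexed family over the exponents smaller than [N]. *)
Definition box_sum m (t : ('I_m -> nat) -> K) (N : nat) : K :=
  \sum_(a : {ffun 'I_m -> 'I_N}) t (fun i => a i).

(* Absolutely convergent multiple series with sum [l]. *)
Definition has_multi_sum m (t : ('I_m -> nat) -> K) (l : K) : Prop :=
  (exists B : K, forall N, box_sum (fun a => `|t a|) N <= B) /\
  box_sum t @ \oo --> l.

Definition monomial m (x : 'rV[K]_m) (a : 'I_m -> nat) : K :=
  \prod_(i < m) x 0 i ^+ a i.

(* Local representability by a convergent power series in [m] variables: for
   [K = R[i]] this is holomorphy, for a real field it is real-analyticity. *)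
Definition analytic_at m (f : 'rV[K]_m -> K) (p : 'rV[K]_m) : Prop :=
  exists c : ('I_m -> nat) -> K,
    \forall h \near (0 : 'rV[K]_m),
      has_multi_sum (fun a => c a * monomial h a) (f (p + h)).

Definition partial m (k : 'I_m) (f : 'rV[K]_m -> K) (p : 'rV[K]_m) : K :=
  'D_(delta_mx 0 k) f p.

End Analytic.

Section ChernMoser.
Context {R : realType}.
Local Notation C := R[i].

(* A point of C^(n+1) is a row vector [p] of size [n + 1], split as (z, w). *)
Definition zcoord n (p : 'rV[C]_(n + 1)) : 'rV[C]_n := lsubmx p.
Definition wcoord n (p : 'rV[C]_(n + 1)) : C := rsubmx p 0 0.

Definition holomorphic_map m m' (U : set 'rV[C]_m)
    (phi : 'rV[C]_m -> 'rV[C]_m') : Prop :=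
  forall (p : 'rV[C]_m) (j : 'I_m'), U p -> analytic_at (fun q => phi q 0 j) p.

(* A function F(z, conj z, u) is encoded as [F z u]; this is the same function
   in the real coordinates (x, y, u), where z = x + iy. *)
Definition real_coords T n (F : 'rV[C]_n -> R -> T) (t : 'rV[R]_(n + n + 1)) : T :=
  F (\row_k (lsubmx (lsubmx t) 0 k +i* rsubmx (lsubmx t) 0 k)) (rsubmx t 0 0).

Definition real_analytic_near0 n (F : 'rV[C]_n -> R -> R) : Prop :=
  \forall t \near (0 : 'rV[R]_(n + n + 1)), analytic_at (real_coords F) t.

Definition derive_real (h : R -> C) : C :=
  derive1 (fun t => complex.Re (h t)) 0 +i* derive1 (fun t => complex.Im (h t)) 0.

Definition dx n (k : 'I_n) (G : 'rV[C]_n -> R -> C) (z : 'rV[C]_n) (u : R) : C :=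
  derive_real (fun t => G (z + t%:C *: delta_mx 0 k) u).
Definition dy n (k : 'I_n) (G : 'rV[C]_n -> R -> C) (z : 'rV[C]_n) (u : R) : C :=
  derive_real (fun t => G (z + ('i * t%:C) *: delta_mx 0 k) u).

Definition D n (k : 'I_n) (G : 'rV[C]_n -> R -> C) : 'rV[C]_n -> R -> C :=
  fun z u => (dx k G z u - 'i * dy k G z u) / 2%:R.
Definition Dbar n (k : 'I_n) (G : 'rV[C]_n -> R -> C) : 'rV[C]_n -> R -> C :=
  fun z u => (dx k G z u + 'i * dy k G z u) / 2%:R.

Definition esign (e k : nat) : C := if (k < e)%N then 1 else - 1.

Definition herm n (e : nat) (z : 'rV[C]_n) : C :=
  \sum_(k < n) esign e k * (z 0 k * conjc (z 0 k)).

Definition Lap n (e : nat) (G : 'rV[C]_n -> R -> C) : 'rV[C]_n -> R -> C :=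
  fun z u => \sum_(k < n) esign e k * D k (Dbar k G) z u.

(* For v = F with F = 0 and dF = 0 at the origin, the complex tangent space at
   the origin is {w = 0}, on which the Levi form has this matrix. *)
Definition levi_matrix n (F : 'rV[C]_n -> R -> R) : 'M[C]_n :=
  \matrix_(j, k) D j (Dbar k (fun z u => (F z u)%:C)) 0 0.

(* The Hermitian form of matrix [L] has [p] positive and [n - p] negative
   squares. *)
Definition has_signature n (L : 'M[C]_n) (p : nat) : Prop :=
  exists P : 'M[C]_n, P \in unitmx /\
    P *m L *m (map_mx conjc P)^T = diag_mx (\row_(k < n) esign p k).

Definition graph_near0 n (M : set 'rV[C]_(n + 1)) (F : 'rV[C]_n -> R -> R) : Prop :=
  \forall p \near (0 : 'rV[C]_(n + 1)),
    M p <-> complex.Im (wcoord p) = F (zcoord p) (complex.Re (wcoord p)).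

(* Absolutely convergent double series over s, t >= 2 with sum [l]. *)
Definition has_double_sum_ge2 (x : nat -> nat -> C) (l : C) : Prop :=
  (exists B : C, forall N : nat,
     \sum_(2 <= s < N) \sum_(2 <= t < N) `|x s t| <= B) /\
  (fun N : nat => \sum_(2 <= s < N) \sum_(2 <= t < N) x s t) @ \oo --> l.

(* The components F_st are given as functions of independent variables
   (z, zeta, u), which the type condition F_st(mu z, nu zeta, u) requires; the
   actual function is recovered at zeta = conj z and u real. *)
Definition on_diagonal n (G : 'rV[C]_n -> 'rV[C]_n -> C -> C) :
    'rV[C]_n -> R -> C :=
  fun z u => G z (map_mx conjc z) u%:C.

Definition uncurry3 n (G : 'rV[C]_n -> 'rV[C]_n -> C -> C)
    (q : 'rV[C]_(n + n + 1)) : C :=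
  G (lsubmx (lsubmx q)) (rsubmx (lsubmx q)) (rsubmx q 0 0).

(* [forall s t] stands under [\near] so that all the components share one
   neighbourhood of the origin. *)
Definition chern_moser_normal_form n (e : nat) (N : set 'rV[C]_(n + 1)) : Prop :=
  exists (Fstar : 'rV[C]_n -> R -> R)
         (Fst : nat -> nat -> 'rV[C]_n -> 'rV[C]_n -> C -> C),
  [/\ real_analytic_near0 Fstar,
      graph_near0 N Fstar,
      (\forall z \near (0 : 'rV[C]_n) & u \near (0 : R),
         has_double_sum_ge2 (fun s t => on_diagonal (Fst s t) z u)
           ((Fstar z u)%:C - herm e z)),
      ((\forall q \near (0 : 'rV[C]_(n + n + 1)), forall s t : nat,
         (2 <= s)%N -> (2 <= t)%N -> analytic_at (uncurry3 (Fst s t)) q) /\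
       (\forall u \near (0 : C), forall s t : nat,
         (2 <= s)%N -> (2 <= t)%N ->
         forall (mu nu : C) (z zeta : 'rV[C]_n),
           Fst s t (mu *: z) (nu *: zeta) u =
             mu ^+ s * nu ^+ t * Fst s t z zeta u)) &
      (\forall z \near (0 : 'rV[C]_n) & u \near (0 : R),
         [/\ Lap e (on_diagonal (Fst 2%N 2%N)) z u = 0,
             iter 2%N (Lap e) (on_diagonal (Fst 2%N 3%N)) z u = 0 &
             iter 3%N (Lap e) (on_diagonal (Fst 3%N 3%N)) z u = 0])].

(* [phi] is a total function of which only the germ at 0 matters; [U] is a
   neighbourhood of the origin on which it is biholomorphic. *)
Definition normalization n (e : nat) (M : set 'rV[C]_(n + 1))
    (phi : 'rV[C]_(n + 1) -> 'rV[C]_(n + 1)) : Prop :=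
  phi 0 = 0 /\
  exists (U V : set 'rV[C]_(n + 1)) (psi : 'rV[C]_(n + 1) -> 'rV[C]_(n + 1)),
  [/\ [/\ open U, U 0 & open V],
      (forall p, U p -> V (phi p) /\ psi (phi p) = p),
      (forall q, V q -> U (psi q) /\ phi (psi q) = q),
      holomorphic_map U phi /\ holomorphic_map V psi &
      chern_moser_normal_form e (phi @` (M `&` U))].

Definition fcomp n (phi : 'rV[C]_(n + 1) -> 'rV[C]_(n + 1)) (j : 'I_n)
    (p : 'rV[C]_(n + 1)) : C := zcoord (phi p) 0 j.
Definition gcomp n (phi : 'rV[C]_(n + 1) -> 'rV[C]_(n + 1))
    (p : 'rV[C]_(n + 1)) : C := wcoord (phi p).

Definition dz n (k : 'I_n) : ('rV[C]_(n + 1) -> C) -> 'rV[C]_(n + 1) -> C :=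
  partial (lshift 1 k).
Definition dw n : ('rV[C]_(n + 1) -> C) -> 'rV[C]_(n + 1) -> C :=
  partial (rshift n ord0).

End ChernMoser.

(* Main.v *)
Require Import Defs.
From HB Require Import structures.
From mathcomp Require Import all_boot all_order all_algebra.
From mathcomp Require Import all_classical all_reals all_analysis.
From mathcomp Require Import complex ring zify.
Import Order.TTheory GRing.Theory Num.Theory.
Import numFieldNormedType.Exports.
Local Open Scope classical_set_scope.
Local Open Scope ring_scope.
Local Open Scope complex_scope.

Set Implicit Arguments.
Unset Strict Implicit.
Unset Printing Implicit Defensive.

(* Give z weight 1 and w weight 2, and compare phi1 and phi2 through their
   weighted homogeneous components, weight by weight.  If the components of
   (f, g) agree below weights (1 + d, 2 + d), carry the points of phi1(M) by
   phi2 o phi1^-1 to phi2(M): the lowest-order terms of the two normal form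
   equations say that the next difference (f, g), composed with the leading part
   of phi1^-1, is mapped by the Chern-Moser operator Im g - 2 Re <f, z> on the
   hyperquadric w = u + i <z, z> to a sum of terms of type (s, t) with s, t >= 2
   whose (2, 2), (2, 3) and (3, 3) parts satisfy the trace conditions.  Solving
   type by type, such an (f, g) vanishes, except for finitely many parameters at
   d = 0, 1, 2 which are prescribed by the initial data.  Hence phi1 and phi2
   have the same expansion at the origin, and they are analytic.
   Everything is evaluated along curves r |-> (r z, r^2 w) as r tends to 0+, so
   that only the expansions of analytic functions are ever needed. *)

(** * Weighted Taylor expansions *)

(** Why exactly the weights d = 0, 1, 2 are exceptional: put mu = d + 2. Once the equations of lower
    type are solved, the (2, 2), (2, 3) and (3, 3) parts carry the factors (mu - 2)/2, 2 m (m - 1)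
    with m = (mu - 1)/2, and 2 C(m, 3) with m = mu/2. Apart from the weights in which parity already
    removes the unknown, these vanish only for mu = 2, mu = 3 and mu = 2, 4. The trace conditions
    bite because the commutator of Delta with multiplication by <z, z> is n plus the Euler operator,
    so the constants it produces are positive. Two limits shape the proof. The series of the F_st is
    controlled only for each fixed u, while u moves with r; its tail is made uniform by comparison
    with the power series of F* on the fibre u = const. And Delta has to be applied to a relation
    known only at each z, up to a higher power of r: on polynomials of bounded degree Delta is a
    finite combination of translates, so pointwise asymptotics suffice. The composition with the
    leading part of phi1^-1 is undone at the end, because that leading part is onto. *)

Section PowerSeries.
Context {K : numFieldType}.

Definition wt m (om : 'I_m -> nat) (a : 'I_m -> nat) : nat :=
  (\sum_(i < m) om i * a i)%N.

Definition slab_sum m (om : 'I_m -> nat) (t : ('I_m -> nat) -> K) (N k : nat) : K :=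
  \sum_(a : {ffun 'I_m -> 'I_N} | wt om (fun i => a i) == k) t (fun i => a i).

(** Positive weights bound every exponent by the total weight, so a box of side larger than [k]
    already holds all multi-indices of weight [k]. This is why [taylor] can be a finite sum over the
    box of side [k.+1]. *)
Lemma slab_sum_stable m (om : 'I_m -> nat) (t : ('I_m -> nat) -> K) (N k : nat) :
  (forall i, 0 < om i)%N -> (k < N)%N ->
  slab_sum om t N k = slab_sum om t k.+1 k.
Proof.
move=> om0 kN; rewrite /slab_sum.
have le_a : forall (a : 'I_m -> nat) i, (a i <= wt om a)%N.
  move=> a i; rewrite /wt (bigD1 i) //=; apply: leq_trans (leq_addr _ _).
  by rewrite -{1}[a i]mul1n leq_mul2r om0 orbT.
pose w (a : {ffun 'I_m -> 'I_k.+1}) : {ffun 'I_m -> 'I_N} :=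
  [ffun i => widen_ord kN (a i)].
pose u (a : {ffun 'I_m -> 'I_N}) : {ffun 'I_m -> 'I_k.+1} := [ffun i => inord (a i)].
have wE a : (fun i => w a i : nat) = (fun i => a i : nat).
  by apply/funext => i; rewrite ffunE.
rewrite (reindex_onto w u) /=; last first.
  move=> a /eqP wa; apply/ffunP => i; rewrite !ffunE; apply/val_inj => /=.
  rewrite inordK //; by rewrite ltnS -[k in (_ <= k)%N]wa le_a.
apply: eq_big => [a|a _]; last by rewrite wE.
rewrite wE; case: eqP => //= _; apply/eqP/ffunP => i.
by rewrite !ffunE; apply/val_inj; rewrite /= inordK.
Qed.

Lemma box_sum_slabs m (om : 'I_m -> nat) (t : ('I_m -> nat) -> K) (N n : nat) :
  box_sum t N = \sum_(k < n) slab_sum om t N k +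
    \sum_(a : {ffun 'I_m -> 'I_N} | (n <= wt om (fun i => a i))%N) t (fun i => a i).
Proof.
rewrite /box_sum (bigID (fun a : {ffun 'I_m -> 'I_N} => wt om (fun i => a i) < n)%N) /=.
congr (_ + _); last by apply: eq_bigl => a; rewrite -leqNgt.
case: n => [|n]; first by rewrite big_ord0 big1.
rewrite (partition_big (fun a : {ffun 'I_m -> 'I_N} =>
   inord (wt om (fun i => a i)) : 'I_n.+1) predT) //=.
apply: eq_bigr => k _; rewrite /slab_sum; apply: eq_bigl => a.
case: ltnP => H /=.
  by rewrite -val_eqE /= inordK.
by apply/esym/negP => /eqP E; move: H; rewrite E leqNgt ltn_ord.
Qed.

(** [kappa] is the gain on high weights over a fixed summable majorant [d]; in a Taylor estimate it
    is [(r / r0) ^+ n]. The bound does not depend on the box, so it survives the limit. *)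
Lemma norm_box_sum_tail m (om : 'I_m -> nat) (t d : ('I_m -> nat) -> K)
    (N n : nat) (kappa B : K) :
  0 <= kappa -> (forall a, 0 <= d a) -> box_sum d N <= B ->
  (forall a, (n <= wt om a)%N -> `|t a| <= kappa * d a) ->
  `|box_sum t N - \sum_(k < n) slab_sum om t N k| <= kappa * B.
Proof.
move=> k0 d0 dB td; rewrite (box_sum_slabs om t N n) addrC addrA addNr add0r.
apply: le_trans (ler_norm_sum _ _ _) _.
apply: le_trans (ler_wpM2l k0 dB); rewrite /box_sum mulr_sumr.
rewrite [leRHS](bigID (fun a : {ffun 'I_m -> 'I_N} => n <= wt om (fun i => a i))%N) /=.
rewrite -[leLHS]addr0; apply: lerD; first by apply: ler_sum => a /td.
by apply: sumr_ge0 => a _; rewrite mulr_ge0.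
Qed.

(* A closed ball is closed: convergence is used through this form only. *)
Lemma norm_lim_le (u : nat -> K) (l p b : K) :
  0 <= b -> u @ \oo --> l -> (exists N0, forall N, (N0 <= N)%N -> `|u N - p| <= b) ->
  `|l - p| <= b.
Proof.
move=> b0 /cvgrPdist_lt ul [N0 H]; rewrite real_leNgt ?ger0_real //.
apply/negP => bl; have e0 : 0 < `|l - p| - b by rewrite subr_gt0.
have [N1 _ /= HN1] := ul _ e0.
have := HN1 (maxn N0 N1); rewrite /= leq_maxr => /(_ isT) h1.
have h2 := H _ (leq_maxl N0 N1).
have := ler_normD (l - u (maxn N0 N1)) (u (maxn N0 N1) - p).
rewrite addrA subrK => h3.
by have := le_lt_trans h3 (ltr_leD h1 h2); rewrite subrK ltxx.
Qed.

Lemma norm_multi_sum_tail m (om : 'I_m -> nat) (t d : ('I_m -> nat) -> K)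
    (n : nat) (kappa B l : K) :
  (forall i, 0 < om i)%N -> 0 <= kappa -> (forall a, 0 <= d a) ->
  (forall N, box_sum d N <= B) ->
  (forall a, (n <= wt om a)%N -> `|t a| <= kappa * d a) ->
  box_sum t @ \oo --> l ->
  `|l - \sum_(k < n) slab_sum om t k.+1 k| <= kappa * B.
Proof.
move=> om0 k0 d0 dB td tl.
have B0 : 0 <= B by apply: le_trans (dB 0%N); apply: sumr_ge0.
apply: norm_lim_le tl _; first exact: mulr_ge0.
exists n => N nN; have := norm_box_sum_tail k0 d0 (dB N) td.
congr (`|_ - _| <= _); apply: eq_bigr => k _.
by rewrite slab_sum_stable // (leq_trans (ltn_ord k)).
Qed.

Lemma monomial_wt m (om : 'I_m -> nat) (r : K) a :
  monomial (\row_i r ^+ om i) a = r ^+ wt om a.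
Proof.
rewrite /monomial /wt; under eq_bigr do rewrite mxE -exprM.
by rewrite -expr_sum.
Qed.

Lemma norm_monomial_le m (om : 'I_m -> nat) (r : K) (h : 'rV[K]_m) a :
  (forall i, `|h 0 i| <= r ^+ om i) -> `|monomial h a| <= r ^+ wt om a.
Proof.
move=> hr; rewrite -monomial_wt /monomial normr_prod; apply: ler_prod => i _.
by rewrite normr_ge0 normrX mxE lerXn2r ?nnegrE ?(le_trans _ (hr i)).
Qed.

Definition taylor m (c : ('I_m -> nat) -> K) (om : 'I_m -> nat) (k : nat) (h : 'rV[K]_m) : K :=
  slab_sum om (fun a => c a * monomial h a) k.+1 k.

Lemma near0_rowP m (Q : 'rV[K]_m -> Prop) :
  (\forall h \near (0 : 'rV[K]_m), Q h) <->
  exists2 e : K, 0 < e & forall h : 'rV[K]_m, (forall i, `|h 0 i| < e) -> Q h.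
Proof.
split.
  move=> /nbhs_ballP[e /= e0 He]; exists e => // h hle; apply: He.
  by split=> // i j; rewrite ord1 mxE /ball /= sub0r normrN.
move=> [e e0 He]; apply/nbhs_ballP; exists e => //= h [_ hh]; apply: He => i.
by have := hh 0 i; rewrite mxE /ball /= sub0r normrN.
Qed.

Definition series_rep m (f : 'rV[K]_m -> K) (p : 'rV[K]_m) (c : ('I_m -> nat) -> K) :=
  \forall h \near (0 : 'rV[K]_m),
    has_multi_sum (fun a => c a * monomial h a) (f (p + h)).

(** One point is enough: the monomials at the point with coordinates [r0 ^+ om i] dominate those on
    the whole polydisc. *)
Lemma series_rep_bound m (f : 'rV[K]_m -> K) p c (om : 'I_m -> nat) :
  series_rep f p c -> (forall i, 0 < om i)%N ->
  exists B r0 : K, [/\ 0 < r0, r0 <= 1, 0 <= B,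
    (forall N, box_sum (fun a => `|c a| * r0 ^+ wt om a) N <= B) &
    forall h : 'rV[K]_m, (forall i, `|h 0 i| <= r0 ^+ om i) ->
      has_multi_sum (fun a => c a * monomial h a) (f (p + h))].
Proof.
move=> /near0_rowP[e e0 He] om0.
(* [e / (1 + e)] lies below both [e] and 1; a minimum is avoided because the order of a
   [numFieldType] is not total. *)
pose r0 : K := e / (1 + e).
have e1 : 0 < 1 + e by rewrite addr_gt0.
have r00 : 0 < r0 by rewrite divr_gt0.
have r01 : r0 <= 1 by rewrite ler_pdivrMr // mul1r lerDr ltW.
have r0e : r0 < e.
  by rewrite ltr_pdivrMr // mulrDr mulr1 ltrDl mulr_gt0.
have Hs (h : 'rV[K]_m) : (forall i, `|h 0 i| <= r0 ^+ om i) ->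
      has_multi_sum (fun a => c a * monomial h a) (f (p + h)).
  move=> hr; apply: He => i; apply: le_lt_trans (hr i) _.
  apply: le_lt_trans r0e; rewrite -[leRHS]expr1.
  by apply: ler_wiXn2l => //; exact: ltW.
have [|[B HB] _] := Hs (\row_i r0 ^+ om i).
  by move=> i; rewrite mxE ger0_norm // exprn_ge0 // ltW.
have HB' N : box_sum (fun a => `|c a| * r0 ^+ wt om a) N <= B.
  apply: le_trans (HB N); rewrite /box_sum; apply: ler_sum => a _.
  by rewrite normrM monomial_wt (ger0_norm (exprn_ge0 _ (ltW r00))).
exists B, r0; split=> //; apply: le_trans (HB 0%N).
by apply: sumr_ge0 => a _; rewrite normr_ge0.
Qed.

(** [B] and [r0] are chosen before [N]: the error decays geometrically in the order, which is what
    lets a vanishing expansion force a vanishing function. *)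
Lemma series_rep_taylor m (f : 'rV[K]_m -> K) p c (om : 'I_m -> nat) :
  series_rep f p c -> (forall i, 0 < om i)%N ->
  exists B r0 : K, [/\ 0 < r0, 0 <= B &
    forall N r (h : 'rV[K]_m), 0 <= r <= r0 -> (forall i, `|h 0 i| <= r ^+ om i) ->
      `|f (p + h) - \sum_(k < N) taylor c om k h| <= B * (r / r0) ^+ N].
Proof.
move=> /series_rep_bound H om0.
have [B [r0 [r00 r01 B0 HB Hs]]] := H om om0.
exists B, r0; split => // N r h /andP[rge rle] hr.
have q0 : 0 <= r / r0 by rewrite divr_ge0 // ltW.
have q1 : r / r0 <= 1 by rewrite ler_pdivrMr // mul1r.
have [|_ Hl] := Hs h.
  by move=> i; apply: le_trans (hr i) _; rewrite lerXn2r ?nnegrE // ltW.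
rewrite mulrC; apply: norm_multi_sum_tail om0 _ _ HB _ Hl.
- by rewrite exprn_ge0.
- by move=> a; rewrite mulr_ge0 // exprn_ge0 // ltW.
move=> a Na; rewrite normrM mulrCA ler_wpM2l //.
apply: le_trans (norm_monomial_le _ hr) _.
rewrite -{1}[r](divfK (lt0r_neq0 r00)) exprMn ler_wpM2r ?exprn_ge0 ?(ltW r00) //.
by apply: ler_wiXn2l.
Qed.

Lemma norm_subrX_le (x y rho : K) n : `|x| <= rho -> `|y| <= rho ->
  `|x ^+ n.+1 - y ^+ n.+1| <= `|x - y| * (n.+1%:R * rho ^+ n).
Proof.
move=> xr yr; rewrite subrXX normrM ler_wpM2l //.
apply: le_trans (ler_norm_sum _ _ _) _.
rewrite [leRHS](_ : _ = \sum_(i < n.+1) rho ^+ n); last first.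
  by rewrite sumr_const card_ord mulr_natl.
apply: ler_sum => i _; rewrite normrM !normrX.
have rho0 : 0 <= rho by apply: le_trans xr.
rewrite -[in leRHS](subnK (leq_ord i)) exprD.
by apply: ler_pM; rewrite ?exprn_ge0 // lerXn2r ?nnegrE.
Qed.

(** The exponent produced by differentiating a power is absorbed into [2 ^ wt], and that factor is
    paid for later by halving the radius. *)
Lemma norm_monomial_diff m (h : 'rV[K]_m) (i : 'I_m) (s rho : K) (a : 'I_m -> nat) :
  (forall j, `|h 0 j| <= rho) -> (forall j, `|(h + s *: delta_mx 0 i) 0 j| <= rho) ->
  `|monomial (h + s *: delta_mx 0 i) a - monomial h a| <=
    `|s| * ((2 ^ wt (fun=> 1%N) a)%:R * rho ^+ (wt (fun=> 1%N) a).-1).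
Proof.
move=> hr hsr; have rho0 : 0 <= rho by apply: le_trans (hr i).
rewrite /monomial (bigD1 i) //= [X in _ - X](bigD1 i) //=.
set P := \prod_(j < m | j != i) _; set Q := \prod_(j < m | j != i) _.
have -> : P = Q.
  by apply: eq_bigr => j ji; rewrite !mxE eqxx (negPf ji) mulr0 addr0.
pose w := (\sum_(j < m | j != i) a j)%N.
have -> : wt (fun=> 1%N) a = (a i + w)%N.
  by rewrite /wt (bigD1 i) //= mul1n; under eq_bigr do rewrite mul1n.
have Qle : `|Q| <= rho ^+ w.
  rewrite /w expr_sum normr_prod; apply: ler_prod => j _.
  by rewrite normr_ge0 normrX lerXn2r ?nnegrE.
rewrite -mulrBl normrM; case: (a i) => [|n].
  rewrite !expr0 subrr normr0 mul0r !mulr_ge0 // exprn_ge0 //.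
apply: le_trans (ler_pM _ _ (norm_subrX_le n (hsr i) (hr i)) Qle) _ => //.
have -> : (h + s *: delta_mx 0 i) 0 i - h 0 i = s by rewrite !mxE !eqxx mulr1 addrC addKr.
rewrite -!mulrA ler_wpM2l // addSn /= exprD ler_wpM2r ?mulr_ge0 ?exprn_ge0 //.
rewrite ler_nat (leq_trans (ltnW (ltn_expl n.+1 (isT : 1 < 2)%N))) //.
by rewrite leq_exp2l // -addSn leq_addr.
Qed.

(** Increments of the Taylor remainder keep the factor [|s|]. Dividing by [s] and letting it tend to
    0 then bounds the derivative of the remainder without differentiating a series term by term. *)
Lemma series_rep_lipschitz m (f : 'rV[K]_m -> K) p c N :
  series_rep f p c ->
  exists B r0 : K, [/\ 0 < r0, 0 <= B &
    forall rho s (i : 'I_m) (h : 'rV[K]_m), rho <= r0 -> (forall j, `|h 0 j| <= rho) ->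
      (forall j, `|(h + s *: delta_mx 0 i) 0 j| <= rho) ->
      `|(f (p + (h + s *: delta_mx 0 i)) - f (p + h)) -
        \sum_(k < N.+1) (taylor c (fun=> 1%N) k (h + s *: delta_mx 0 i) -
                        taylor c (fun=> 1%N) k h)|
      <= B * (`|s| * rho ^+ N)].
Proof.
move=> /series_rep_bound H; have [//|B [r0 [r00 r01 B0 HB Hs]]] := H (fun=> 1%N).
exists (B * (2 / r0) ^+ N.+1), (r0 / 2); split => //; first by rewrite divr_gt0.
  by rewrite mulr_ge0 // exprn_ge0 // divr_ge0 // ltW.
move=> rho s i h rhole hr hsr; have rho0 : 0 <= rho by apply: le_trans (hr i).
have rr0 : rho <= r0.
  by apply: le_trans rhole _; rewrite ler_pdivrMr // -{1}[r0]mulr1 ler_pM2l // ler1n.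
have [|_ H1] := Hs h; first by move=> j; rewrite expr1 (le_trans (hr j)).
have [|_ H2] := Hs (h + s *: delta_mx 0 i).
  by move=> j; rewrite expr1 (le_trans (hsr j)).
have H3 := cvgB H2 H1.
pose t a := c a * (monomial (h + s *: delta_mx 0 i) a - monomial h a).
have {}H3 : box_sum t @ \oo --> f (p + (h + s *: delta_mx 0 i)) - f (p + h).
  have E : box_sum t = (box_sum (fun a => c a * monomial (h + s *: delta_mx 0 i) a) \-
    box_sum (fun a => c a * monomial h a)).
    by apply/funext => n; rewrite /box_sum /= -sumrB; apply: eq_bigr => a _; rewrite /t mulrBr.
  rewrite E; exact: H3.
rewrite (_ : \sum_(k < N.+1) _ =
   \sum_(k < N.+1) slab_sum (fun=> 1%N) t k.+1 k); last first.
  apply: eq_bigr => k _; rewrite /taylor /slab_sum -sumrB.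
  by apply: eq_bigr => a _; rewrite /t mulrBr.
rewrite -mulrA mulrC; apply: norm_multi_sum_tail HB _ H3 => //.
- by rewrite !mulr_ge0 ?exprn_ge0 ?divr_ge0 // ltW.
- by move=> a; rewrite mulr_ge0 // exprn_ge0 // ltW.
move=> a Na; rewrite /t normrM mulrCA ler_wpM2l //.
apply: le_trans (norm_monomial_diff _ hr hsr) _.
set w := wt _ a in Na *; set d := (w - N.+1)%N.
have wE : w = (d + N.+1)%N by rewrite subnK.
have r0n : r0 ^+ N.+1 != 0 by rewrite expf_neq0 ?lt0r_neq0.
rewrite [leRHS](_ : _ = `|s| * (2 ^+ N.+1 * rho ^+ N * r0 ^+ d)); last first.
  by rewrite wE exprMn exprVn exprD; field.
rewrite ler_wpM2l // wE addnS /= natrX.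
rewrite [leLHS](_ : _ = 2 ^+ N.+1 * rho ^+ N * (2 * rho) ^+ d); last first.
  by rewrite -addnS exprMn !exprD; ring.
rewrite ler_wpM2l ?mulr_ge0 ?exprn_ge0 // lerXn2r ?nnegrE ?mulr_ge0 // ?(ltW r00) //.
by rewrite mulrC -ler_pdivlMr.
Qed.

End PowerSeries.

(** * Partial derivatives read off the power series *)

Section Derivative.
Context {K : numFieldType}.

Lemma monomial_scale m om (s : K) (h : 'rV[K]_m) a :
  monomial (\row_i (s ^+ om i * h 0 i)) a = s ^+ wt om a * monomial h a.
Proof.
rewrite -monomial_wt /monomial -big_split /=.
by apply: eq_bigr => i _; rewrite !mxE exprMn.
Qed.

Lemma taylor_scale m (c : ('I_m -> nat) -> K) om k (s : K) (h : 'rV[K]_m) :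
  taylor c om k (\row_i (s ^+ om i * h 0 i)) = s ^+ k * taylor c om k h.
Proof.
rewrite /taylor /slab_sum mulr_sumr; apply: eq_bigr => a /eqP ak.
by rewrite monomial_scale ak mulrCA.
Qed.

Lemma taylor_scale1 m (c : ('I_m -> nat) -> K) k (s : K) (h : 'rV[K]_m) :
  taylor c (fun=> 1%N) k (s *: h) = s ^+ k * taylor c (fun=> 1%N) k h.
Proof.
by rewrite -taylor_scale; congr taylor; apply/rowP => i; rewrite !mxE expr1.
Qed.

Lemma taylor0 m (c : ('I_m -> nat) -> K) om h :
  taylor c om 0 h = taylor c om 0 (0 : 'rV[K]_m).
Proof.
rewrite /taylor /slab_sum; apply: eq_bigr => a _; congr (_ * _).
by apply: eq_bigr => i _; case: (a i) => -[].
Qed.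

Lemma derive_of_bound m (f : 'rV[K]_m -> K) (p v : 'rV[K]_m) (T B e : K) :
  0 < e -> (forall s, `|s| < e -> `|f (p + s *: v) - f p - s * T| <= B * `|s| ^+ 2) ->
  'D_v f p = T.
Proof.
move=> e0 H; rewrite /derive; apply: cvg_lim; first exact: norm_hausdorff.
apply/cvgrPdist_lt => eps eps0.
have B0 : 0 <= B.
  have e2 : 0 < e / 2 by rewrite divr_gt0.
  have e2e : `|e / 2| < e by rewrite gtr0_norm // ltr_pdivrMr // -{1}[e]mulr1 ltr_pM2l // ltr1n.
  have := le_trans (normr_ge0 _) (H _ e2e).
  by rewrite pmulr_lge0 // exprn_gt0 // gtr0_norm.
(* For positive [a] and [e], the number a e / (a + e) is below both; it stands in for the minimum
   here and in the proofs below. *)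
pose d := eps / (B + 1) * (e / (e + eps / (B + 1))).
have a0 : 0 < eps / (B + 1) by rewrite divr_gt0 // ltr_wpDl.
have q0 : 0 < e + eps / (B + 1) by rewrite addr_gt0.
have d0 : 0 < d by rewrite mulr_gt0 // divr_gt0.
have de : d <= e.
  rewrite /d mulrCA -[leRHS]mulr1 ler_pM2l // ler_pdivrMr // mul1r lerDr ltW //.
have dea : d <= eps / (B + 1).
  by rewrite /d -[leRHS]mulr1 ler_pM2l // ler_pdivrMr // mul1r lerDl ltW.
apply/nbhs_ballP; exists d => //= s; rewrite /ball /= sub0r normrN => sd s0.
have sp : 0 < `|s| by rewrite normr_gt0.
rewrite -(ltr_pM2l sp) -normrM mulrBr.
rewrite [s * (_ *: _)](mulrA s (s^-1)) mulfV // mul1r (addrC (s *: v)) -normrN opprB.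
apply: le_lt_trans (H _ (lt_le_trans sd de)) _.
rewrite expr2 mulrCA ltr_pM2l //.
have := lt_le_trans sd dea; rewrite ltr_pdivlMr ?ltr_wpDl //.
apply: le_lt_trans; rewrite mulrC ler_wpM2l //.
by rewrite lerDl.
Qed.

Lemma series_rep_partial_bound m (f : 'rV[K]_m -> K) p c (i : 'I_m) :
  series_rep f p c ->
  exists B e : K, 0 < e /\ forall s, `|s| < e ->
    `|f (p + s *: delta_mx 0 i) - f p - s * taylor c (fun=> 1%N) 1 (delta_mx 0 i)|
      <= B * `|s| ^+ 2.
Proof.
move=> /series_rep_taylor H; have [//|B [r0 [r00 B0 HB]]] := H (fun=> 1%N).
exists (B / r0 ^+ 2), r0; split=> // s sr.
have E0 : taylor c (fun=> 1%N) 0 (0 : 'rV[K]_m) = f p.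
  have := HB 1%N 0 0; rewrite lexx ltW // addr0 mul0r mulr0 big_ord1 /= => /(_ isT).
  by rewrite normr_le0 subr_eq0 => H1; apply/esym/eqP/H1 => j; rewrite mxE normr0.
have := HB 2%N `|s| (s *: delta_mx 0 i); rewrite normr_ge0 ltW // => /(_ isT).
rewrite !big_ord_recl big_ord0 /= addr0 taylor0 E0 taylor_scale1 expr1 opprD addrA.
rewrite exprMn exprVn mulrA mulrAC; apply => j.
by rewrite !mxE eqxx /= normrM ler_piMr //; case: (_ == _); rewrite ?normr0 ?normr1.
Qed.

Lemma series_rep_partial m (f : 'rV[K]_m -> K) p c (i : 'I_m) :
  series_rep f p c -> partial i f p = taylor c (fun=> 1%N) 1 (delta_mx 0 i).
Proof. by move=> /(series_rep_partial_bound i)[B [e [e0 H]]]; exact: derive_of_bound H. Qed.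

Lemma le_of_le_add_mul (x b B e : K) : 0 <= b -> 0 < e -> 0 <= x ->
  (forall s, 0 < s < e -> x <= b + B * s) -> x <= b.
Proof.
move=> b0 e0 x0 H; rewrite real_leNgt ?ger0_real //; apply/negP => bx.
have g0 : 0 < x - b by rewrite subr_gt0.
have Bs s : 0 < s < e -> x - b <= `|B| * s.
  move=> se; have := H _ se; rewrite -lerBlDl => h.
  have s0 : 0 < s by case/andP: se.
  have : 0 <= B * s by apply: le_trans h; rewrite ltW.
  by move=> /ger0_norm; rewrite normrM (gtr0_norm s0) => ->.
have B1 : 0 < `|B| + 1 by rewrite ltr_wpDl.
pose s := (x - b) / (`|B| + 1) * (e / (e + (x - b) / (`|B| + 1))).
have a0 : 0 < (x - b) / (`|B| + 1) by rewrite divr_gt0.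
have q0 : 0 < e + (x - b) / (`|B| + 1) by rewrite addr_gt0.
have s0 : 0 < s by rewrite mulr_gt0 // divr_gt0.
have se : s < e.
  by rewrite /s mulrCA -[ltRHS]mulr1 ltr_pM2l // ltr_pdivrMr // mul1r ltrDr.
have sx : s < (x - b) / (`|B| + 1).
  by rewrite /s -[ltRHS]mulr1 ltr_pM2l // ltr_pdivrMr // mul1r ltrDl.
have := Bs s; rewrite s0 se => /(_ isT) h.
move: sx; rewrite ltr_pdivlMr // => /lt_le_trans/(_ h).
by rewrite mulrDr mulr1 (mulrC s) gtrDl => /lt_trans/(_ s0); rewrite ltxx.
Qed.

(** At a nearby point the first derivative is the linear coefficient of another series [cq], not
    expressed through [c]. The same increment of [f] is estimated once with [cq] and once with [c],
    and the step [s] is sent to 0. *)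
Lemma series_rep_partial2 m (f : 'rV[K]_m -> K) p c (i : 'I_m) :
  (\forall q \near p, analytic_at f q) -> series_rep f p c ->
  partial i (partial i f) p = 2 * taylor c (fun=> 1%N) 2 (delta_mx 0 i).
Proof.
move=> an fc; have [B [r0 [r00 B0 HB]]] := series_rep_lipschitz 2 fc.
have : \forall h \near (0 : 'rV[K]_m), analytic_at f (p + h).
  by move: an; rewrite (near_shift 0 p) subr0; apply: filterS => h /=; rewrite addrC.
move=> /near0_rowP[e1 e10 He1].
pose e := r0 / 2 * (e1 / (e1 + r0 / 2)).
have a0 : 0 < r0 / 2 by rewrite divr_gt0.
have q0 : 0 < e1 + r0 / 2 by rewrite addr_gt0.
have e0 : 0 < e by rewrite mulr_gt0 // divr_gt0.
have ee1 : e < e1.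
  by rewrite /e mulrCA -[ltRHS]mulr1 ltr_pM2l // ltr_pdivrMr // mul1r ltrDr.
have er0 : e < r0 / 2.
  by rewrite /e -[ltRHS]mulr1 ltr_pM2l // ltr_pdivrMr // mul1r ltrDl.
set dl : 'rV[K]_m := delta_mx 0 i.
have dl1 (s : K) j : `|(s *: dl) 0 j| <= `|s|.
  by rewrite !mxE eqxx /= normrM ler_piMr //; case: (_ == _); rewrite ?normr0 ?normr1.
set T1 := taylor c (fun=> 1%N) 1 dl; set T2 := taylor c (fun=> 1%N) 2 dl.
(* The 4 is 2 ^ 2: the Lipschitz bound is used with exponent 2 on the polydisc of radius [2 |w|],
   which contains both ends of the increment. *)
apply: (@derive_of_bound _ _ _ _ _ (B * 4) e) => // w we.
have -> : partial i f p = T1 by exact: series_rep_partial.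
have [->|w0] := eqVneq w 0.
  rewrite scale0r addr0 mul0r subr0 (series_rep_partial i fc) subrr normr0 expr0n /=.
  by rewrite mulr0.
have wp : 0 < `|w| by rewrite normr_gt0.
have [|cq fcq] := He1 (w *: dl); first by move=> j; rewrite (le_lt_trans (dl1 _ _)) ?(lt_trans we).
rewrite (series_rep_partial i fcq).
have [C [e2 [e20 HC]]] := series_rep_partial_bound i fcq.
set T := taylor cq _ _ _ in HC *.
pose e3 := `|w| * (e2 / (e2 + `|w|)).
have q3 : 0 < e2 + `|w| by rewrite addr_gt0.
have e30 : 0 < e3 by rewrite mulr_gt0 // divr_gt0.
have e3e2 : e3 < e2.
  by rewrite /e3 mulrCA -[ltRHS]mulr1 ltr_pM2l // ltr_pdivrMr // mul1r ltrDr.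
have e3w : e3 < `|w|.
  by rewrite /e3 -[ltRHS]mulr1 ltr_pM2l // ltr_pdivrMr // mul1r ltrDl.
apply: (@le_of_le_add_mul _ _ (C + `|T2|) e3) => //.
  by rewrite !mulr_ge0 // exprn_ge0.
move=> s /andP[s0 se3].
have sn : `|s| = s by rewrite gtr0_norm.
have := HC s; rewrite sn (lt_trans se3 e3e2) => /(_ isT).
have w2 : `|w| * 2 <= r0.
  by rewrite -ler_pdivlMr // ltW // (lt_trans we).
have swdl : w *: dl + s *: dl = (w + s) *: dl by rewrite scalerDl.
have hA j : `|(w *: dl) 0 j| <= `|w| * 2.
  by apply: le_trans (dl1 _ _) _; rewrite ler_peMr // ler1n.
have hB j : `|(w *: dl + s *: dl) 0 j| <= `|w| * 2.
  rewrite swdl; apply: le_trans (dl1 _ _) _; apply: le_trans (ler_normD _ _) _.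
  by rewrite sn mulr_natr mulr2n lerD2l ltW // (lt_trans se3).
have := HB _ s i (w *: dl) w2 hA hB; rewrite swdl.
rewrite !big_ord_recl big_ord0 /= addr0 !taylor_scale1 !expr0 !expr1 -/T1 -/T2.
rewrite -(addrA p) -/dl swdl sn => h1 h2.
rewrite -(ler_pM2l s0) -{1}sn -normrM.
set X := f _ - f _ in h1 h2.
rewrite (_ : s * _ = (X - ((1 * taylor c (fun=> 1%N) 0 dl - 1 * taylor c (fun=> 1%N) 0 dl) +
   ((w + s) * T1 - w * T1 + ((w + s) ^+ 2 * T2 - w ^+ 2 * T2)))) - (X - s * T) + s * s * T2).
  apply: le_trans (ler_normD _ _) _; apply: le_trans (lerD (ler_normB _ _) (lexx _)) _.
  apply: le_trans (lerD (lerD h1 h2) (lexx _)) _.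
  by rewrite !normrM sn exprMn -subr_ge0 (_ : _ - _ = 0) //; ring.
by ring.
Qed.

End Derivative.

(** * Expansions in some variables, the others being parameters *)

Section FiberExpansion.
Context {R : realType}.

Lemma box_sum_widen m (t : ('I_m -> nat) -> R) (N N' : nat) : (N <= N')%N ->
  box_sum t N = \sum_(a : {ffun 'I_m -> 'I_N'} | [forall i, (a i < N)%N]) t (fun i => a i).
Proof.
case: N => [|N] NN'.
  case: m t => [|m] t; last first.
    rewrite /box_sum !big1 // => [a /forallP/(_ ord0)//|a _].
    by have := ltn_ord (a ord0).
  rewrite /box_sum; pose a0 T : {ffun 'I_0 -> T} := finfun (fun i : 'I_0 => match i with Ordinal _ h => False_rect T (notF h) end).
  have aE T (a : {ffun 'I_0 -> T}) : a = a0 T by apply/ffunP => -[].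
  rewrite (big_pred1 (a0 _)) => [|a]; last by rewrite (aE _ a) /= eqxx.
  rewrite [RHS](big_pred1 (a0 _)) => [|a]; last first.
    by rewrite (aE _ a) /= eqxx; apply/forallP => -[].
  by congr t; apply/funext => -[].
pose w (a : {ffun 'I_m -> 'I_N.+1}) : {ffun 'I_m -> 'I_N'} :=
  [ffun i => widen_ord NN' (a i)].
pose u (a : {ffun 'I_m -> 'I_N'}) : {ffun 'I_m -> 'I_N.+1} := [ffun i => inord (a i)].
have wE a : (fun i => w a i : nat) = (fun i => a i : nat).
  by apply/funext => i; rewrite ffunE.
rewrite /box_sum [RHS](reindex_onto w u) /=; last first.
  move=> a /forallP wa; apply/ffunP => i; rewrite !ffunE; apply/val_inj => /=.
  by rewrite inordK // wa.
apply: eq_big => [a|a _]; last by rewrite wE.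
apply/esym/andP; split; first by apply/forallP => i; rewrite ffunE /=.
apply/eqP/ffunP => i.
by rewrite !ffunE; apply/val_inj; rewrite /= inordK.
Qed.

Lemma box_sum_diff_le m (t d : ('I_m -> nat) -> R) (N N' : nat) : (N <= N')%N ->
  (forall a, `|t a| <= d a) ->
  `|box_sum t N' - box_sum t N| <= box_sum d N' - box_sum d N.
Proof.
move=> NN' td; rewrite !(box_sum_widen _ NN') /box_sum.
rewrite (bigID (fun a : {ffun 'I_m -> 'I_N'} => [forall i, (a i < N)%N])) /=.
rewrite addrC addrK.
rewrite [X in _ <= X - _](bigID (fun a : {ffun 'I_m -> 'I_N'} => [forall i, (a i < N)%N])) /=.
rewrite addrAC subrr add0r.
by apply: le_trans (ler_norm_sum _ _ _) _; apply: ler_sum.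
Qed.

Lemma box_sum_cvg m (t d : ('I_m -> nat) -> R) (B : R) :
  (forall a, `|t a| <= d a) -> (forall N, box_sum d N <= B) ->
  exists l : R, box_sum t @ \oo --> l.
Proof.
move=> td dB; have d0 a : 0 <= d a by apply: le_trans (td a).
have dmono N N' : (N <= N')%N -> box_sum d N <= box_sum d N'.
  move=> NN'; rewrite -subr_ge0; apply: le_trans (box_sum_diff_le NN' (t := d) _) => // a.
  by rewrite ger0_norm.
have cd : cvgn (box_sum d).
  apply: nondecreasing_is_cvgn => [N N' /dmono//|].
  by exists B => _ [N _ <-].
(* Adding the majorant makes all terms nonnegative, so monotone convergence applies to [t + d] and
   to [d] separately. *)
have cs : cvgn (fun N => box_sum t N + box_sum d N).
  apply: nondecreasing_is_cvgn => [N N' NN'|].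
    rewrite -subr_ge0; have := box_sum_diff_le NN' td.
    rewrite ler_norml => /andP[h _]; move: h; rewrite -subr_ge0.
    by congr (_ <= _); ring.
  exists (B + B) => _ [N _ <-]; apply: lerD => //.
  apply: le_trans (dB N); apply: le_trans (ler_norm _) _.
  by apply: le_trans (ler_norm_sum _ _ _) _; apply: ler_sum.
have Hc := cvgB cs cd _.
have E : box_sum t = (fun N => box_sum t N + box_sum d N) \- box_sum d.
  by apply/funext => N /=; rewrite addrK.
by rewrite E; eexists; exact: Hc.
Qed.

(** Weights may be 0 here: the variables of weight 0 are parameters, each slab is an infinite
    series, and the coefficients [q] are its limits. The constant [C] comes before [h], hence is
    uniform in the parameters. *)
Lemma fiber_expansion m (Phi : 'rV[R]_m -> R) p c (om : 'I_m -> nat) :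
  series_rep Phi p c ->
  exists2 e : R, 0 < e & forall N, exists C : R, forall h : 'rV[R]_m,
    (forall i, `|h 0 i| <= e) -> exists q : nat -> R, forall s : R, 0 <= s <= 1 ->
    `|Phi (p + \row_i (s ^+ om i * h 0 i)) - \sum_(d < N) s ^+ d * q d| <= C * s ^+ N.
Proof.
move=> /series_rep_bound H; have [//|B [r0 [r00 r01 B0 HB Hs]]] := H (fun=> 1%N).
exists r0 => // N; exists B => h hr.
pose dd (a : 'I_m -> nat) := `|c a| * r0 ^+ wt (fun=> 1%N) a.
have dd0 a : 0 <= dd a by rewrite mulr_ge0 // exprn_ge0 // ltW.
have hdd a : `|c a * monomial h a| <= dd a.
  by rewrite normrM ler_wpM2l // norm_monomial_le // => i; rewrite expr1.
pose tk k (a : 'I_m -> nat) := if wt om a == k then c a * monomial h a else 0.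
have tkE k n : box_sum (tk k) n = slab_sum om (fun a => c a * monomial h a) n k.
  by rewrite /box_sum /slab_sum [RHS]big_mkcond.
have tkd k a : `|tk k a| <= dd a by rewrite /tk; case: ifP => _ //; rewrite normr0.
have ex k := box_sum_cvg (tkd k) HB.
have /choice[q Hq] : forall k, exists l : R, box_sum (tk k) @ \oo --> l by [].
exists q => s /andP[s0 s1].
pose t (a : 'I_m -> nat) := c a * monomial (\row_i (s ^+ om i * h 0 i)) a.
have tE a : t a = s ^+ wt om a * (c a * monomial h a).
  by rewrite /t monomial_scale mulrCA.
have [|_ Hl] := Hs (\row_i (s ^+ om i * h 0 i)).
  move=> i; rewrite mxE normrM expr1 ger0_norm ?exprn_ge0 //.
  apply: le_trans (hr i); rewrite ler_piMl //.
  by apply: exprn_ile1.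
have Hsum : (fun n => \sum_(d < N) s ^+ d * box_sum (tk d) n) @ \oo -->
    \sum_(d < N) s ^+ d * q d.
  elim: N => [|N IH].
    rewrite big_ord0 (_ : (fun n => _) = (fun=> 0)); first exact: cvg_cst.
    by apply/funext => n; rewrite big_ord0.
  rewrite big_ord_recr /= (_ : (fun n => _) = (fun n => (\sum_(d < N) s ^+ d * box_sum (tk d) n)
     + s ^+ N * box_sum (tk N) n)); last by apply/funext => n; rewrite big_ord_recr.
  by apply: cvgD IH _; apply: cvgMl_tmp; exact: Hq.
have HD : (fun n => box_sum t n - \sum_(d < N) s ^+ d * box_sum (tk d) n) @ \oo -->
    Phi (p + \row_i (s ^+ om i * h 0 i)) - \sum_(d < N) s ^+ d * q d.
  exact: cvgB Hl Hsum.
rewrite -[X in `|X|]subr0.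
refine (@norm_lim_le _ (fun n => box_sum t n - \sum_(d < N) s ^+ d * box_sum (tk d) n) _ 0 _ _ HD _).
  by rewrite mulr_ge0 // exprn_ge0.
exists 0%N => n _; rewrite subr0 /=.
have := @norm_box_sum_tail _ _ om t dd n N (s ^+ N) B.
rewrite exprn_ge0 // mulrC => /(_ isT dd0 (HB n)).
rewrite (_ : \sum_(k < N) slab_sum om t n k = \sum_(d < N) s ^+ d * box_sum (tk d) n).
  apply=> a Na; rewrite tE normrM ger0_norm ?exprn_ge0 //.
  by apply: ler_pM => //; rewrite ?exprn_ge0 // ler_wiXn2l.
apply: eq_bigr => d _; rewrite tkE /slab_sum mulr_sumr; apply: eq_bigr => a /eqP ad.
by rewrite tE ad.
Qed.

End FiberExpansion.

(** * Orders of vanishing and weighted jets *)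

Section Vanish.
Context {R : realType}.
Local Notation C := R[i].

Definition vanish (k : nat) (phi : R -> C) : Prop :=
  exists B : R, \forall r \near 0^'+, `|phi r| <= (B * r ^+ k)%:C.

Lemma vanish_ge0 k phi : vanish k phi ->
  exists B : R, 0 <= B /\ \forall r \near 0^'+, `|phi r| <= (B * r ^+ k)%:C.
Proof.
move=> [B HB]; exists `|B|; split => //; near=> r.
apply: (@le_trans _ _ (B * r ^+ k)%:C); first by near: r.
rewrite lecR ler_wpM2r ?ler_norm // exprn_ge0 // ltW //.
Unshelve. all: by end_near. Qed.

Lemma vanish_near k (phi psi : R -> C) :
  (\forall r \near 0^'+, phi r = psi r) -> vanish k phi -> vanish k psi.
Proof.
move=> E [B HB]; exists B; near=> r.
have <- : phi r = psi r by near: r.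
by near: r.
Unshelve. all: by end_near. Qed.

Lemma vanish_ext k (phi psi : R -> C) :
  (forall r, phi r = psi r) -> vanish k phi -> vanish k psi.
Proof. by move=> E; have -> : phi = psi by apply/funext. Qed.

Lemma vanishD k phi psi : vanish k phi -> vanish k psi ->
  vanish k (fun r => phi r + psi r).
Proof.
move=> [B HB] [D HD]; exists (B + D); near=> r.
rewrite mulrDl rmorphD /=; apply: le_trans (ler_normD _ _) _.
by apply: lerD; near: r.
Unshelve. all: by end_near. Qed.

Lemma vanishN k phi : vanish k phi -> vanish k (fun r => - phi r).
Proof. by move=> [B HB]; exists B; apply: filterS HB => r; rewrite normrN. Qed.

Lemma vanishB k phi psi : vanish k phi -> vanish k psi ->
  vanish k (fun r => phi r - psi r).
Proof. by move=> h1 h2; apply: vanishD => //; exact: vanishN. Qed.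

Lemma vanish_trans k phi chi psi : vanish k (fun r => phi r - chi r) ->
  vanish k (fun r => chi r - psi r) -> vanish k (fun r => phi r - psi r).
Proof. by move=> h1 h2; apply: vanish_ext (vanishD h1 h2) => r; rewrite addrA subrK. Qed.

Lemma vanishM j k phi psi : vanish j phi -> vanish k psi ->
  vanish (j + k) (fun r => phi r * psi r).
Proof.
move=> [B HB] [D HD]; exists (B * D); near=> r.
rewrite normrM; have -> : B * D * r ^+ (j + k) = (B * r ^+ j) * (D * r ^+ k).
  by rewrite exprD; ring.
by rewrite rmorphM /=; apply: ler_pM => //; near: r.
Unshelve. all: by end_near. Qed.

Lemma vanish_cst c : vanish 0 (fun=> c).
Proof.
exists (complex.Re `|c|); near=> r; rewrite expr0 mulr1 RRe_real //.
Unshelve. all: by end_near. Qed.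

Lemma vanishZ k c phi : vanish k phi -> vanish k (fun r => c * phi r).
Proof. by move=> h; rewrite -[k]add0n; apply: vanishM => //; exact: vanish_cst. Qed.

Lemma vanish0 k : vanish k (fun=> 0).
Proof. by exists 0; near=> r; rewrite normr0 mul0r. Unshelve. all: by end_near. Qed.

Lemma vanish_X k : vanish k (fun r => r%:C ^+ k).
Proof.
exists 1; near=> r; rewrite mul1r -rmorphXn /= ger0_norm // ler0c exprn_ge0 // ltW //.
Unshelve. all: by end_near. Qed.

Lemma vanish_le j k phi : (j <= k)%N -> vanish k phi -> vanish j phi.
Proof.
move=> jk /vanish_ge0[B [B0 HB]]; exists B; near=> r.
have r0 : 0 < r by near: r; exact: nbhs_right_gt.
have r1 : r < 1 by near: r; apply: nbhs_right_lt.
apply: (@le_trans _ _ (B * r ^+ k)%:C); first by near: r.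
by rewrite lecR ler_wpM2l // ler_wiXn2l // ltW.
Unshelve. all: by end_near. Qed.

Lemma vanish_sum (I : Type) (s : seq I) (P : pred I) k (phi : I -> R -> C) :
  (forall i, P i -> vanish k (phi i)) -> vanish k (fun r => \sum_(i <- s | P i) phi i r).
Proof.
move=> H; elim: s => [|i s IH].
  by apply: vanish_ext (vanish0 k) => r; rewrite big_nil.
case Pi: (P i); last by apply: vanish_ext IH => r; rewrite big_cons Pi.
by apply: vanish_ext (vanishD (H i Pi) IH) => r; rewrite big_cons Pi.
Qed.

Lemma vanish_conj k phi : vanish k phi -> vanish k (fun r => conjc (phi r)).
Proof. by move=> [B HB]; exists B; apply: filterS HB => r; rewrite normcJ. Qed.

Lemma vanish_Re k phi : vanish k phi -> vanish k (fun r => (complex.Re (phi r))%:C).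
Proof.
move=> h; have := vanishZ (2%:R^-1) (vanishD h (vanish_conj h)).
by apply: vanish_ext => r; rewrite ReJ_add mulrC.
Qed.

Lemma vanish_Im k phi : vanish k phi -> vanish k (fun r => (complex.Im (phi r))%:C).
Proof.
move=> h; have := vanishZ (2%:R^-1 * 'i) (vanishB (vanish_conj h) h).
by apply: vanish_ext => r; rewrite ImJ_sub mulrC mulrA.
Qed.

Lemma vanish_lt1 phi (e : R) : vanish 1 phi -> 0 < e ->
  \forall r \near 0^'+, `|phi r| < e%:C.
Proof.
move=> /vanish_ge0[B [B0 HB]] e0; near=> r.
have r0 : 0 < r by near: r; exact: nbhs_right_gt.
apply: (@le_lt_trans _ _ (B * r ^+ 1)%:C); first by near: r.
rewrite ltcR expr1; have : r < e / (B + 1).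
  by near: r; apply: nbhs_right_lt; rewrite divr_gt0 // ltr_wpDl.
rewrite ltr_pdivlMr ?ltr_wpDl // mulrDr mulr1 mulrC; apply: le_lt_trans.
by rewrite lerDl ltW.
Unshelve. all: by end_near. Qed.

Lemma vanish_lead k (a : C) : vanish k.+1 (fun r => r%:C ^+ k * a) -> a = 0.
Proof.
move=> /vanish_ge0[B [B0 HB]]; apply/eqP; rewrite -normr_eq0.
have nr : `|a| = (complex.Re `|a|)%:C by rewrite RRe_real // realE normr_ge0.
rewrite nr; apply/eqP; congr (_%:C); apply/eqP.
rewrite eq_le; apply/andP; split; last by rewrite -ler0c -nr.
apply/ler_addgt0Pr => e e0; rewrite add0r.
near (0:R)^'+ => r.
have r0 : 0 < r by near: r; exact: nbhs_right_gt.
have re : r < e / (B + 1).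
  by near: r; apply: nbhs_right_lt; rewrite divr_gt0 // ltr_wpDl.
have : `|r%:C ^+ k * a| <= (B * r ^+ k.+1)%:C by near: r.
rewrite normrM -rmorphXn /= ger0_norm ?ler0c ?exprn_ge0 ?(ltW r0) // nr -rmorphM lecR.
rewrite (_ : B * r ^+ k.+1 = r ^+ k * (r * B)); last by rewrite exprS; ring.
rewrite ler_pM2l ?exprn_gt0 // => h; apply: le_trans h _.
move: re; rewrite ltr_pdivlMr ?ltr_wpDl // => /ltW; apply: le_trans.
by rewrite mulrDr mulr1 mulrC lerDl ltW.
Unshelve. all: by end_near. Qed.

Lemma vanish_coef N (a : nat -> C) :
  vanish N (fun r => \sum_(k < N) r%:C ^+ k * a k) -> forall k, (k < N)%N -> a k = 0.
Proof.
move=> H k; elim/ltn_ind: k => k IH kN; apply: (@vanish_lead k).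
have := vanish_le kN H => {}H.
have H2 : vanish k.+1 (fun r => \sum_(j < N | (k < j)%N) r%:C ^+ j * a j).
  apply: vanish_sum => j kj; apply: (vanish_le kj).
  by rewrite -[X in vanish X]addn0; apply: vanishM; [exact: vanish_X|exact: vanish_cst].
apply: vanish_ext (vanishB H H2) => r.
rewrite [X in X - _](bigID (fun j : 'I_N => (k < j)%N)) /= addrAC subrr add0r.
rewrite (bigD1 (Ordinal kN)) //= ?ltnn // big1 ?addr0 // => j /andP[jk /eqP jne].
rewrite IH ?mulr0 //; rewrite ltn_neqAle leqNgt jk andbT; apply/eqP => e.
by apply: jne; apply/val_inj.
Qed.

End Vanish.

(** * Weighted homogeneous polynomials along curves, and jets *)

Section GradedPolynomials.
Context {R : realType}.
Local Notation C := R[i].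

(* Weighted homogeneous polynomial functions of degree [k] in the functions
   [x i], where [x i] has weight [om i]. *)
Inductive gpoly (T I : Type) (x : I -> T -> C) (om : I -> nat) : nat -> (T -> C) -> Prop :=
| gpoly_cst c : gpoly x om 0 (fun=> c)
| gpoly0 k : gpoly x om k (fun=> 0)
| gpoly_gen i : gpoly x om (om i) (x i)
| gpolyD k f g : gpoly x om k f -> gpoly x om k g -> gpoly x om k (fun t => f t + g t)
| gpolyM j k f g : gpoly x om j f -> gpoly x om k g ->
    gpoly x om (j + k) (fun t => f t * g t).

Lemma gpoly_ext T I (x : I -> T -> C) om k f g :
  f =1 g -> gpoly x om k f -> gpoly x om k g.
Proof. by move=> /funext ->. Qed.

Lemma gpolyZ T I (x : I -> T -> C) om k c f :
  gpoly x om k f -> gpoly x om k (fun t => c * f t).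
Proof. by move=> h; rewrite -[k]add0n; apply: gpolyM => //; exact: gpoly_cst. Qed.

Lemma gpolyB T I (x : I -> T -> C) om k f g :
  gpoly x om k f -> gpoly x om k g -> gpoly x om k (fun t => f t - g t).
Proof.
move=> h1 h2; apply: gpoly_ext (gpolyD h1 (gpolyZ (-1) h2)) => t.
by rewrite mulN1r.
Qed.

Lemma gpoly_sum T I (x : I -> T -> C) om k J (s : seq J) (P : pred J) (f : J -> T -> C) :
  (forall j, P j -> gpoly x om k (f j)) ->
  gpoly x om k (fun t => \sum_(j <- s | P j) f j t).
Proof.
move=> H; elim: s => [|i s IH].
  by apply: gpoly_ext (gpoly0 _ _ k) => r; rewrite big_nil.
case Pi: (P i); last by apply: gpoly_ext IH => r; rewrite big_cons Pi.
by apply: gpoly_ext (gpolyD (H i Pi) IH) => r; rewrite big_cons Pi.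
Qed.

Lemma gpolyX T I (x : I -> T -> C) om k f n :
  gpoly x om k f -> gpoly x om (k * n) (fun t => f t ^+ n).
Proof.
move=> h; elim: n => [|n IH].
  by rewrite muln0; apply: gpoly_ext (gpoly_cst _ _ 1) => t; rewrite expr0.
by rewrite mulnS; apply: gpoly_ext (gpolyM h IH) => t; rewrite exprS.
Qed.

Lemma gpoly_monomial T m (x : 'I_m -> T -> C) om (a : 'I_m -> nat) :
  gpoly x om (wt om a) (fun t => \prod_(i < m) x i t ^+ a i).
Proof.
rewrite /wt; elim: (index_enum _) => [|i s IH].
  by rewrite big_nil; apply: gpoly_ext (gpoly_cst _ _ 1) => t; rewrite big_nil.
rewrite big_cons; have h := gpolyX (a i) (gpoly_gen x om i).
by apply: gpoly_ext (gpolyM h IH) => t; rewrite big_cons.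
Qed.

Lemma gpoly_subst T S I J (x : I -> T -> C) om (y : J -> S -> C) om' (th : S -> T) k f :
  (forall i, gpoly y om' (om i) (fun s => x i (th s))) ->
  gpoly x om k f -> gpoly y om' k (fun s => f (th s)).
Proof.
move=> H; elim=> {k f} [c|k|i|k f g _ h1 _ h2|j k f g _ h1 _ h2] //.
- exact: gpoly_cst.
- exact: gpoly0.
- exact: gpolyD.
- exact: gpolyM.
Qed.

Lemma gpoly_vanish T I (x : I -> T -> C) om k f (h : R -> T) :
  (forall i, vanish (om i) (fun r => x i (h r))) ->
  gpoly x om k f -> vanish k (fun r => f (h r)).
Proof.
move=> H; elim=> {k f} [c|k|i|k f g _ h1 _ h2|j k f g _ h1 _ h2] //.
- exact: vanish_cst.
- exact: vanish0.
- exact: vanishD.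
- exact: vanishM.
Qed.

(** An error of relative order [d] in every generator gives relative order [d] in every polynomial,
    by f' g' - f g = (f' - f) g' + f (g' - g). *)
Lemma gpoly_perturb T I (x : I -> T -> C) om d k f (h h' : R -> T) :
  (forall i, vanish (om i) (fun r => x i (h r))) ->
  (forall i, vanish (om i + d) (fun r => x i (h' r) - x i (h r))) ->
  gpoly x om k f -> vanish (k + d) (fun r => f (h' r) - f (h r)).
Proof.
move=> H1 H2.
have H3 i : vanish (om i) (fun r => x i (h' r)).
  apply: vanish_ext (vanishD (vanish_le (leq_addr d _) (H2 i)) (H1 i)) => r.
  by rewrite subrK.
elim=> {k f} [c|k|i|k f g _ h1 _ h2|j k f g hf h1 hg h2] //.
- by apply: vanish_ext (vanish0 _) => r; rewrite subrr.
- by apply: vanish_ext (vanish0 _) => r; rewrite subrr.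
- by apply: vanish_ext (vanishD h1 h2) => r; ring.
- have a1 := vanishM h1 (gpoly_vanish H3 hg).
  have a2 := vanishM (gpoly_vanish H1 hf) h2.
  rewrite addnAC in a1; rewrite addnA in a2.
  by apply: vanish_ext (vanishD a1 a2) => r; ring.
Qed.

Lemma gpoly_scale T I (x : I -> T -> C) om k f (s : C) (p q : T) :
  (forall i, x i q = s ^+ om i * x i p) -> gpoly x om k f -> f q = s ^+ k * f p.
Proof.
move=> H; elim=> {k f} [c|k|i|k f g _ h1 _ h2|j k f g _ h1 _ h2] //.
- by rewrite mul1r.
- by rewrite mulr0.
- by rewrite h1 h2 mulrDr.
- by rewrite h1 h2 exprD; ring.
Qed.

Lemma gpoly_line T I (x : I -> T -> C) om k f (p : C -> T) :
  (forall i, exists P : {poly C}, forall s, x i (p s) = P.[s]) ->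
  gpoly x om k f -> exists P : {poly C}, forall s, f (p s) = P.[s].
Proof.
move=> H; elim=> {k f} [c|k|i|k f g _ [P h1] _ [Q h2]|j k f g _ [P h1] _ [Q h2]] //.
- by exists c%:P => s; rewrite hornerC.
- by exists 0 => s; rewrite horner0.
- by exists (P + Q) => s; rewrite hornerD h1 h2.
- by exists (P * Q) => s; rewrite hornerM h1 h2.
Qed.

Lemma gpoly_deg0 T I (x : I -> T -> C) om f : (forall i, 0 < om i)%N ->
  gpoly x om 0 f -> exists c, forall t, f t = c.
Proof.
move=> om0; move: {-2}0%N (erefl 0%N) => k k0; move=> h.
elim: h k0 => {k f} [c|k|i|k f g _ h1 _ h2|j k f g _ h1 _ h2] k0.
- by exists c.
- by exists 0.
- by have := om0 i; rewrite k0.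
- by have [c Hc] := h1 k0; have [d Hd] := h2 k0; exists (c + d) => t; rewrite Hc Hd.
- move/eqP: k0; rewrite addn_eq0 => /andP[/eqP j0 /eqP k0].
  have [c Hc] := h1 j0; have [d Hd] := h2 k0.
  by exists (c * d) => t; rewrite Hc Hd.
Qed.

Lemma gpoly_deg1 T m (x : 'I_m -> T -> C) om f : (forall i, 0 < om i)%N ->
  gpoly x om 1 f ->
  exists b : 'I_m -> C, forall t, f t = \sum_(i < m | om i == 1%N) b i * x i t.
Proof.
move=> om0; move: {-2}1%N (erefl 1%N) => k k1; move=> h.
elim: h k1 => {k f} [c|k|i|k f g _ h1 _ h2|j k f g hf h1 hg h2] k1.
- by discriminate k1.
- by exists (fun=> 0) => t; rewrite big1 // => i _; rewrite mul0r.
- exists (fun j => (j == i)%:R) => t; rewrite (bigD1 i) /= ?eqxx ?mul1r ?k1 //.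
  by rewrite big1 ?addr0 // => j /andP[_ /negPf ->]; rewrite mul0r.
- have [c Hc] := h1 k1; have [d Hd] := h2 k1; exists (fun i => c i + d i) => t.
  by rewrite Hc Hd -big_split; apply: eq_bigr => i _; rewrite mulrDl.
- case: j hf h1 k1 => [|[|j]] hf h1 k1; last by discriminate k1.
    have [c Hc] := gpoly_deg0 om0 hf; have [d Hd] := h2 k1.
    exists (fun i => c * d i) => t.
    by rewrite Hc Hd mulr_sumr; apply: eq_bigr => i _; rewrite mulrA.
  have k0 : k = 0%N by case: k1.
  rewrite k0 in hg.
  have [c Hc] := gpoly_deg0 om0 hg; have [d Hd] := h1 erefl.
  exists (fun i => c * d i) => t.
  by rewrite Hc Hd [LHS]mulrC mulr_sumr k1; apply: eq_bigr => i _; rewrite mulrA.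
Qed.

(** Points and coordinate functions are abstract so that complex points and real coordinate vectors
    are treated alike. As in [series_rep_taylor], one pair [B], [r0] serves all orders. *)
Definition has_jet (T : Type) m (x : 'I_m -> T -> C) (om : 'I_m -> nat)
    (f : T -> C) (F : nat -> T -> C) : Prop :=
  (forall k, gpoly x om k (F k)) /\
  exists B r0 : R, 0 < r0 /\ forall N (r : R) t, 0 <= r <= r0 ->
    (forall i, `|x i t| <= (r ^+ om i)%:C) ->
    `|f t - \sum_(k < N) F k t| <= (B * (r / r0) ^+ N)%:C.

Lemma lec0_real (x : C) : 0 <= x -> exists2 r : R, 0 <= r & x = r%:C.
Proof.
move=> x0; have xr : (complex.Re x)%:C = x by rewrite RRe_real // ger0_real.
by exists (complex.Re x) => //; rewrite -ler0c xr.
Qed.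

Lemma ltc0_real (x : C) : 0 < x -> exists2 r : R, 0 < r & x = r%:C.
Proof.
move=> x0; have [r _ E] := lec0_real (ltW x0); exists r => //.
by rewrite -ltcR -E.
Qed.

Lemma series_rep_jetC m (f : 'rV[C]_m -> C) p c (om : 'I_m -> nat) :
  series_rep f p c -> (forall i, 0 < om i)%N ->
  has_jet (fun i (h : 'rV[C]_m) => h 0 i) om (fun h => f (p + h)) (taylor c om).
Proof.
move=> fc om0; split=> [k|].
  apply: gpoly_sum => a /eqP ak; apply: gpolyZ.
  by rewrite -[X in gpoly _ _ X]ak; exact: gpoly_monomial.
have [B [r0 [/ltc0_real[r1 r10 ->] /lec0_real[b b0 ->] H]]] := series_rep_taylor fc om0.
exists b, r1; split=> // N r t /andP[r0' r1'] tr.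
rewrite rmorphM rmorphXn fmorph_div; apply: H; first by rewrite ler0c r0' lecR.
by move=> i; rewrite -rmorphXn; exact: tr.
Qed.

Lemma series_rep_jetR m (f : 'rV[R]_m -> R) p c (om : 'I_m -> nat) :
  series_rep f p c -> (forall i, 0 < om i)%N ->
  has_jet (fun i (h : 'rV[R]_m) => (h 0 i)%:C) om (fun h => (f (p + h))%:C)
    (fun k h => (taylor c om k h)%:C).
Proof.
move=> fc om0; split=> [k|].
  apply: (@gpoly_ext _ _ _ _ _ (fun h : 'rV[R]_m => \sum_(a : {ffun 'I_m -> 'I_k.+1}
      | wt om (fun i => a i) == k) (c (fun i => a i))%:C * \prod_(i < m) (h 0 i)%:C ^+ a i)).
    move=> h; rewrite /taylor /slab_sum rmorph_sum; apply: eq_bigr => a _.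
    rewrite rmorphM /monomial rmorph_prod; congr (_ * _); apply: eq_bigr => i _.
    by rewrite rmorphXn.
  apply: gpoly_sum => a /eqP ak; apply: gpolyZ.
  rewrite -[X in gpoly _ _ X]ak; exact: (@gpoly_monomial _ _ (fun i (h : 'rV[R]_m) => (h 0 i)%:C)).
have nC (y : R) : `|y%:C| = `|y|%:C :> C by rewrite normc_def /= expr0n /= addr0 sqrtr_sqr.
have [B [r0 [r10 b0 H]]] := series_rep_taylor fc om0.
exists B, r0; split=> // N r t rr tr.
rewrite -rmorph_sum -rmorphB nC lecR; apply: H => // i.
by rewrite -lecR -nC.
Qed.

Lemma has_jetB T m (x : 'I_m -> T -> C) om f g F G :
  has_jet x om f F -> has_jet x om g G ->
  has_jet x om (fun t => f t - g t) (fun k t => F k t - G k t).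
Proof.
move=> [gF [B [r0 [r00 HB]]]] [gG [D [s0 [s00 HD]]]]; split => [k|].
  exact: gpolyB.
pose m0 := Num.min r0 s0.
have m00 : 0 < m0 by rewrite lt_min r00.
exists (`|B| + `|D|), m0; split => // N r t /andP[r1 rm] xt.
have rr : r <= r0 by apply: le_trans rm _; rewrite ge_min lexx.
have rs : r <= s0 by apply: le_trans rm _; rewrite ge_min lexx orbT.
rewrite sumrB opprB addrACA -opprB opprK.
rewrite (_ : _ + _ = (f t - \sum_(k < N) F k t) - (g t - \sum_(k < N) G k t)); last by ring.
apply: le_trans (ler_normB _ _) _; rewrite mulrDl rmorphD /=.
have aux (E s1 : R) : m0 <= s1 -> 0 < s1 -> E * (r / s1) ^+ N <= `|E| * (r / m0) ^+ N.
  move=> ms s10; apply: (@le_trans _ _ (`|E| * (r / s1) ^+ N)).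
    by rewrite ler_wpM2r ?ler_norm // exprn_ge0 // divr_ge0 // ltW.
  rewrite ler_wpM2l // lerXn2r ?nnegrE ?divr_ge0 ?(ltW s10) ?(ltW m00) //.
  by rewrite ler_wpM2l // lef_pV2.
apply: lerD.
  apply: le_trans (HB N r t _ xt) _; first by rewrite r1.
  by rewrite lecR; apply: aux => //; rewrite ge_min lexx.
apply: le_trans (HD N r t _ xt) _; first by rewrite r1.
by rewrite lecR; apply: aux => //; rewrite ge_min lexx orbT.
Qed.

Lemma curve_bound T m (x : 'I_m -> T -> C) om (h : R -> T) : (forall i, 0 < om i)%N ->
  (forall i, vanish (om i) (fun r => x i (h r))) ->
  exists2 A : R, 0 < A & \forall r \near 0^'+, forall i, `|x i (h r)| <= ((A * r) ^+ om i)%:C.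
Proof.
move=> om0 H; have /choice[B HB] := fun i => vanish_ge0 (H i).
pose A := 1 + \sum_i B i.
have A1 : 1 <= A by rewrite lerDl; apply: sumr_ge0 => i _; have [] := HB i.
have A0 : 0 < A by apply: lt_le_trans A1.
exists A => //; apply: filter_forall => i; have [Bi0 Hi] := HB i; near=> r.
have r0 : 0 < r by near: r; exact: nbhs_right_gt.
apply: (@le_trans _ _ (B i * r ^+ om i)%:C); first by near: r.
rewrite lecR exprMn ler_wpM2r ?exprn_ge0 ?(ltW r0) //.
apply: (@le_trans _ _ A).
  rewrite /A (bigD1 i) //= addrCA lerDl addr_ge0 //.
  by apply: sumr_ge0 => j _; have [] := HB j.
by rewrite -[leLHS]expr1 ler_weXn2l.
Unshelve. all: by end_near. Qed.

Lemma jet_vanish T m (x : 'I_m -> T -> C) om f F (h : R -> T) N :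
  (forall i, 0 < om i)%N -> has_jet x om f F ->
  (forall i, vanish (om i) (fun r => x i (h r))) ->
  vanish N (fun r => f (h r) - \sum_(k < N) F k (h r)).
Proof.
move=> om0 [_ [B [r0 [r00 H]]]] /(curve_bound om0)[A A0 HA].
exists (B * (A / r0) ^+ N); near=> r.
have rp : 0 < r by near: r; exact: nbhs_right_gt.
have r1 : r < r0 / A by near: r; apply: nbhs_right_lt; rewrite divr_gt0.
have := H N (A * r) (h r); rewrite mulr_ge0 ?(ltW rp) ?(ltW A0) //=.
rewrite mulrC -ler_pdivlMr // ltW // => /(_ isT).
rewrite -mulrA -exprMn (_ : A / r0 * r = r * A / r0); last by ring.
by apply=> i; rewrite mulrC; move: i; near: r.
Unshelve. all: by end_near. Qed.

(** At half the radius the truncation errors are at most [|B| 2^-N] for every [N], and nothing is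
    subtracted when all components vanish. This plays the part of the identity theorem for germs. *)
Lemma jet_flat T m (x : 'I_m -> T -> C) om f F :
  (forall i, 0 < om i)%N -> has_jet x om f F -> (forall k t, F k t = 0) ->
  exists2 e : R, 0 < e & forall t, (forall i, `|x i t| <= (e ^+ om i)%:C) -> f t = 0.
Proof.
move=> om0 [_ [B [r0 [r00 H]]]] F0; exists (r0 / 2); first by rewrite divr_gt0.
move=> t xt; apply/eqP; rewrite -normr_eq0.
have [y y0 E] := lec0_real (normr_ge0 (f t)).
have HN N : y <= `|B| * 2^-1 ^+ N.
  have := H N (r0 / 2) t; rewrite divr_ge0 ?(ltW r00) //= ler_pdivrMr //.
  rewrite -{1}[r0]mulr1 ler_pM2l // ler1n => /(_ isT xt).
  rewrite big1 // subr0 E lecR => /le_trans; apply.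
  rewrite (_ : r0 / 2 / r0 = 2^-1); last by field; rewrite lt0r_neq0.
  by rewrite ler_wpM2r ?ler_norm // exprn_ge0.
suff : y <= 0 by rewrite E => yle; apply/eqP; congr (_%:C); apply: le_anti; rewrite yle.
apply/ler_addgt0Pr => e e0; rewrite add0r.
have c0 : `|B| * (2^-1 : R) ^+ n @[n --> \oo] --> (0 : R).
  by rewrite -(mulr0 `|B|); apply: cvgMl_tmp; apply: cvg_expr; rewrite ger0_norm // invf_lt1 // ltr1n.
move/cvgrPdist_lt: c0 => /(_ e e0)[n _ Hn].
have := Hn n (leqnn n); rewrite /= sub0r normrN ger0_norm ?mulr_ge0 ?exprn_ge0 // => /ltW.
exact: le_trans.
Qed.

End GradedPolynomials.

(** * Extraction of coefficients by interpolation *)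

Section Coefficients.

Lemma vander_inverse (F : fieldType) N (a : 'I_N -> F) : injective a ->
  exists e : 'I_N -> 'I_N -> F, forall (X : 'I_N -> F) j,
    X j = \sum_i e i j * \sum_(k < N) a i ^+ k * X k.
Proof.
move=> ainj; pose V := Vandermonde N (\row_i a i).
have uV : V \in unitmx.
  rewrite unitmxE det_Vandermonde unitfE; apply/prodf_neq0 => i _.
  apply/prodf_neq0 => j ij; rewrite !mxE subr_eq0; apply/negP => /eqP/ainj ji.
  by rewrite ji ltnn in ij.
exists (fun i j => invmx V i j) => X j.
have := congr1 (fun A : 'rV_N => A 0 j) (mulmxK uV (\row_k X k)).
rewrite mxE [RHS]mxE => <-; apply: eq_bigr => i _; rewrite mulrC; congr (_ * _).
by rewrite mxE; apply: eq_bigr => k _; rewrite !mxE mulrC.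
Qed.

(** The weights [e] depend on the degree bound only, not on the polynomial; differentiation can thus
    become a fixed combination of values. *)
Lemma coef_comb (F : numFieldType) N :
  exists e : 'I_N -> 'I_N -> F, forall (P : {poly F}), (size P <= N)%N ->
    forall j : 'I_N, P`_j = \sum_i e i j * P.[i%:R].
Proof.
have inj : injective (fun i : 'I_N => i%:R : F).
  by move=> i j /eqP; rewrite eqr_nat => /eqP/val_inj.
have [e He] := vander_inverse inj; exists e => P sP j.
rewrite (He (fun k => P`_k)); apply: eq_bigr => i _; congr (_ * _).
by rewrite (horner_coef_wide _ sP); apply: eq_bigr => k _; rewrite mulrC.
Qed.

Context {R : realType}.
Local Notation C := R[i].

Lemma vanish_vander N k (a : 'I_N -> C) (X : 'I_N -> R -> C) : injective a ->
  (forall i, vanish k (fun r => \sum_(j < N) a i ^+ j * X j r)) ->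
  forall j, vanish k (X j).
Proof.
move=> ainj H j; have [e He] := vander_inverse ainj.
apply: vanish_ext (_ : vanish k (fun r => \sum_i e i j * \sum_(l < N) a i ^+ l * X l r)).
  by move=> r; rewrite -(He (fun l => X l r)).
by apply: vanish_sum => i _; apply: vanishZ.
Qed.

(** Integer multiples of a fixed [l] separate the total degrees s + t; inside one total degree, the
    ratios l / conj l separate [s]. Each separation inverts a Vandermonde matrix, so orders of
    vanishing are preserved. *)
Lemma vanish_bidegree N k (X : nat -> nat -> R -> C) :
  (forall l : C, vanish k (fun r => \sum_(s < N) \sum_(t < N) l ^+ s * conjc l ^+ t * X s t r)) ->
  forall s t, (s < N)%N -> (t < N)%N -> vanish k (X s t).
Proof.
move=> H s t sN tN.
(* Points on the line Re = 1: they are nonzero and their arguments are distinct in (-pi/2, pi/2), so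
   the ratios to their conjugates are distinct too. *)
pose om (j : nat) : C := 1 + 'i * j%:R.
have omc j : conjc (om j) = 1 - 'i * j%:R.
  have ci : conjc ('i : C) = - 'i by simpc.
  by rewrite /om rmorphD rmorphM rmorph1 rmorph_nat -mulNr -ci.
have i2 : ('i : C) * 'i = -1 by rewrite -expr2 sqr_i.
have i0 : ('i : C) != 0 by rewrite eq_complex /= oner_eq0 andbF.
have om2 j : om j * conjc (om j) != 0.
  rewrite omc /om (_ : _ * _ = 1 - ('i * 'i) * (j%:R * j%:R)); last by ring.
  by rewrite i2 mulN1r opprK -natrM nat1r pnatr_eq0.
have om0 j : conjc (om j) != 0 by move: (om2 j); rewrite mulf_eq0 negb_or => /andP[].
pose Y j d r := \sum_(p : 'I_N * 'I_N | (p.1 + p.2 == d)%N)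
   om j ^+ p.1 * conjc (om j) ^+ p.2 * X p.1 p.2 r.
pose M := (N + N).-1.
have NN : M.+1 = (N + N)%N by rewrite prednK // addn_gt0 (leq_ltn_trans _ sN).
have ltM (p : 'I_N * 'I_N) : (p.1 + p.2 < M.+1)%N by rewrite NN -addnS leq_add // ltnW.
have YH j d : (d < M.+1)%N -> vanish k (Y j d).
  move=> dN; pose a (i : 'I_M.+1) : C := i%:R.
  have ainj : injective a by move=> i i' /eqP; rewrite eqr_nat => /eqP/val_inj.
  apply: (vanish_vander (X := fun d : 'I_M.+1 => Y j d) ainj _ (Ordinal dN)) => i.
  apply: vanish_ext (H (i%:R * om j)) => r.
  rewrite pair_big /= (partition_big (fun p : 'I_N * 'I_N => inord (p.1 + p.2) : 'I_M.+1) predT) //=.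
  apply: eq_bigr => d' _; rewrite /Y mulr_sumr; apply: eq_big => [p|p /eqP pd].
    by rewrite -val_eqE /= inordK.
  have -> : a i ^+ d' = i%:R ^+ p.1 * i%:R ^+ p.2 by rewrite -pd /= inordK ?exprD.
  by rewrite rmorphM rmorph_nat !exprMn; ring.
have stN : (s + t < M.+1)%N by rewrite NN -addnS leq_add // ltnW.
pose nu (j : 'I_N) := om j / conjc (om j).
have nuinj : injective nu.
  move=> i j /eqP; rewrite /nu eqr_div // !omc /om => /eqP h; apply/val_inj/eqP.
  rewrite -(eqr_nat C) -subr_eq0; have : 2 * 'i * (i%:R - j%:R) = 0 :> C.
    move/eqP: h; rewrite -subr_eq0 => /eqP <-; ring.
  by move/eqP; rewrite !mulf_eq0 (negPf i0) pnatr_eq0 /= => ->.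
pose Z (s' : 'I_N) r := \sum_(t' < N | (s' + t' == s + t)%N) X s' t' r.
have ZH : forall s', vanish k (Z s').
  apply: (vanish_vander nuinj) => j.
  apply: vanish_ext (vanishZ ((conjc (om j))^-1 ^+ (s + t)) (YH j _ stN)) => r.
  rewrite /Y mulr_sumr -(pair_big_dep predT (fun a b : 'I_N => (a + b == s + t)%N)
    (fun a b : 'I_N => (conjc (om j))^-1 ^+ (s + t) * (om j ^+ a * conjc (om j) ^+ b * X a b r))) /=.
  apply: eq_bigr => s' _; rewrite /Z mulr_sumr; apply: eq_bigr => t' /eqP <-.
  rewrite /nu exprMn exprD !exprVn; field.
  by rewrite !expf_neq0.
apply: vanish_ext (ZH (Ordinal sN)) => r.
by rewrite /Z (big_pred1 (Ordinal tN)) // => t'; rewrite /= eqn_add2l.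
Qed.

(** The outer variable is [y] and the inner one [x], so the coefficient of x^s y^t is Q[_t]_s, with
    the indices in this order. *)
Definition ev (Q : {poly {poly C}}) (x y : C) : C := Q.[y%:P].[x].

Lemma ev_sum (Q : {poly {poly C}}) : exists N0, forall N, (N0 <= N)%N ->
  forall x y, ev Q x y = \sum_(s < N) \sum_(t < N) x ^+ s * y ^+ t * Q`_t`_s.
Proof.
pose N0 := maxn (size Q) (\max_(t < size Q) size (Q`_t)%R); exists N0 => N N0N x y.
have sQ : (size Q <= N)%N by apply: leq_trans N0N; exact: leq_maxl.
have sQt t : (size (Q`_t)%R <= N)%N.
  case: (ltnP t (size Q)) => h; last by rewrite nth_default // size_poly0.
  apply: leq_trans N0N; apply: leq_trans (leq_maxr _ _).
  exact: (leq_bigmax (F := fun t : 'I_(size Q) => size (Q`_t)%R) (Ordinal h)).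
rewrite /ev (horner_coef_wide _ sQ) horner_sum exchange_big /=; apply: eq_bigr => t _.
rewrite -rmorphXn hornerM hornerC (horner_coef_wide _ (sQt t)) mulr_suml.
by apply: eq_bigr => s _; ring.
Qed.

Lemma ev_eq0 (Q : {poly {poly C}}) : (forall l, ev Q l (conjc l) = 0) ->
  forall s t, Q`_t`_s = 0.
Proof.
move=> H s t; have [N0 HN] := ev_sum Q.
pose N := maxn N0 (maxn s t).+1.
have sN : (s < N)%N by rewrite leq_max ltnS leq_maxl orbT.
have tN : (t < N)%N by rewrite leq_max ltnS leq_maxr orbT.
have h : vanish 1 (fun=> Q`_t`_s : C).
  apply: (@vanish_bidegree N 1 (fun s t _ => Q`_t`_s)) => // l.
  by apply: vanish_ext (vanish0 _) => r; have := H l; rewrite (HN N (leq_maxl _ _)) => ->.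
by apply: (@vanish_lead _ 0); apply: vanish_ext h => r; rewrite expr0 mul1r.
Qed.

End Coefficients.

(** * Laplacians of polynomials in z and conj z *)

Section LaplaceCalculus.
Context {R : realType}.
Local Notation C := R[i].

Lemma conjcD (x y : C) : conjc (x + y) = conjc x + conjc y.
Proof. exact: rmorphD. Qed.
Lemma conjcN (x : C) : conjc (- x) = - conjc x.
Proof. exact: rmorphN. Qed.
Lemma conjcB (x y : C) : conjc (x - y) = conjc x - conjc y.
Proof. exact: rmorphB. Qed.
Lemma conjcM (x y : C) : conjc (x * y) = conjc x * conjc y.
Proof. exact: rmorphM. Qed.
Lemma conjcX (x : C) k : conjc (x ^+ k) = conjc x ^+ k.
Proof. exact: rmorphXn. Qed.
Lemma conjc_sum (I : Type) (s : seq I) (P : pred I) (f : I -> C) :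
  conjc (\sum_(i <- s | P i) f i) = \sum_(i <- s | P i) conjc (f i).
Proof. exact: rmorph_sum. Qed.

(** Because of [lpolyW] the index only bounds the degree. That makes the class stable under
    translations and derivatives, and it fixes the number of interpolation nodes. *)
Inductive lpoly n : nat -> ('rV[C]_n -> C) -> Prop :=
| lpoly_cst c : lpoly 0 (fun=> c)
| lpoly_z k : lpoly 1 (fun z => z 0 k)
| lpoly_zbar k : lpoly 1 (fun z => conjc (z 0 k))
| lpolyD d f g : lpoly d f -> lpoly d g -> lpoly d (fun z => f z + g z)
| lpolyM d d' f g : lpoly d f -> lpoly d' g -> lpoly (d + d') (fun z => f z * g z)
| lpolyW d d' f : (d <= d')%N -> lpoly d f -> lpoly d' f.

Lemma lpoly_ext n d (f g : 'rV[C]_n -> C) : f =1 g -> lpoly d f -> lpoly d g.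
Proof. by move=> /funext ->. Qed.

Lemma lpolyZ n d c (f : 'rV[C]_n -> C) : lpoly d f -> lpoly d (fun z => c * f z).
Proof. by move=> h; rewrite -[d]add0n; apply: lpolyM => //; exact: lpoly_cst. Qed.

Lemma lpoly_sum n d J (s : seq J) (P : pred J) (f : J -> 'rV[C]_n -> C) :
  (forall j, P j -> lpoly d (f j)) -> lpoly d (fun z => \sum_(j <- s | P j) f j z).
Proof.
move=> H; elim: s => [|i s IH].
  apply: (@lpolyW _ 0) => //; apply: lpoly_ext (lpoly_cst _ 0) => r; by rewrite big_nil.
case Pi: (P i); last by apply: lpoly_ext IH => r; rewrite big_cons Pi.
by apply: lpoly_ext (lpolyD (H i Pi) IH) => r; rewrite big_cons Pi.
Qed.

Lemma lpoly_translate n d (f : 'rV[C]_n -> C) v :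
  lpoly d f -> lpoly d (fun z => f (z + v)).
Proof.
elim=> {d f} [c|k|k|d f g _ h1 _ h2|d d' f g _ h1 _ h2|d d' f dd _ h].
- exact: lpoly_cst.
- apply: lpoly_ext (lpolyD (lpoly_z k) (lpolyW (leq0n 1) (lpoly_cst _ (v 0 k)))) => z.
  by rewrite mxE.
- apply: lpoly_ext (lpolyD (lpoly_zbar k) (lpolyW (leq0n 1) (lpoly_cst _ (conjc (v 0 k))))) => z.
  by rewrite mxE conjcD.
- exact: lpolyD.
- exact: lpolyM.
- exact: lpolyW dd h.
Qed.

Lemma lpoly_line n d (f : 'rV[C]_n -> C) z v : lpoly d f ->
  exists2 P : {poly C}, (size P <= d.+1)%N & forall t : R, f (z + t%:C *: v) = P.[t%:C].
Proof.
have lin (a b : C) : (size (a%:P + b *: 'X)%R <= 2)%N.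
  rewrite (leq_trans (size_polyD _ _)) // geq_max (leq_trans (size_polyC_leq1 _)) //=.
  by rewrite (leq_trans (size_scale_leq _ _)) // size_polyX.
elim=> {d f} [c|k|k|d f g _ [P sP h1] _ [Q sQ h2]|d d' f g _ [P sP h1] _ [Q sQ h2]|d d' f dd _ [P sP h]].
- by exists c%:P => [|t]; rewrite ?size_polyC_leq1 ?hornerC.
- exists ((z 0 k)%:P + v 0 k *: 'X) => // t.
  by rewrite !mxE !hornerE mulrC.
- exists ((conjc (z 0 k))%:P + conjc (v 0 k) *: 'X) => // t.
  by rewrite !mxE !hornerE conjcD conjcM conjc_real mulrC.
- exists (P + Q) => [|t]; last by rewrite hornerD h1 h2.
  by rewrite (leq_trans (size_polyD _ _)) // geq_max sP.
- exists (P * Q) => [|t]; last by rewrite hornerM h1 h2.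
  rewrite (leq_trans (size_polyMleq _ _)) //; move: sP sQ; lia.
- by exists P => //; rewrite (leq_trans sP).
Qed.

(* Locked, because conversion must not unfold [derive1]. *)
Definition der n : 'rV[C]_n -> ('rV[C]_n -> C) -> 'rV[C]_n -> C :=
  locked (fun v f z => derive_real (fun t => f (z + t%:C *: v))).

Lemma derE n (v : 'rV[C]_n) f z : der v f z = derive_real (fun t => f (z + t%:C *: v)).
Proof. by rewrite /der -lock. Qed.

Lemma Re_sum (I : Type) (s : seq I) (P : pred I) (f : I -> C) :
  complex.Re (\sum_(i <- s | P i) f i) = \sum_(i <- s | P i) complex.Re (f i).
Proof. by elim/big_rec2: _ => [|i x y _ <-] //; case: (f i) y => a b [c d]. Qed.

Lemma Im_sum (I : Type) (s : seq I) (P : pred I) (f : I -> C) :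
  complex.Im (\sum_(i <- s | P i) f i) = \sum_(i <- s | P i) complex.Im (f i).
Proof. by elim/big_rec2: _ => [|i x y _ <-] //; case: (f i) y => a b [c d]. Qed.

Lemma Re_mulr (x : C) (t : R) : complex.Re (x * t%:C) = complex.Re x * t.
Proof. by case: x => a b /=; rewrite mulr0 subr0. Qed.

Lemma Im_mulr (x : C) (t : R) : complex.Im (x * t%:C) = complex.Im x * t.
Proof. by case: x => a b /=; rewrite mulr0 add0r. Qed.

Lemma derive_real_horner (P : {poly C}) : derive_real (fun t => P.[t%:C]) = P`_1.
Proof.
have aux (proj : C -> R) : (forall (I : Type) (s : seq I) (Q : pred I) (f : I -> C),
    proj (\sum_(i <- s | Q i) f i) = \sum_(i <- s | Q i) proj (f i)) ->
    (forall (x : C) (t : R), proj (x * t%:C) = proj x * t) -> proj 0 = 0 ->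
    derive1 (fun t => proj P.[t%:C]) 0 = proj P`_1.
  move=> psum pmul p0.
  rewrite (_ : (fun t => _) = horner (\poly_(i < size P) proj P`_i)).
    rewrite -derivE horner_coef0 coef_deriv mulr1n coef_poly.
    by case: ltnP => // h; rewrite nth_default.
  apply/funext => t; rewrite horner_poly horner_coef psum.
  by apply: eq_bigr => i _; rewrite -rmorphXn pmul.
rewrite /derive_real (aux _ Re_sum Re_mulr) // (aux _ Im_sum Im_mulr) //.
by case: (P`_1).
Qed.

Lemma der_line n v (f : 'rV[C]_n -> C) z (P : {poly C}) :
  (forall t : R, f (z + t%:C *: v) = P.[t%:C]) -> der v f z = P`_1.
Proof. by move=> H; rewrite -derive_real_horner derE; congr derive_real; apply/funext. Qed.

Lemma line0 n v (f : 'rV[C]_n -> C) z (P : {poly C}) :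
  (forall t : R, f (z + t%:C *: v) = P.[t%:C]) -> f z = P`_0.
Proof. by move=> H; have := H 0; rewrite scale0r addr0 horner_coef0. Qed.

Lemma derD n d d' v (f g : 'rV[C]_n -> C) z : lpoly d f -> lpoly d' g ->
  der v (fun z => f z + g z) z = der v f z + der v g z.
Proof.
move=> /(lpoly_line z v)[P _ hP] /(lpoly_line z v)[Q _ hQ].
rewrite (der_line hP) (der_line hQ) -coefD; apply: der_line => t.
by rewrite hornerD hP hQ.
Qed.

Lemma derM n d d' v (f g : 'rV[C]_n -> C) z : lpoly d f -> lpoly d' g ->
  der v (fun z => f z * g z) z = der v f z * g z + f z * der v g z.
Proof.
move=> /(lpoly_line z v)[P _ hP] /(lpoly_line z v)[Q _ hQ].
rewrite (der_line hP) (der_line hQ) (line0 hP) (line0 hQ).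
rewrite (_ : _ + _ = (P * Q)`_1).
  by apply: der_line => t; rewrite hornerM hP hQ.
by rewrite coefM !big_ord_recl big_ord0 /= addr0 addrC.
Qed.

Lemma der_cst n (v : 'rV[C]_n) c z : der v (fun=> c) z = 0.
Proof. by rewrite (@der_line _ _ _ _ c%:P) ?coefC // => t; rewrite hornerC. Qed.

Lemma der_z n (v : 'rV[C]_n) k z : der v (fun z => z 0 k) z = v 0 k.
Proof.
rewrite (@der_line _ _ _ _ ((z 0 k)%:P + v 0 k *: 'X)) => [|t].
  by rewrite coefD coefC coefZ coefX /= add0r mulr1.
by rewrite !mxE !hornerE mulrC.
Qed.

Lemma der_zbar n (v : 'rV[C]_n) k z : der v (fun z => conjc (z 0 k)) z = conjc (v 0 k).
Proof.
rewrite (@der_line _ _ _ _ ((conjc (z 0 k))%:P + conjc (v 0 k) *: 'X)) => [|t].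
  by rewrite coefD coefC coefZ coefX /= add0r mulr1.
by rewrite !mxE !hornerE conjcD conjcM conjc_real mulrC.
Qed.

(* [Op] is, on polynomials of degree at most [d], a fixed finite combination
   of translates: such operators commute with pointwise limits. *)
Definition comb n d (Op : ('rV[C]_n -> C) -> 'rV[C]_n -> C) : Prop :=
  exists s : seq (C * 'rV[C]_n), forall f, lpoly d f -> forall z,
    Op f z = \sum_(cv <- s) cv.1 * f (z + cv.2).

Lemma comb_lpoly n d (Op : ('rV[C]_n -> C) -> 'rV[C]_n -> C) f :
  comb d Op -> lpoly d f -> lpoly d (Op f).
Proof.
move=> [s Hs] hf; apply: (@lpoly_ext _ _ (fun z => \sum_(cv <- s) cv.1 * f (z + cv.2))).
  by move=> z; rewrite Hs.
by apply: lpoly_sum => cv _; apply: lpolyZ; exact: lpoly_translate.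
Qed.

Lemma comb_der n d (v : 'rV[C]_n) : comb d (der v).
Proof.
(* [d.+1] nodes would determine a polynomial of degree [d]; one more keeps the index 1 of the wanted
   coefficient in range when [d] is 0. *)
have [e He] := coef_comb C d.+2.
exists [seq (e i (inord 1), (i%:R : R)%:C *: v) | i <- enum 'I_d.+2] => f hf z.
have [P sP hP] := lpoly_line z v hf.
rewrite (der_line hP) big_map big_enum /=.
have := He P (leq_trans sP (leqnSn _)) (inord 1); rewrite inordK // => ->.
by apply: eq_bigr => i _; rewrite hP rmorph_nat.
Qed.

Lemma combD n d (A B : ('rV[C]_n -> C) -> 'rV[C]_n -> C) :
  comb d A -> comb d B -> comb d (fun f z => A f z + B f z).
Proof. by move=> [s hs] [t ht]; exists (s ++ t) => f hf z; rewrite big_cat hs // ht. Qed.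

Lemma combZ n d c (A : ('rV[C]_n -> C) -> 'rV[C]_n -> C) :
  comb d A -> comb d (fun f z => c * A f z).
Proof.
move=> [s hs]; exists [seq (c * cv.1, cv.2) | cv <- s] => f hf z.
by rewrite hs // big_map mulr_sumr; apply: eq_bigr => cv _; rewrite mulrA.
Qed.

Lemma comb_sum n d (I : Type) (s : seq I) (A : I -> ('rV[C]_n -> C) -> 'rV[C]_n -> C) :
  (forall i, comb d (A i)) -> comb d (fun f z => \sum_(i <- s) A i f z).
Proof.
move=> H; elim: s => [|i s [t ht]].
  by exists [::] => f hf z; rewrite !big_nil.
have [t' ht'] := combD (H i) (ex_intro _ t ht : comb d (fun f z => \sum_(i <- s) A i f z)).
by exists t' => f hf z; rewrite big_cons ht'.
Qed.

Lemma comb_comp n d (A B : ('rV[C]_n -> C) -> 'rV[C]_n -> C) :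
  comb d A -> comb d B -> comb d (fun f z => A (B f) z).
Proof.
move=> hA hB; have [s hs] := hA; have [t ht] := hB.
exists (flatten [seq [seq (cv.1 * cw.1, cv.2 + cw.2) | cw <- t] | cv <- s]) => f hf z.
rewrite hs; last exact: comb_lpoly.
rewrite big_flatten big_map; apply: eq_bigr => cv _.
rewrite big_map ht // mulr_sumr; apply: eq_bigr => cw _.
by rewrite mulrA addrA.
Qed.

Definition Dz n (k : 'I_n) (f : 'rV[C]_n -> C) z : C :=
  (der (delta_mx 0 k) f z - 'i * der ('i *: delta_mx 0 k) f z) / 2%:R.
Definition Dzb n (k : 'I_n) (f : 'rV[C]_n -> C) z : C :=
  (der (delta_mx 0 k) f z + 'i * der ('i *: delta_mx 0 k) f z) / 2%:R.
Definition Lapz n (e : nat) (f : 'rV[C]_n -> C) z : C :=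
  \sum_(k < n) esign e k * Dz k (Dzb k f) z.

(** Neither operator differentiates in [u], so [u] can be frozen and the iterated Laplacian studied
    on functions of [z] alone. *)
Lemma D_slice n (k : 'I_n) (G : 'rV[C]_n -> R -> C) g z u :
  (forall z, G z u = g z) -> D k G z u = Dz k g z /\ Dbar k G z u = Dzb k g z.
Proof.
move=> H; rewrite /D /Dbar /Dz /Dzb /dx /dy !derE.
have -> : (fun t : R => G (z + t%:C *: delta_mx 0 k) u) = (fun t : R => g (z + t%:C *: delta_mx 0 k)).
  by apply/funext.
have -> : (fun t : R => G (z + ('i * t%:C) *: delta_mx 0 k) u) = (fun t : R => g (z + t%:C *: ('i *: delta_mx 0 k))).
  by apply/funext => t; rewrite H scalerA mulrC.
by split.
Qed.

Lemma Lap_slice n e (G : 'rV[C]_n -> R -> C) g z u :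
  (forall z, G z u = g z) -> Lap e G z u = Lapz e g z.
Proof.
move=> H; rewrite /Lap /Lapz; apply: eq_bigr => k _.
have Hb z' : Dbar k G z' u = Dzb k g z' by have [] := D_slice k z' H.
by have [-> _] := D_slice k z Hb.
Qed.

Lemma iter_LapE n e j (G : 'rV[C]_n -> R -> C) z u :
  iter j (Lap e) G z u = iter j (Lapz e) (fun z => G z u) z.
Proof.
elim: j z => [|j IH] z; first by [].
change (Lap e (iter j (Lap e) G) z u = Lapz e (iter j (Lapz e) (fun z => G z u)) z).
exact: Lap_slice.
Qed.

Lemma comb_Dz n d (k : 'I_n) : comb d (Dz k).
Proof.
have := combD (combZ (2%:R^-1) (comb_der d (delta_mx 0 k))) (combZ (- ('i / 2%:R)) (comb_der d ('i *: delta_mx 0 k))).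
case=> s hs; exists s => f hf z; have <- := hs f hf z.
by rewrite /Dz mulrBl mulNr (mulrC _ 2%:R^-1) (mulrAC 'i).
Qed.

Lemma comb_Dzb n d (k : 'I_n) : comb d (Dzb k).
Proof.
have := combD (combZ (2%:R^-1) (comb_der d (delta_mx 0 k))) (combZ ('i / 2%:R) (comb_der d ('i *: delta_mx 0 k))).
case=> s hs; exists s => f hf z; have <- := hs f hf z.
by rewrite /Dzb mulrDl (mulrC _ 2%:R^-1) (mulrAC 'i).
Qed.

Lemma comb_Lapz n d e : comb d (@Lapz n e).
Proof.
by apply: comb_sum => k; apply: combZ; apply: comb_comp; [exact: comb_Dz|exact: comb_Dzb].
Qed.

Lemma comb_iter_Lapz n d e j : comb d (fun f => iter j (@Lapz n e) f).
Proof.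
elim: j => [|j IH]; first by exists [:: (1, 0)] => f _ z; rewrite big_seq1 mul1r addr0.
have [s hs] := @comb_comp _ _ (@Lapz n e) (fun f => iter j (@Lapz n e) f) (comb_Lapz n d e) IH.
by exists s => f hf z; have <- := hs f hf z.
Qed.

End LaplaceCalculus.

(** * Wirtinger calculus and the commutator of the Laplacian with <z, z> *)

Section Wirtinger.
Context {R : realType}.
Local Notation C := R[i].

Lemma der_sum n d v (I : Type) (s : seq I) (f : I -> 'rV[C]_n -> C) z :
  (forall i, lpoly d (f i)) ->
  der v (fun z => \sum_(i <- s) f i z) z = \sum_(i <- s) der v (f i) z.
Proof.
move=> H; elim: s => [|i s IH].
  rewrite big_nil (_ : (fun z => _) = (fun=> 0)) ?der_cst //.
  by apply/funext => z'; rewrite big_nil.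
rewrite big_cons -IH (_ : (fun z => _) = (fun z => f i z + \sum_(j <- s) f j z)).
  by apply: derD (H i) (lpoly_sum _ _) => j _; exact: H.
by apply/funext => z'; rewrite big_cons.
Qed.

Section Rules.
Variables (n : nat) (k : 'I_n).
Implicit Types (f g : 'rV[C]_n -> C) (z : 'rV[C]_n).

Lemma DzD d d' f g z : lpoly d f -> lpoly d' g ->
  Dz k (fun z => f z + g z) z = Dz k f z + Dz k g z.
Proof. by move=> hf hg; rewrite /Dz !(derD _ _ hf hg); ring. Qed.

Lemma DzbD d d' f g z : lpoly d f -> lpoly d' g ->
  Dzb k (fun z => f z + g z) z = Dzb k f z + Dzb k g z.
Proof. by move=> hf hg; rewrite /Dzb !(derD _ _ hf hg); ring. Qed.

Lemma DzM d d' f g z : lpoly d f -> lpoly d' g ->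
  Dz k (fun z => f z * g z) z = Dz k f z * g z + f z * Dz k g z.
Proof. by move=> hf hg; rewrite /Dz !(derM _ _ hf hg); ring. Qed.

Lemma DzbM d d' f g z : lpoly d f -> lpoly d' g ->
  Dzb k (fun z => f z * g z) z = Dzb k f z * g z + f z * Dzb k g z.
Proof. by move=> hf hg; rewrite /Dzb !(derM _ _ hf hg); ring. Qed.

Lemma Dz_cst (c : C) z : Dz k (fun=> c) z = 0.
Proof. by rewrite /Dz !der_cst mulr0 subrr mul0r. Qed.

Lemma Dzb_cst (c : C) z : Dzb k (fun=> c) z = 0.
Proof. by rewrite /Dzb !der_cst mulr0 addr0 mul0r. Qed.

Lemma DzZ d c f z : lpoly d f -> Dz k (fun z => c * f z) z = c * Dz k f z.
Proof. by move=> hf; rewrite (DzM _ (lpoly_cst _ c) hf) Dz_cst mul0r add0r. Qed.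

Lemma DzbZ d c f z : lpoly d f -> Dzb k (fun z => c * f z) z = c * Dzb k f z.
Proof. by move=> hf; rewrite (DzbM _ (lpoly_cst _ c) hf) Dzb_cst mul0r add0r. Qed.

Lemma Dz_sum d (I : Type) (s : seq I) (f : I -> 'rV[C]_n -> C) z :
  (forall i, lpoly d (f i)) ->
  Dz k (fun z => \sum_(i <- s) f i z) z = \sum_(i <- s) Dz k (f i) z.
Proof.
move=> H; rewrite /Dz !(der_sum _ _ _ H) mulr_sumr -sumrB mulr_suml.
by [].
Qed.

Lemma Dzb_sum d (I : Type) (s : seq I) (f : I -> 'rV[C]_n -> C) z :
  (forall i, lpoly d (f i)) ->
  Dzb k (fun z => \sum_(i <- s) f i z) z = \sum_(i <- s) Dzb k (f i) z.
Proof.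
move=> H; rewrite /Dzb !(der_sum _ _ _ H) mulr_sumr -big_split mulr_suml.
by [].
Qed.

Let ii : 'i%C * 'i%C = -1 :> C. Proof. by rewrite -expr2 sqr_i. Qed.
Let ci : conjc 'i%C = - 'i%C :> C. Proof. by simpc. Qed.

Lemma Dz_z j z : Dz k (fun z => z 0 j) z = (j == k)%:R.
Proof.
rewrite /Dz !der_z !mxE eqxx /= mulrA ii mulN1r opprK.
by field.
Qed.

Lemma Dz_zbar j z : Dz k (fun z => conjc (z 0 j)) z = 0.
Proof.
rewrite /Dz !der_zbar !mxE eqxx /= conjcM !conjc_nat ci mulNr mulrN opprK mulrA ii.
by rewrite mulN1r subrr mul0r.
Qed.

Lemma Dzb_z j z : Dzb k (fun z => z 0 j) z = 0.
Proof. by rewrite /Dzb !der_z !mxE eqxx /= mulrA ii mulN1r subrr mul0r. Qed.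

Lemma Dzb_zbar j z : Dzb k (fun z => conjc (z 0 j)) z = (j == k)%:R.
Proof.
rewrite /Dzb !der_zbar !mxE eqxx /= conjcM !conjc_nat ci mulNr mulrN mulrA ii.
by rewrite mulN1r opprK; field.
Qed.

Lemma lpoly_Dzb d f : lpoly d f -> lpoly d (Dzb k f).
Proof. by move=> hf; exact: comb_lpoly (comb_Dzb _ _) hf. Qed.

End Rules.

Section Rho.
Variables (n e : nat).
Implicit Types (f q : 'rV[C]_n -> C) (z : 'rV[C]_n).

Lemma esign_sq k : esign e k * esign e k = 1 :> C.
Proof. by rewrite /esign; case: ifP => _; rewrite ?mulr1 // mulrNN mulr1. Qed.

Lemma conjc_esign k : conjc (esign e k : C) = esign e k.
Proof. by rewrite /esign; case: ifP => _; rewrite ?conjcN conjc1. Qed.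

Lemma lpoly_herm : lpoly 2 (@herm R n e).
Proof.
apply: lpoly_sum => k _; apply: lpolyZ.
exact: lpolyM (lpoly_z k) (lpoly_zbar k).
Qed.

Lemma lpoly_zzbar (j : 'I_n) : lpoly 2 (fun z : 'rV[C]_n => esign e j * (z 0 j * conjc (z 0 j))).
Proof. by apply: lpolyZ; exact: lpolyM (lpoly_z j) (lpoly_zbar j). Qed.

Lemma Dz_herm k z : Dz k (@herm R n e) z = esign e k * conjc (z 0 k).
Proof.
rewrite (Dz_sum _ _ _ lpoly_zzbar) (bigD1 k) //= big1 => [|j jk].
  rewrite addr0 (DzZ _ _ _ (lpolyM (lpoly_z k) (lpoly_zbar k))).
  by rewrite (DzM _ _ (lpoly_z k) (lpoly_zbar k)) Dz_z Dz_zbar eqxx mul1r mulr0 addr0.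
rewrite (DzZ _ _ _ (lpolyM (lpoly_z j) (lpoly_zbar j))).
by rewrite (DzM _ _ (lpoly_z j) (lpoly_zbar j)) Dz_z Dz_zbar (negPf jk) mul0r !mulr0 addr0 mulr0.
Qed.

Lemma Dzb_herm k z : Dzb k (@herm R n e) z = esign e k * z 0 k.
Proof.
rewrite (Dzb_sum _ _ _ lpoly_zzbar) (bigD1 k) //= big1 => [|j jk].
  rewrite addr0 (DzbZ _ _ _ (lpolyM (lpoly_z k) (lpoly_zbar k))).
  by rewrite (DzbM _ _ (lpoly_z k) (lpoly_zbar k)) Dzb_z Dzb_zbar eqxx mulr1 mul0r add0r.
rewrite (DzbZ _ _ _ (lpolyM (lpoly_z j) (lpoly_zbar j))).
by rewrite (DzbM _ _ (lpoly_z j) (lpoly_zbar j)) Dzb_z Dzb_zbar (negPf jk) mul0r !mulr0 addr0 mulr0.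
Qed.

Definition euler f z : C := \sum_(k < n) (z 0 k * Dz k f z + conjc (z 0 k) * Dzb k f z).

(** Homogeneity in (z, conj z) jointly, stated as Euler's identity because that is how it enters the
    commutator formula below. *)
Definition homog d f := forall z, euler f z = d%:R * f z.

Lemma homogM d d' a b f q : lpoly a f -> lpoly b q -> homog d f -> homog d' q ->
  homog (d + d') (fun z => f z * q z).
Proof.
move=> la lb hf hq z; rewrite natrD mulrDl.
rewrite [X in _ = X + _](_ : _ = euler f z * q z); last by rewrite hf mulrA.
rewrite [X in _ = _ + X](_ : _ = euler q z * f z); last by rewrite hq; ring.
rewrite /euler !mulr_suml -big_split; apply: eq_bigr => k _.
by rewrite /= (DzM _ _ la lb) (DzbM _ _ la lb); ring.
Qed.

Lemma homog_cst c : homog 0 (fun=> c).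
Proof.
by move=> z; rewrite /euler mul0r big1 // => k _; rewrite Dz_cst Dzb_cst !mulr0 addr0.
Qed.

Lemma homogZ d a c f : lpoly a f -> homog d f -> homog d (fun z => c * f z).
Proof. by move=> la hf; rewrite -[d]add0n; apply: homogM (lpoly_cst _ c) la (homog_cst c) hf. Qed.

Lemma homog_sum d a (I : Type) (s : seq I) (f : I -> 'rV[C]_n -> C) :
  (forall i, lpoly a (f i)) -> (forall i, homog d (f i)) ->
  homog d (fun z => \sum_(i <- s) f i z).
Proof.
move=> la H z; rewrite mulr_sumr.
under [RHS]eq_bigr => i _ do rewrite -H.
rewrite /euler exchange_big /=; apply: eq_bigr => k _.
by rewrite (Dz_sum _ _ _ la) (Dzb_sum _ _ _ la) !mulr_sumr -big_split.
Qed.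

Lemma homog_z j : homog 1 (fun z => z 0 j).
Proof.
move=> z; rewrite /euler (bigD1 j) //= big1 => [|k kj].
  by rewrite addr0 Dz_z Dzb_z eqxx mulr0 addr0 mulrC.
by rewrite Dz_z Dzb_z eq_sym (negPf kj) !mulr0 addr0.
Qed.

Lemma homog_zbar j : homog 1 (fun z => conjc (z 0 j)).
Proof.
move=> z; rewrite /euler (bigD1 j) //= big1 => [|k kj].
  by rewrite addr0 Dz_zbar Dzb_zbar eqxx mulr0 add0r mulrC.
by rewrite Dz_zbar Dzb_zbar eq_sym (negPf kj) !mulr0 addr0.
Qed.

Lemma homog_herm : homog 2 (@herm R n e).
Proof.
apply: (homog_sum _ lpoly_zzbar) => j.
apply: homogZ (lpolyM (lpoly_z j) (lpoly_zbar j)) _.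
exact: homogM (lpoly_z j) (lpoly_zbar j) (homog_z j) (homog_zbar j).
Qed.

(** The commutator of Delta with multiplication by <z, z> is n plus the Euler operator: every sign
    of the form meets the same sign of Delta and squares to 1, whatever the signature. *)
Lemma Lapz_herm_mul d a q z : lpoly a q -> homog d q ->
  Lapz e (fun z => herm e z * q z) z = herm e z * Lapz e q z + (n + d)%:R * q z.
Proof.
move=> la hq; have lb k := lpoly_Dzb k la.
have E k : Dzb k (fun z => herm e z * q z) =
    fun z => esign e k * z 0 k * q z + herm e z * Dzb k q z.
  by apply/funext => z'; rewrite (DzbM _ _ lpoly_herm la) Dzb_herm.
rewrite natrD mulrDl -hq /Lapz mulr_sumr.
rewrite (_ : n%:R * q z = \sum_(k < n) q z); last by rewrite sumr_const card_ord mulr_natl.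
rewrite /euler -!big_split; apply: eq_bigr => k _ /=; rewrite E.
have lz : lpoly 1 (fun z : 'rV[C]_n => esign e k * z 0 k) by apply: lpolyZ; exact: lpoly_z.
rewrite (DzD _ _ (lpolyM lz la) (lpolyM lpoly_herm (lb k))) (DzM _ _ lz la).
rewrite (DzM _ _ lpoly_herm (lb k)) Dz_herm (DzZ _ _ _ (lpoly_z k)) Dz_z eqxx mulr1n.
set s := esign e k; have ss : s * s = 1 by exact: esign_sq.
set A := Dz k q z; set B := Dzb k q z; set D := Dz k _ z.
rewrite (_ : s * _ = (s * s) * (q z + z 0 k * A + conjc (z 0 k) * B) + herm e z * (s * D)).
  by rewrite ss; ring.
by ring.
Qed.

Lemma LapzZ a c q z : lpoly a q -> Lapz e (fun z => c * q z) z = c * Lapz e q z.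
Proof.
move=> la; rewrite /Lapz mulr_sumr; apply: eq_bigr => k _.
rewrite (_ : Dzb k (fun z => c * q z) = fun z => c * Dzb k q z).
  by rewrite (DzZ _ _ _ (lpoly_Dzb k la)); ring.
by apply/funext => z'; rewrite (DzbZ _ _ _ la).
Qed.

Lemma LapzD a b f q z : lpoly a f -> lpoly b q ->
  Lapz e (fun z => f z + q z) z = Lapz e f z + Lapz e q z.
Proof.
move=> la lb; rewrite /Lapz -big_split; apply: eq_bigr => k _ /=.
rewrite (_ : Dzb k (fun z => f z + q z) = fun z => Dzb k f z + Dzb k q z).
  by rewrite (DzD _ _ (lpoly_Dzb k la) (lpoly_Dzb k lb)); ring.
by apply/funext => z'; rewrite (DzbD _ _ la lb).
Qed.

Lemma Lapz_cst c z : Lapz e (fun=> c : C) (z : 'rV[C]_n) = 0.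
Proof.
rewrite /Lapz big1 // => k _; rewrite (_ : Dzb k _ = fun=> 0) ?Dz_cst ?mulr0 //.
by apply/funext => z'; rewrite Dzb_cst.
Qed.

Lemma Lapz_herm z : Lapz e (@herm R n e) z = n%:R.
Proof.
have := @Lapz_herm_mul 0 0 (fun=> 1) z (lpoly_cst _ 1) (homog_cst 1).
rewrite Lapz_cst mulr0 add0r addn0 mulr1 => <-; congr Lapz.
by apply/funext => z'; rewrite mulr1.
Qed.

(** The factors accumulate commutators: n for <z, z>, then n + (n + 2) = 2 (n + 1) for its square,
    and 2 (n + 1) + (n + 4) = 3 (n + 2) for its cube. *)
Lemma Lapz3_herm3 z : iter 3 (Lapz e) (fun z => herm e z * (herm e z * herm e z)) z =
  (3%:R * (n + 2)%:R) * ((2%:R * (n + 1)%:R) * n%:R).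
Proof.
have E1 : Lapz e (fun z : 'rV[C]_n => herm e z * herm e z) =
    fun z => 2%:R * (n + 1)%:R * herm e z.
  apply/funext => z'; rewrite (Lapz_herm_mul _ lpoly_herm homog_herm) Lapz_herm.
  by rewrite !natrD; ring.
have l2 : lpoly 4 (fun z : 'rV[C]_n => herm e z * herm e z).
  exact: lpolyM lpoly_herm lpoly_herm.
have h2 : homog 4 (fun z : 'rV[C]_n => herm e z * herm e z).
  exact: homogM lpoly_herm lpoly_herm homog_herm homog_herm.
have E2 : Lapz e (fun z : 'rV[C]_n => herm e z * (herm e z * herm e z)) =
    fun z => 3%:R * (n + 2)%:R * (herm e z * herm e z).
  apply/funext => z'; rewrite (Lapz_herm_mul _ l2 h2) E1.
  by rewrite !natrD; ring.
rewrite /= E2 (_ : Lapz e (fun z => 3%:R * _ * _) =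
    fun z => 3%:R * (n + 2)%:R * (2%:R * (n + 1)%:R * herm e z)).
  rewrite (LapzZ _ _ (lpolyZ _ lpoly_herm)) (LapzZ _ _ lpoly_herm) Lapz_herm.
  by rewrite !mulrA.
by apply/funext => z'; rewrite (LapzZ _ _ l2) E1.
Qed.

Variable b : 'I_n -> C.
Let ell (z : 'rV[C]_n) : C := \sum_(k < n) b k * conjc (z 0 k).

Lemma lpoly_ell : lpoly 1 ell.
Proof. by apply: lpoly_sum => k _; apply: lpolyZ; exact: lpoly_zbar. Qed.

Lemma homog_ell : homog 1 ell.
Proof.
apply: (@homog_sum 1 1) => k; first by apply: lpolyZ; exact: lpoly_zbar.
by apply: homogZ (lpoly_zbar k) _; exact: homog_zbar.
Qed.

Lemma Lapz_ell z : Lapz e ell z = 0.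
Proof.
rewrite /Lapz big1 // => k _; rewrite (_ : Dzb k ell = fun=> b k) ?Dz_cst ?mulr0 //.
apply/funext => z'; rewrite (@Dzb_sum _ _ 1) => [|j]; last by apply: lpolyZ; exact: lpoly_zbar.
rewrite (bigD1 k) //= big1 => [|j jk]; rewrite (DzbZ _ _ _ (lpoly_zbar _)) Dzb_zbar.
  by rewrite eqxx mulr1 addr0.
by rewrite (negPf jk) mulr0.
Qed.

(** An antilinear form is harmonic of degree 1, so the commutators give n + 1, and then (n + 1) + (n
    + 3) = 2 (n + 2). *)
Lemma Lapz2_herm2_ell z : iter 2 (Lapz e) (fun z => herm e z * (herm e z * ell z)) z =
  (2%:R * (n + 2)%:R) * ((n + 1)%:R * ell z).
Proof.
have l1 : lpoly 3 (fun z : 'rV[C]_n => herm e z * ell z) by exact: lpolyM lpoly_herm lpoly_ell.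
have h1 : homog 3 (fun z : 'rV[C]_n => herm e z * ell z).
  exact: homogM lpoly_herm lpoly_ell homog_herm homog_ell.
have E1 : Lapz e (fun z : 'rV[C]_n => herm e z * ell z) = fun z => (n + 1)%:R * ell z.
  apply/funext => z'; rewrite (Lapz_herm_mul _ lpoly_ell homog_ell) Lapz_ell.
  by rewrite mulr0 add0r.
have E2 : Lapz e (fun z : 'rV[C]_n => herm e z * (herm e z * ell z)) =
    fun z => 2%:R * (n + 2)%:R * (herm e z * ell z).
  apply/funext => z'; rewrite (Lapz_herm_mul _ l1 h1) E1.
  by rewrite !natrD; ring.
by rewrite /= E2 (LapzZ _ _ l1) E1.
Qed.

Variable H : 'I_n -> 'I_n -> C.
Let h (z : 'rV[C]_n) : C := \sum_(j < n) \sum_(k < n) H j k * (z 0 j * conjc (z 0 k)).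

Let lh j k : lpoly 2 (fun z : 'rV[C]_n => H j k * (z 0 j * conjc (z 0 k))).
Proof. by apply: lpolyZ; exact: lpolyM (lpoly_z j) (lpoly_zbar k). Qed.

Lemma lpoly_sesq : lpoly 2 h.
Proof. by apply: lpoly_sum => j _; apply: lpoly_sum. Qed.

Lemma homog_sesq : homog 2 h.
Proof.
apply: (@homog_sum 2 2) => j; first by apply: lpoly_sum.
apply: (@homog_sum 2 2) => k //.
apply: homogZ (lpolyM (lpoly_z j) (lpoly_zbar k)) _.
exact: homogM (lpoly_z j) (lpoly_zbar k) (homog_z j) (homog_zbar k).
Qed.

Lemma Lapz_sesq z : Lapz e h z = \sum_(k < n) esign e k * H k k.
Proof.
apply: eq_bigr => k _; congr (_ * _).
rewrite (_ : Dzb k h = fun z => \sum_(j < n) H j k * z 0 j).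
  rewrite (@Dz_sum _ _ 1) => [|j]; last by apply: lpolyZ; exact: lpoly_z.
  rewrite (bigD1 k) //= big1 => [|j jk]; rewrite (DzZ _ _ _ (lpoly_z _)) Dz_z.
    by rewrite eqxx mulr1 addr0.
  by rewrite (negPf jk) mulr0.
apply/funext => z'; rewrite (@Dzb_sum _ _ 2) => [|j]; last by apply: lpoly_sum.
apply: eq_bigr => j _; rewrite (@Dzb_sum _ _ 2) //.
rewrite (bigD1 k) //= big1 => [|i ik].
  rewrite (DzbZ _ _ _ (lpolyM (lpoly_z j) (lpoly_zbar k))).
  by rewrite (DzbM _ _ (lpoly_z j) (lpoly_zbar k)) Dzb_z Dzb_zbar eqxx mul0r add0r mulr1 addr0.
rewrite (DzbZ _ _ _ (lpolyM (lpoly_z j) (lpoly_zbar i))).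
by rewrite (DzbM _ _ (lpoly_z j) (lpoly_zbar i)) Dzb_z Dzb_zbar (negPf ik) mul0r mulr0 addr0 mulr0.
Qed.

(* Applying the Laplacian twice kills the trace of [h], then [h] itself. *)
Lemma Lapz_herm_sesq_eq0 (eps : R) : (0 < n)%N -> 0 < eps ->
  (forall z : 'rV[C]_n, (forall i, `|z 0 i| < eps%:C) ->
     Lapz e (fun z => herm e z * h z) z = 0) -> forall z, h z = 0.
Proof.
move=> n0 e0 H0; pose tau := \sum_(k < n) esign e k * H k k : C.
have E (z : 'rV[C]_n) : Lapz e (fun z => herm e z * h z) z = tau * herm e z + (n + 2)%:R * h z.
  by rewrite (Lapz_herm_mul _ lpoly_sesq homog_sesq) Lapz_sesq mulrC.
have scale (t : R) (z : 'rV[C]_n) : tau * herm e (t%:C *: z) + (n + 2)%:R * h (t%:C *: z) =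
   t%:C ^+ 2 * (tau * herm e z + (n + 2)%:R * h z).
  rewrite mulrDr !(mulrCA (t%:C ^+ 2)); congr (_ * _ + _ * _).
    rewrite /herm mulr_sumr; apply: eq_bigr => k _.
    by rewrite !mxE conjcM conjc_real; ring.
  rewrite /h mulr_sumr; apply: eq_bigr => j _; rewrite mulr_sumr; apply: eq_bigr => k _.
  by rewrite !mxE conjcM conjc_real; ring.
(* The hypothesis is only local. Both terms have degree 2 under real scaling, so each [z] is shrunk
   into the small polydisc. *)
have E0 (z : 'rV[C]_n) : tau * herm e z + (n + 2)%:R * h z = 0.
  pose m := \sum_i complex.Re `|z 0 i| + 1.
  have zr i : `|z 0 i| = (complex.Re `|z 0 i|)%:C by rewrite RRe_real // ger0_real.
  have z0 i : 0 <= complex.Re `|z 0 i| by rewrite -ler0c -zr.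
  have m0 : 0 < m by rewrite ltr_wpDl // sumr_ge0.
  have tm0 : (eps / m)%:C != 0 :> C by rewrite eq_complex /= eqxx andbT mulf_neq0 ?invr_neq0 ?lt0r_neq0.
  have := H0 ((eps / m)%:C *: z); rewrite E scale => /(_ _)/eqP.
  rewrite mulf_eq0 expf_eq0 (negPf tm0) andbF /= => H1; apply/eqP/H1 => i.
  rewrite mxE normrM zr ger0_norm ?ler0c ?divr_ge0 ?(ltW e0) ?(ltW m0) // -rmorphM ltcR.
  rewrite mulrAC -mulrA gtr_pMr // ltr_pdivrMr // mul1r /m (bigD1 i) //= -addrA ltrDl.
  by rewrite ltr_wpDl //; apply: sumr_ge0 => j _; exact: z0.
have nn p : (n + p)%:R != 0 :> C by rewrite pnatr_eq0 addn_eq0 negb_and -lt0n n0.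
have tau0 : tau = 0.
  have := Lapz_cst 0 (0 : 'rV[C]_n).
  have -> : (fun=> 0) = (fun z : 'rV[C]_n => tau * herm e z + (n + 2)%:R * h z).
    by apply/funext => z; rewrite E0.
  rewrite (LapzD _ (lpolyZ _ lpoly_herm) (lpolyZ _ lpoly_sesq)).
  rewrite (LapzZ _ _ lpoly_herm) (LapzZ _ _ lpoly_sesq) Lapz_herm Lapz_sesq -/tau.
  rewrite (mulrC _ tau) -mulrDr -natrD => /eqP; rewrite mulf_eq0 => /orP[/eqP //|].
  by rewrite (negPf (nn _)).
move=> z; have := E0 z; rewrite tau0 mul0r add0r => /eqP.
by rewrite mulf_eq0 (negPf (nn _)) => /eqP.
Qed.

End Rho.
End Wirtinger.

#[local] Arguments conjc : simpl never.

(** * The kernel of the Chern-Moser operator *)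

Section Types.
Context {R : realType}.
Local Notation C := R[i].

Lemma coef_1DX_exp (A : comNzRingType) (d : A) j t :
  ((1 + d%:P * 'X) ^+ j)`_t = d ^+ t *+ 'C(j, t).
Proof.
rewrite exprDn coef_sum.
under eq_bigr => i _.
  rewrite expr1n mul1r coefMn exprMn -rmorphXn coefCM coefXn; over.
have [tj|jt] := ltnP t j.+1; last first.
  rewrite bin_small // mulr0n big1 // => i _; rewrite (_ : t == i = false) ?mulr0 ?mul0rn //.
  by apply/eqP => ti; have := ltn_ord i; rewrite -ti ltnNge jt.
rewrite (bigD1 (Ordinal tj)) //= eqxx mulr1 big1 ?addr0 // => i it.
rewrite (_ : t == i = false) ?mulr0 ?mul0rn //.
by apply/negbTE; apply: contra it => /eqP ti; apply/eqP/val_inj; rewrite /= ti.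
Qed.

Section Coefficients.
Variables (mu : nat) (c : C).

(** The value at (l z, 1 + c l m) of a polynomial of weight [mu], where [a k] is its part of degree
    [k] in z. Since w has weight 2 its exponent is (mu - k)/2; in the application [a k] is 0 when mu
    - k is odd, [m] is conj l and [c] is i <z, z>. *)
Definition type_series (a : nat -> C) (l m : C) : C :=
  \sum_(k < mu.+1) a k * l ^+ k * (1 + c * (l * m)) ^+ (mu - k)./2.

(** The coefficient of l^s m^t in [type_series]: each factor m comes with a factor l, so only the
    degree k = s - t contributes, and nothing does when t > s. *)
Definition type_coef (a : nat -> C) (s t : nat) : C :=
  if (t <= s)%N then a (s - t)%N * (c ^+ t *+ 'C((mu - (s - t))./2, t)) else 0.

Lemma type_series_ev (a : nat -> C) : (forall k, (mu < k)%N -> a k = 0) ->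
  exists Q : {poly {poly C}}, (forall l m, ev Q l m = type_series a l m) /\
    forall s t, Q`_t`_s = type_coef a s t.
Proof.
move=> a0; exists (\sum_(k < mu.+1) (a k *: 'X^k)%:P * (1 + (c *: 'X)%:P * 'X) ^+ (mu - k)./2).
split=> [l m|s t].
  rewrite /ev horner_sum horner_sum; apply: eq_bigr => k _.
  rewrite hornerM hornerM hornerC horner_exp horner_exp !hornerE.
  by [].
rewrite coef_sum coef_sum.
under eq_bigr => k _.
  rewrite coefCM coef_1DX_exp exprZn scalerMnl -scalerAr coefZ -scalerAl -exprD coefZ coefXn.
  over.
rewrite /type_coef; case: leqP => ts; last first.
  rewrite big1 // => k _; rewrite (_ : s == _ = false) ?mulr0 //.
  by apply/eqP => sk; move: ts; rewrite sk ltnNge leq_addl.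
have [kmu|kmu] := ltnP (s - t) mu.+1; last first.
  rewrite a0 // mul0r big1 // => k _; rewrite (_ : s == _ = false) ?mulr0 //.
  by apply/eqP => sk; move: kmu; rewrite sk addnK leqNgt ltn_ord.
rewrite (bigD1 (Ordinal kmu)) //= subnK // eqxx mulr1 big1 ?addr0 => [|k kne].
  by rewrite mulrC.
rewrite (_ : s == _ = false) ?mulr0 //.
apply/negbTE; apply: contra kne => /eqP sk; apply/eqP/val_inj.
by rewrite /= sk addnK.
Qed.

End Coefficients.

(** Pairing with z brings one factor conj l, hence the shift of [t] by one; f has weight one less
    than g. *)
Definition fcoef mu c (b : nat -> C) (s t : nat) : C :=
  if t is t'.+1 then type_coef mu c b s t' else 0.

(* The component of type (s, t) of Im g - 2 Re <f, z>, where [a k] and [b k]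
   are the components of degree [k] in z of g and of <f, z>. *)
Definition pcoef mu c (a b : nat -> C) (s t : nat) : C :=
  (type_coef mu c a s t - conjc (type_coef mu c a t s)) / (2%:R * 'i%C) -
  (fcoef mu.-1 c b s t + conjc (fcoef mu.-1 c b t s)).

Lemma pcoef_sum mu c (a b : nat -> C) :
  (forall k, (mu < k)%N -> a k = 0) -> (forall k, (mu.-1 < k)%N -> b k = 0) ->
  exists N0, forall N, (N0 <= N)%N -> forall l,
    (type_series mu c a l (conjc l) - conjc (type_series mu c a l (conjc l))) / (2%:R * 'i%C) -
    (conjc l * type_series mu.-1 c b l (conjc l) +
      conjc (conjc l * type_series mu.-1 c b l (conjc l))) =
    \sum_(s < N) \sum_(t < N) l ^+ s * conjc l ^+ t * pcoef mu c a b s t.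
Proof.
move=> /(type_series_ev c)[Qa [Qa1 Qa2]] /(type_series_ev c)[Qb [Qb1 Qb2]].
have [Na Ha] := ev_sum Qa; have [Nb Hb] := ev_sum ('X * Qb).
exists (maxn Na Nb) => N HN l.
have {}Ha := Ha N (leq_trans (leq_maxl _ _) HN).
have {}Hb := Hb N (leq_trans (leq_maxr _ _) HN).
have Eb : conjc l * type_series mu.-1 c b l (conjc l) = ev ('X * Qb) l (conjc l).
  by rewrite /ev hornerM hornerM hornerX hornerC -Qb1.
have Hf s t : ('X * Qb)`_t`_s = fcoef mu.-1 c b s t.
  by rewrite coefXM /fcoef; case: t => [|t] /=; rewrite ?coef0 ?Qb2.
have sw (G : nat -> nat -> C) :
  conjc (\sum_(s < N) \sum_(t < N) l ^+ s * conjc l ^+ t * G s t) =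
  \sum_(s < N) \sum_(t < N) l ^+ s * conjc l ^+ t * conjc (G t s).
  rewrite conjc_sum exchange_big /=; apply: eq_bigr => s _.
  rewrite conjc_sum; apply: eq_bigr => t _.
  by rewrite !conjcM !conjcX conjcK; ring.
rewrite Eb -Qa1 Ha Hb (sw (fun s t => Qa`_t`_s)) (sw (fun s t => ('X * Qb)`_t`_s)).
rewrite -!sumrB mulr_suml -big_split -sumrB; apply: eq_bigr => s _ /=.
rewrite -sumrB mulr_suml -big_split -sumrB; apply: eq_bigr => t _ /=.
by rewrite /pcoef !Qa2 !Hf; ring.
Qed.

Section Equations.
Variables (mu : nat) (rho : R) (c : C) (a b : nat -> C).
Hypothesis cE : c = 'i%C * rho%:C.
Let P := pcoef mu c a b.
Hypothesis P0 : forall s t, ~~ ((2 <= s) && (2 <= t))%N -> P s t = 0.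

Let ii : 'i%C * 'i%C = -1 :> C. Proof. by rewrite -expr2 sqr_i. Qed.
Let i0 : 'i%C != 0 :> C. Proof. by rewrite eq_complex /= oner_eq0 andbF. Qed.
Let i20 : 2%:R * 'i%C != 0 :> C. Proof. by rewrite mulf_neq0 ?pnatr_eq0. Qed.
Let cc : conjc c = - c.
Proof. by rewrite cE conjcM conjc_real (_ : conjc 'i%C = - 'i%C) ?mulNr //; simpc. Qed.
Let c2 : c * c = - (rho%:C * rho%:C).
Proof. by rewrite cE mulrACA ii mulN1r. Qed.

(** In type (k, 0) with k >= 2 only g contributes, since <f, z> always contains conj z and its
    conjugate reaches only (1, 0). *)
Lemma type_a_ge2 k : (2 <= k)%N -> a k = 0.
Proof.
move=> k2; have := P0 (s := k) (t := 0%N); rewrite andbF => /(_ isT) /eqP.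
case: k k2 => [|[|k]] // _.
rewrite /P /pcoef /fcoef /type_coef /= conjc0 !subr0 addr0 subr0.
rewrite expr0 bin0 mulr1n mulr1 mulf_eq0 invr_eq0 (negPf i20) orbF.
by move/eqP.
Qed.

Lemma type_a0_real : conjc (a 0%N) = a 0%N.
Proof.
have := P0 (s := 0%N) (t := 0%N) isT; rewrite /P /pcoef /fcoef /type_coef /= conjc0 addr0 subr0.
rewrite expr0 bin0 mulr1n mulr1 => /eqP; rewrite mulf_eq0 invr_eq0 (negPf i20) orbF.
by rewrite subr_eq0 => /eqP.
Qed.

Lemma type_a1 : a 1%N = 2%:R * 'i%C * conjc (b 0%N).
Proof.
have := P0 (s := 1%N) (t := 0%N) isT; rewrite /P /pcoef /fcoef /type_coef /= conjc0 add0r subr0.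
rewrite !expr0 !bin0 !mulr1n !mulr1 => /eqP; rewrite subr_eq0 => /eqP h.
by rewrite -h mulrC divfK.
Qed.

(** Type (k, 1): g contributes through [a (k - 1)], already known to vanish, which leaves [b k]
    alone. *)
Lemma type_b_ge3 k : (3 <= k)%N -> b k = 0.
Proof.
move=> k3; have := P0 (s := k) (t := 1%N); rewrite andbF => /(_ isT) /eqP.
case: k k3 => [|[|[|k]]] // _.
rewrite /P /pcoef /fcoef /type_coef /= type_a_ge2 //.
rewrite mul0r conjc0 subr0 mul0r add0r addr0 expr0 bin0 mulr1n mulr1.
by rewrite oppr_eq0 => /eqP.
Qed.

(** Type (1, 1) fixes the Hermitian part of the linear term of f. Its skew part is invisible here
    and has to come from type (2, 2). *)
Lemma type_b1 : b 1%N + conjc (b 1%N) = a 0%N * (mu./2%:R * rho%:C).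
Proof.
have := P0 (s := 1%N) (t := 1%N) isT; rewrite /P /pcoef /fcoef /type_coef /= !expr0 !expr1 !bin0 !mulr1n !mulr1 subn0 bin1 => /eqP.
rewrite subr_eq0 => /eqP <-; rewrite conjcM type_a0_real -mulr_natr conjcM conjc_nat cc cE.
by rewrite subnn subn0; field; rewrite i0.
Qed.

Lemma type_b2 : b 2%N = 2%:R * (mu.-1)./2%:R * c * conjc (b 0%N).
Proof.
have := P0 (s := 2%N) (t := 1%N) isT; rewrite /P /pcoef /fcoef /type_coef /= !expr0 !expr1 !bin0 !mulr1n !mulr1 !subn0 !bin1 conjc0 subr0 subnn (_ : 2 - 1 = 1)%N // subn1.
rewrite conjcM -mulr_natr conjcM conjc_nat cc type_a1 => /eqP.
rewrite subr_eq0 => /eqP h.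
apply: (addIr (conjc (b 0%N) * (- c * (mu.-1)./2%:R))); rewrite -h.
by field; rewrite i0.
Qed.

(** [c] is imaginary, so c^2 and [a 0] are real and g drops out of the imaginary part, while c turns
    the real part of <f, z> into the skew part of [b 1]. *)
Lemma pcoef22 : P 2 2 = - ((mu.-1 - 1)./2%:R * c) * (b 1%N - conjc (b 1%N)).
Proof.
rewrite /P /pcoef /fcoef /type_coef /= !expr1 !bin1 subn0.
rewrite -!(mulr_natr c) -!(mulr_natr (c ^+ 2)) !conjcM type_a0_real !(conjcM, conjcX, conjc_nat, cc).
rewrite subnn mulrNN -expr2 subrr mul0r (_ : 2 - 1 = 1)%N //.
by ring.
Qed.

(** [a 1] and [b 2] are multiples of conj (b 0) by types (1, 0) and (2, 1); after substitution the
    only unknown is [b 0]. For odd mu and m = (mu - 1)/2 the factor is 2 m (m - 1). *)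
Lemma pcoef23 : P 2 3 =
  2%:R * (mu.-1)./2%:R * (mu.-1 - 2)./2%:R * (rho%:C * rho%:C) * b 0%N.
Proof.
rewrite /P /pcoef /fcoef /type_coef /= !expr1 !bin1. 
rewrite (_ : 3 - 2 = 1)%N // (_ : 3 - 1 = 2)%N // subnn subn0 subn1.
rewrite type_b2 type_a1 -!(mulr_natr c) -!(mulr_natr (c ^+ 2)) !(conjcM, conjcX, conjc_nat, cc) conjcK.
rewrite (_ : conjc 'i%C = - 'i%C); last by simpc.
rewrite (_ : rho%:C * rho%:C = - (c * c)); last by rewrite c2 opprK.
by field; rewrite i0.
Qed.

(** Type (1, 1) expresses the Hermitian part of [b 1] through [a 0]. For even mu and m = mu/2 the
    bracket is m C(m - 1, 2) - C(m, 3) = 2 C(m, 3). *)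
Lemma pcoef33 : P 3 3 = a 0%N * (rho%:C * (rho%:C * rho%:C)) *
  (mu./2%:R * 'C((mu.-1 - 1)./2, 2)%:R - 'C(mu./2, 3)%:R).
Proof.
rewrite /P /pcoef /fcoef /type_coef /= !subn0 (_ : 3 - 2 = 1)%N //.
rewrite -!(mulr_natr (c ^+ 3)) -!(mulr_natr (c ^+ 2)) !(conjcM, conjcX, conjc_nat, cc) type_a0_real.
set p := 'C(_, _)%:R; set q := 'C(_, _)%:R.
rewrite [LHS](_ : _ = a 0%N * (c * c * c) * p / 'i%C - (b 1%N + conjc (b 1%N)) * (c * c * q)).
  by rewrite type_b1 c2 cE; field; rewrite i0.
by field; rewrite i0.
Qed.

End Equations.
End Types.

(** * Weighted polynomials as polynomials in w with coefficients in z *)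

Section Splitting.
Context {R : realType}.
Local Notation C := R[i].

Definition wom n (i : 'I_(n + 1)) : nat := if (i < n)%N then 1%N else 2%N.
Definition xc m (i : 'I_m) (p : 'rV[C]_m) : C := p 0 i.
Definition pt n (z : 'rV[C]_n) (w : C) : 'rV[C]_(n + 1) := row_mx z (const_mx w).

Lemma wom_l n (k : 'I_n) : wom (lshift 1 k) = 1%N.
Proof. by rewrite /wom /= ltn_ord. Qed.

Lemma wom_r n (k : 'I_1) : wom (rshift n k) = 2%N.
Proof. by rewrite /wom /= ltnNge leq_addr. Qed.

Lemma wom_gt0 n (i : 'I_(n + 1)) : (0 < wom i)%N.
Proof. by rewrite /wom; case: ifP. Qed.

Lemma pt_l n (z : 'rV[C]_n) w k : pt z w 0 (lshift 1 k) = z 0 k.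
Proof. exact: row_mxEl. Qed.

Lemma pt_r n (z : 'rV[C]_n) w k : pt z w 0 (rshift n k) = w.
Proof. by rewrite /pt row_mxEr mxE. Qed.

Lemma ordlr n (P : 'I_(n + 1) -> Prop) :
  (forall k, P (lshift 1 k)) -> P (rshift n ord0) -> forall i, P i.
Proof.
move=> Hl Hr i; rewrite -(splitK i); case: (fintype.split i) => [k|k] /=; first exact: Hl.
by rewrite (ord1 k).
Qed.

Local Notation zpoly n := (gpoly (@xc n) (fun=> 1%N)).

(** The condition on the coefficient of w^i in a polynomial of weight [k]. The case distinction is
    needed because k - 2 i is a truncated subtraction: past the top degree the coefficient must be
    0, not a constant. *)
Definition half_graded n k i (h : 'rV[C]_n -> C) : Prop :=
  if (i.*2 <= k)%N then zpoly n (k - i.*2) h else forall z, h z = 0.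

Lemma half_graded0 n k i (h : 'rV[C]_n -> C) : (forall z, h z = 0) -> half_graded k i h.
Proof.
rewrite /half_graded => H; case: ifP => // _; apply: gpoly_ext (gpoly0 _ _ _) => z.
by rewrite H.
Qed.

Lemma half_gradedD n k i (f g : 'rV[C]_n -> C) :
  half_graded k i f -> half_graded k i g -> half_graded k i (fun z => f z + g z).
Proof.
rewrite /half_graded; case: ifP => _; first exact: gpolyD.
by move=> h1 h2 z; rewrite h1 h2 addr0.
Qed.

Lemma half_graded_sum n k i (J : Type) (s : seq J) (f : J -> 'rV[C]_n -> C) :
  (forall j, half_graded k i (f j)) -> half_graded k i (fun z => \sum_(j <- s) f j z).
Proof.
move=> H; elim: s => [|j s IH]; first by apply: half_graded0 => z; rewrite big_nil.
have -> : (fun z => \sum_(j <- j :: s) f j z) = fun z => f j z + \sum_(j <- s) f j z.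
  by apply/funext => z; rewrite big_cons.
exact: half_gradedD.
Qed.

Lemma half_gradedM n k k' i i' (f g : 'rV[C]_n -> C) :
  half_graded k i f -> half_graded k' i' g -> half_graded (k + k') (i + i') (fun z => f z * g z).
Proof.
rewrite {1 2}/half_graded; case: leqP => [ik|_] hf; last first.
  by move=> _; apply: half_graded0 => z; rewrite hf mul0r.
case: leqP => [ik'|_] hg; last by apply: half_graded0 => z; rewrite hg mulr0.
rewrite /half_graded doubleD leq_add //.
have -> : (k + k' - (i.*2 + i'.*2) = (k - i.*2) + (k' - i'.*2))%N by lia.
exact: gpolyM.
Qed.

Lemma gpoly_wpoly n k (f : 'rV[C]_(n + 1) -> C) : gpoly (@xc (n + 1)) (@wom n) k f ->
  exists Phi : 'rV[C]_n -> {poly C}, (forall z w, f (pt z w) = (Phi z).[w]) /\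
    forall i, half_graded k i (fun z => (Phi z)`_i).
Proof.
elim=> {k f} [c|k|i|k f g _ [F [hF1 hF2]] _ [G [hG1 hG2]]|j k f g _ [F [hF1 hF2]] _ [G [hG1 hG2]]].
- exists (fun=> c%:P); split=> [z w|i]; first by rewrite hornerC.
  case: i => [|i]; last by apply: half_graded0 => z; rewrite coefC.
  by rewrite /half_graded /=; apply: gpoly_ext (gpoly_cst _ _ c) => z; rewrite coefC.
- exists (fun=> 0); split=> [z w|i]; first by rewrite horner0.
  by apply: half_graded0 => z; rewrite coef0.
- elim/ordlr: i => [k|].
    exists (fun z => (z 0 k)%:P); split=> [z w|i]; first by rewrite hornerC /xc pt_l.
    rewrite wom_l; case: i => [|i]; last by apply: half_graded0 => z; rewrite coefC.
    rewrite /half_graded /=; apply: gpoly_ext (gpoly_gen (@xc n) (fun=> 1%N) k) => z.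
    by rewrite coefC.
  exists (fun=> 'X); split=> [z w|i]; first by rewrite hornerX /xc pt_r.
  rewrite wom_r; case: i => [|[|i]].
  + by apply: half_graded0 => z; rewrite coefX.
  + rewrite /half_graded /=; apply: gpoly_ext (gpoly_cst _ _ 1) => z.
    by rewrite coefX.
  + by apply: half_graded0 => z; rewrite coefX.
- exists (fun z => F z + G z); split=> [z w|i]; first by rewrite hornerD hF1 hG1.
  have -> : (fun z => (F z + G z)`_i) = fun z => (F z)`_i + (G z)`_i.
    by apply/funext => z; rewrite coefD.
  exact: half_gradedD.
- exists (fun z => F z * G z); split=> [z w|i]; first by rewrite hornerM hF1 hG1.
  have -> : (fun z => (F z * G z)`_i) = fun z => \sum_(l < i.+1) (F z)`_l * (G z)`_(i - l).
    by apply/funext => z; rewrite coefM.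
  apply: half_graded_sum => l; rewrite -[X in half_graded _ X](subnKC (leq_ord l)).
  exact: half_gradedM.
Qed.

Lemma sum_half (g : nat -> C) k :
  \sum_(i < k.+1) (if odd i then 0 else g i./2) = \sum_(i < k./2.+1) g i.
Proof.
elim: k => [|k IH]; first by rewrite !big_ord1.
rewrite big_ord_recr IH /= uphalf_half; case: (odd k) => /=.
  by rewrite add1n [RHS]big_ord_recr.
by rewrite addr0 add0n.
Qed.

Lemma gpoly_split n k (f : 'rV[C]_(n + 1) -> C) : gpoly (@xc (n + 1)) (@wom n) k f ->
  exists A : nat -> 'rV[C]_n -> C, [/\ forall j, zpoly n j (A j),
    forall j z, (k < j)%N || odd (k - j) -> A j z = 0 &
    forall z w, f (pt z w) = \sum_(j < k.+1) A j z * w ^+ (k - j)./2].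
Proof.
move=> /gpoly_wpoly[F [F1 F2]].
exists (fun j z => if (k < j)%N || odd (k - j) then 0 else (F z)`_((k - j)./2)); split.
- move=> j; case: (boolP ((k < j)%N || odd (k - j))) => [_|]; first exact: gpoly0.
  rewrite negb_or -leqNgt => /andP[jk ev].
  have := F2 (k - j)./2; rewrite /half_graded.
  have -> : ((k - j)./2.*2 = k - j)%N by move: (odd_double_half (k - j)); rewrite (negPf ev).
  by rewrite leq_subr subKn.
- by move=> j z ->.
move=> z w; rewrite F1.
have sF : (size (F z) <= k./2.+1)%N.
  apply/leq_sizeP => j hj; have := F2 j; rewrite /half_graded.
  by have -> : (j.*2 <= k)%N = false by lia.
rewrite (horner_coef_wide _ sF) -(sum_half (fun i => (F z)`_i * w ^+ i)) (reindex_inj rev_ord_inj) /=.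
apply: eq_bigr => j _; rewrite subSS ltnNge -ltnS ltn_ord /=.
by case: ifP => _; rewrite ?mul0r.
Qed.

Lemma zpoly_0 n j (f : 'rV[C]_n -> C) : (0 < j)%N -> zpoly n j f -> f 0 = 0.
Proof.
move=> j0 hf; rewrite (gpoly_scale (s := 0) (p := 0) (q := 0) _ hf) => [|i].
  by rewrite expr0n (gtn_eqF j0) mul0r.
by rewrite /xc mxE mulr0.
Qed.

Lemma zpoly_scale n j (f : 'rV[C]_n -> C) l z : zpoly n j f -> f (l *: z) = l ^+ j * f z.
Proof. by apply: gpoly_scale => i; rewrite /xc mxE expr1. Qed.

(** Polarization: at z + l e_k the identity is a polynomial in l and conj l that vanishes for all l,
    and its coefficient of conj l alone is, up to sign, [B k z]. *)
Lemma zpoly_pairing_eq0 n e j (B : 'I_n -> 'rV[C]_n -> C) : (forall k, zpoly n j (B k)) ->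
  (forall z, \sum_(k < n) esign e k * B k z * conjc (z 0 k) = 0) ->
  forall k z, B k z = 0.
Proof.
move=> hB H k z; pose v : 'rV[C]_n := delta_mx 0 k.
have lineB i : exists P : {poly C}, forall l, B i (z + l *: v) = P.[l].
  apply: gpoly_line (hB i) => i'; exists ((z 0 i')%:P + v 0 i' *: 'X) => l.
  by rewrite /xc !mxE !hornerE mulrC.
have [P HP] := choice lineB.
pose Q : {poly {poly C}} := \sum_(i < n) (esign e i *: P i)%:P *
   ((conjc (z 0 i))%:P%:P + (conjc (v 0 i))%:P%:P * 'X).
have Q0 : forall l, ev Q l (conjc l) = 0.
  move=> l; rewrite -(H (z + l *: v)) /ev /Q horner_sum horner_sum; apply: eq_bigr => i _.
  by rewrite !hornerE -HP !mxE conjcD conjcM; ring.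
have Q1 (i : 'I_n) : ((esign e i *: P i)%:P *
   ((conjc (z 0 i))%:P%:P + (conjc (v 0 i))%:P%:P * 'X))`_1`_0 = esign e i * B i z * conjc (v 0 i).
  rewrite coefCM coefD coefC /= add0r coefCM coefX mulr1 coefMC coefZ.
  by rewrite -horner_coef0 -HP scale0r addr0.
have := ev_eq0 Q0 0 1; rewrite /Q coef_sum coef_sum (bigD1 k) //= big1 => [|i ik].
  rewrite addr0 Q1 /v mxE !eqxx conjc1 mulr1.
  move/eqP; rewrite mulf_eq0 => /orP[|/eqP //]; rewrite /esign.
  by case: ifP => _; rewrite ?oppr_eq0 oner_eq0.
by rewrite Q1 /v mxE (negPf ik) andbF conjc0 mulr0.
Qed.

End Splitting.

(** * Injectivity of the Chern-Moser operator up to the initial data *)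

Section Kernel.
Context {R : realType}.
Local Notation C := R[i].
Local Notation zpoly n := (gpoly (@xc R n) (fun=> 1%N)).

Lemma herm_real n e (z : 'rV[C]_n) : herm e z = (complex.Re (herm e z))%:C.
Proof.
have h : conjc (herm e z) = herm e z.
  rewrite /herm conjc_sum; apply: eq_bigr => k _.
  by rewrite !conjcM conjc_esign conjcK; ring.
by rewrite ReJ_add h; field.
Qed.

Lemma herm_scale n e (l : C) (z : 'rV[C]_n) : herm e (l *: z) = l * conjc l * herm e z.
Proof.
rewrite /herm mulr_sumr; apply: eq_bigr => k _.
by rewrite !mxE conjcM; ring.
Qed.

Lemma herm_delta n e (k : 'I_n) : herm e (delta_mx 0 k : 'rV[C]_n) = esign e k.
Proof.
rewrite /herm (bigD1 k) //= big1 => [|i ik].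
  by rewrite !mxE !eqxx conjc1 !mulr1 addr0.
by rewrite !mxE (negPf ik) andbF !mul0r mulr0.
Qed.

Lemma esign_neq0 e k : esign e k != 0 :> C.
Proof. by rewrite /esign; case: ifP => _; rewrite ?oppr_eq0 oner_eq0. Qed.

Variables (n e mu : nat) (f : 'I_n -> 'rV[C]_(n + 1) -> C) (g : 'rV[C]_(n + 1) -> C).
Hypothesis mu2 : (2 <= mu)%N.
Hypothesis hf : forall k, gpoly (@xc R (n + 1)) (@wom n) mu.-1 (f k).
Hypothesis hg : gpoly (@xc R (n + 1)) (@wom n) mu g.

Definition pairing (z : 'rV[C]_n) (w : C) : C :=
  \sum_(k < n) esign e k * f k (pt z w) * conjc (z 0 k).

(* The Chern-Moser operator Im g - 2 Re <f, z> on the hyperquadric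
   w = u + i <z, z> at u = 1. *)
Definition cm_op (z : 'rV[C]_n) : C :=
  let w := 1 + 'i%C * herm e z in
  (g (pt z w) - conjc (g (pt z w))) / (2%:R * 'i%C) -
  (pairing z w + conjc (pairing z w)).

Lemma cm_kernel : exists p : nat -> nat -> 'rV[C]_n -> C,
  (forall z, exists N0, forall N, (N0 <= N)%N -> forall l,
     cm_op (l *: z) = \sum_(s < N) \sum_(t < N) l ^+ s * conjc l ^+ t * p s t z) /\
  ((forall s t z, ~~ ((2 <= s) && (2 <= t))%N -> p s t z = 0) ->
   [/\ lpoly 4 (p 2 2), lpoly 5 (p 2 3), lpoly 6 (p 3 3) &
    (0 < n)%N ->
    (exists2 eps : R, 0 < eps & forall z : 'rV[C]_n, (forall i, `|z 0 i| < eps%:C) ->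
      [/\ Lapz e (p 2 2) z = 0, iter 2 (Lapz e) (p 2 3) z = 0 &
          iter 3 (Lapz e) (p 3 3) z = 0]) ->
    (mu = 2 -> forall k z, f k (pt z 0) = 0) ->
    (mu = 3 -> forall k, f k (pt 0 1) = 0) ->
    (mu = 4 -> complex.Re (g (pt 0 1)) = 0) ->
    (forall k x, f k x = 0) /\ (forall x, g x = 0)]).
Proof.
have [A [hA A0 gA]] := gpoly_split hg.
have [B HB] := choice (fun k => gpoly_split (hf k)).
have hB k j : zpoly n j (B k j) by have [h _ _] := HB k; exact: h.
have B0 k j z : (mu.-1 < j)%N || odd (mu.-1 - j) -> B k j z = 0.
  by have [_ h _] := HB k; exact: h.
have fB k z w : f k (pt z w) = \sum_(j < mu.-1.+1) B k j z * w ^+ (mu.-1 - j)./2.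
  by have [_ _ h] := HB k; exact: h.
pose a z j := A j z.
pose b (z : 'rV[C]_n) j := \sum_(k < n) esign e k * B k j z * conjc (z 0 k).
pose c (z : 'rV[C]_n) : C := 'i%C * (complex.Re (herm e z))%:C.
exists (fun s t z => pcoef mu (c z) (a z) (b z) s t); split.
  move=> z; have [||N0 H] := @pcoef_sum R mu (c z) (a z) (b z).
  - by move=> k hk; rewrite /a A0 ?hk.
  - by move=> k hk; rewrite /b big1 // => i _; rewrite B0 ?hk // mulr0 mul0r.
  exists N0 => N HN l; rewrite -H // /cm_op.
  have -> : 1 + 'i%C * herm e (l *: z) = 1 + c z * (l * conjc l).
    by rewrite herm_scale /c -herm_real; ring.
  have -> : g (pt (l *: z) (1 + c z * (l * conjc l))) = type_series mu (c z) (a z) l (conjc l).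
    rewrite gA; apply: eq_bigr => k _; rewrite (zpoly_scale _ _ (hA k)) /a; ring.
  have -> // : pairing (l *: z) (1 + c z * (l * conjc l)) = conjc l * type_series mu.-1 (c z) (b z) l (conjc l).
  rewrite /pairing /type_series mulr_sumr.
  under eq_bigr => k _ do rewrite fB mulr_sumr mulr_suml.
  rewrite exchange_big /=; apply: eq_bigr => j _; rewrite /b !mulr_suml mulr_sumr.
  by apply: eq_bigr => k _; rewrite (zpoly_scale _ _ (hB k j)) !mxE conjcM; ring.
move=> P0; have cE z : c z = 'i%C * (complex.Re (herm e z))%:C by [].
have P0z z s t : ~~ ((2 <= s) && (2 <= t))%N -> pcoef mu (c z) (a z) (b z) s t = 0 by exact: P0.
have om1 (i : 'I_n) : (0 < (fun=> 1%N) i)%N by [].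
have [beta Hbeta] : exists beta : 'I_n -> 'I_n -> C, forall k z, B k 1%N z = \sum_(j < n) beta k j * z 0 j.
  have /choice[beta H] k := gpoly_deg1 om1 (hB k 1%N).
  by exists beta => k z; rewrite H; apply: eq_bigl => j.
have [b0 Hb0] : exists b0 : 'I_n -> C, forall k z, B k 0%N z = b0 k.
  by have /choice[b0 H] k := gpoly_deg0 om1 (hB k 0%N); exists b0.
have [a0 Ha0] := gpoly_deg0 om1 (hA 0%N).
pose H (j k : 'I_n) : C := - ((mu.-1 - 1)./2%:R * 'i%C) * (esign e k * beta k j - conjc (esign e j * beta j k)).
have b1E z : b z 1%N = \sum_(j < n) \sum_(k < n) esign e k * beta k j * (z 0 j * conjc (z 0 k)).
  rewrite /b exchange_big /=; apply: eq_bigr => k _; rewrite Hbeta mulr_sumr mulr_suml.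
  by apply: eq_bigr => j _; ring.
have cb1E z : conjc (b z 1%N) = \sum_(j < n) \sum_(k < n) conjc (esign e j * beta j k) * (z 0 j * conjc (z 0 k)).
  rewrite b1E exchange_big conjc_sum; apply: eq_bigr => k _.
  rewrite conjc_sum; apply: eq_bigr => j _.
  by rewrite !conjcM conjcK; ring.
have p22 : (fun z => pcoef mu (c z) (a z) (b z) 2 2) = fun z => herm e z *
    \sum_(j < n) \sum_(k < n) H j k * (z 0 j * conjc (z 0 k)).
  apply/funext => z; rewrite (pcoef22 (cE z) (P0z z)) cE -herm_real.
  rewrite [X in _ = _ * X](_ : _ = - ((mu.-1 - 1)./2%:R * 'i%C) * (b z 1%N - conjc (b z 1%N))); first by ring.
  rewrite cb1E b1E -sumrB mulr_sumr; apply: eq_bigr => j _.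
  rewrite -sumrB mulr_sumr; apply: eq_bigr => k _.
  by rewrite /H; ring.
pose bb (k : 'I_n) : C := 2%:R * (mu.-1)./2%:R * (mu.-1 - 2)./2%:R * (esign e k * b0 k).
have bz0 z : b z 0%N = \sum_(k < n) esign e k * b0 k * conjc (z 0 k).
  by apply: eq_bigr => k _; rewrite Hb0.
have p23 : (fun z => pcoef mu (c z) (a z) (b z) 2 3) = fun z => herm e z * (herm e z *
    \sum_(k < n) bb k * conjc (z 0 k)).
  apply/funext => z; rewrite (pcoef23 (cE z) (P0z z)) -herm_real.
  rewrite bz0 (mulrA (herm e z)) mulr_sumr [RHS]mulr_sumr; apply: eq_bigr => k _.
  by rewrite /bb; ring.
pose K : C := mu./2%:R * 'C((mu.-1 - 1)./2, 2)%:R - 'C(mu./2, 3)%:R.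
have p33 : (fun z => pcoef mu (c z) (a z) (b z) 3 3) = fun z => (a0 * K) *
    (herm e z * (herm e z * herm e z)).
  by apply/funext => z; rewrite (pcoef33 (cE z) (P0z z)) -herm_real /a Ha0 /K; ring.
split.
- by rewrite p22; apply: (@lpolyM _ _ 2 2); [exact: lpoly_herm|exact: lpoly_sesq].
- rewrite p23; apply: (@lpolyM _ _ 2 3); first exact: lpoly_herm.
  by apply: (@lpolyM _ _ 2 1); [exact: lpoly_herm|exact: lpoly_ell].
- rewrite p33; apply: lpolyZ; apply: (@lpolyM _ _ 2 4); first exact: lpoly_herm.
  by apply: (@lpolyM _ _ 2 2); exact: lpoly_herm.
move=> n0 [eps e0 Heps] I2 I3 I4.
pose k0 := Ordinal n0; pose z0 : 'rV[C]_n := delta_mx 0 k0.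
have smallz k : exists2 z : 'rV[C]_n, (forall i, `|z 0 i| < eps%:C) & z = (eps / 2)%:C *: delta_mx 0 k.
  exists ((eps / 2)%:C *: delta_mx 0 k) => // i; rewrite !mxE eqxx /= normrM.
  have e2 : `|(eps / 2)%:C| < eps%:C :> C.
    rewrite ger0_norm ?ler0c ?divr_ge0 ?(ltW e0) // ltcR.
    by rewrite ltr_pdivrMr // -{1}[eps]mulr1 ltr_pM2l // ltr1n.
  apply: le_lt_trans e2; rewrite ler_piMr //.
  by case: (i == k); rewrite ?normr1 ?normr0.
have nn q : (n + q)%:R != 0 :> C by rewrite pnatr_eq0 addn_eq0 negb_and -lt0n n0.
have e2n0 : (eps / 2)%:C != 0 :> C.
  by rewrite eq_complex /= eqxx andbT mulf_neq0 ?invr_neq0 ?lt0r_neq0.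
have Bge3 j : (3 <= j)%N -> forall k z, B k j z = 0.
  move=> j3; apply: (zpoly_pairing_eq0 (e := e) (fun k => hB k j)) => z.
  exact: (type_b_ge3 (P0z z) j3).
have B00 k z : B k 0%N z = 0.
  (* Weight 3 is prescribed; for even [mu] parity removes [B k 0]; for odd [mu] from 5 on the factor
     2 m (m - 1) is nonzero and the (2, 3) trace condition isolates [b0 k] at a multiple of e_k. *)
  have [/eqP mu3|mu3] := boolP (mu == 3).
    have := I3 mu3 k; rewrite fB mu3 !big_ord_recl big_ord0 /= !expr1n !mulr1 addr0.
    rewrite (zpoly_0 _ (hB k (bump 0 0))) // (zpoly_0 _ (hB k (bump 0 (bump 0 0)))) //.
    by rewrite !addr0 !Hb0.
  have [od|ev] := boolP (odd mu.-1); first by rewrite B0 ?subn0 ?od ?orbT.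
  have [w ws wE] := smallz k; have [_ h _] := Heps w ws; move: h.
  rewrite p23 Lapz2_herm2_ell => /eqP; rewrite !mulf_eq0 !(negPf (nn _)) pnatr_eq0 /=.
  rewrite (bigD1 k) //= big1 => [|i ik]; last first.
    by rewrite wE !mxE (negPf ik) andbF mulr0 conjc0 mulr0.
  rewrite addr0 wE !mxE !eqxx mulr1 conjc_real mulf_eq0 (negPf e2n0) orbF.
  rewrite /bb !mulf_eq0 !pnatr_eq0 (negPf (esign_neq0 _ _)) /= Hb0.
  have -> : ((mu.-1)./2 == 0 = false)%N by move: mu2 mu3 ev; lia.
  have -> : ((mu.-1 - 2)./2 == 0 = false)%N by move: mu2 mu3 ev; lia.
  by move/eqP.
have b0z z : b z 0%N = 0.
  by rewrite /b big1 // => k _; rewrite B00 mulr0 mul0r.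
have B20 : forall k z, B k 2%N z = 0.
  apply: (zpoly_pairing_eq0 (e := e) (fun k => hB k 2%N)) => z.
  have := type_b2 (cE z) (P0z z); rewrite b0z conjc0 mulr0; exact.
have b1r z : b z 1%N = conjc (b z 1%N).
  (* Weight 2 is prescribed, odd weights go by parity, and from 4 on the (2, 2) trace condition
     kills the whole skew form, not only its trace. *)
  have [/eqP mu2'|mu2'] := boolP (mu == 2).
    rewrite /b; have B1 k : B k 1%N z = 0.
      have := I2 mu2' k z; rewrite fB mu2' !big_ord_recl big_ord0 /= addr0.
      by rewrite B00 mul0r add0r expr0 mulr1.
    rewrite big1 ?conjc0 // => k _; by rewrite B1 mulr0 mul0r.
  have [od|ev] := boolP (odd (mu.-1 - 1)).
    by rewrite /b big1 ?conjc0 // => k _; rewrite B0 ?od ?orbT // mulr0 mul0r.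
  have hs : \sum_(j < n) \sum_(k < n) H j k * (z 0 j * conjc (z 0 k)) = 0.
    apply: (@Lapz_herm_sesq_eq0 R n e H eps n0 e0) => w ws.
    by rewrite -p22; have [] := Heps w ws.
  move: hs; rewrite (_ : \sum_(j < n) _ = - ((mu.-1 - 1)./2%:R * 'i%C) * (b z 1%N - conjc (b z 1%N))).
    move/eqP; rewrite mulf_eq0 oppr_eq0 mulf_eq0 pnatr_eq0.
    have -> : ((mu.-1 - 1)./2 == 0 = false)%N by move: mu2 mu2' ev; lia.
    rewrite (_ : ('i%C == 0 :> C) = false) /= ?subr_eq0; first by move/eqP.
    by rewrite eq_complex /= oner_eq0 andbF.
  rewrite cb1E b1E -sumrB mulr_sumr; apply: eq_bigr => j _.
  rewrite -sumrB mulr_sumr; apply: eq_bigr => k _.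
  by rewrite /H; ring.
(* With the skew part gone, type (1, 1) makes [b z 1] a multiple of <z, z>; the single scalar [a0]
   is left. *)
have b1a z : 2%:R * b z 1%N = a0 * (mu./2%:R * herm e z).
  have := type_b1 (cE z) (P0z z); rewrite -b1r -herm_real /a Ha0 => <-.
  by rewrite mulr2n mulrDl mul1r.
have a0c : conjc a0 = a0 by have := type_a0_real (P0z 0); rewrite /a Ha0.
have a00 : a0 = 0.
  have [/eqP mu2'|mu2'] := boolP (mu == 2).
    have := b1a z0; rewrite /b big1 => [|k _].
      rewrite mulr0 mu2' mul1r herm_delta => /esym/eqP.
      by rewrite mulf_eq0 (negPf (esign_neq0 _ _)) orbF => /eqP.
    have -> : B k 1%N z0 = 0.
      have := I2 mu2' k z0; rewrite fB mu2' !big_ord_recl big_ord0 /= addr0.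
      by rewrite B00 mul0r add0r expr0 mulr1.
    by rewrite mulr0 mul0r.
  have [od|ev] := boolP (odd mu); first by rewrite -(Ha0 0) A0 // subn0 od orbT.
  have [/eqP mu4|mu4] := boolP (mu == 4).
    have := I4 mu4; rewrite gA big_ord_recl big1 => [|j _]; last first.
      by rewrite (zpoly_0 _ (hA _)) ?mul0r.
    rewrite addr0 /= Ha0 expr1n mulr1 => ra; rewrite -[a0]RRe_real ?ra //.
    apply/complex_realP; exists (complex.Re a0).
    by rewrite ReJ_add a0c; field.
  have l6 : lpoly 6 (fun z : 'rV[C]_n => herm e z * (herm e z * herm e z)).
    apply: (@lpolyM _ _ 2 4); first exact: lpoly_herm.
    by apply: (@lpolyM _ _ 2 2); exact: lpoly_herm.
  have iterZ (q : 'rV[C]_n -> C) (d : C) j : lpoly 6 q ->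
      iter j (Lapz e) (fun z => d * q z) = fun z => d * iter j (Lapz e) q z.
    move=> lq; elim: j => [//|j IH]; apply/funext => z; rewrite iterS IH.
    by rewrite (LapzZ _ _ _ (comb_lpoly (comb_iter_Lapz _ _ _ _) lq)).
  have [w ws _] := smallz k0; have [_ _ h] := Heps w ws; move: h.
  rewrite p33 iterZ // Lapz3_herm3 => /eqP.
  have nn0 : n%:R != 0 :> C by rewrite pnatr_eq0 -lt0n.
  rewrite !mulf_eq0 !(negPf (nn _)) (negPf nn0) !pnatr_eq0 /= !orbF => /orP[/eqP //|].
  have [j [jmu j3]] : exists j, mu = j.+1.*2 /\ (3 <= j.+1)%N.
    by exists (mu./2.-1); split; move: mu2 mu2' mu4 ev; lia.
  rewrite /K; have -> : (mu.-1 - 1)./2 = j by rewrite jmu; lia.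
  have -> : mu./2 = j.+1 by rewrite jmu; lia.
  (* (j + 1) C(j, 2) = 3 C(j + 1, 3), so [K] is 2 C(j + 1, 3), nonzero because j + 1 >= 3. *)
  rewrite -natrM (mul_bin_diag j.+1 2) natrM -{2}['C(_, _)%:R]mul1r -mulrBl mulf_eq0.
  have -> : (3%:R - 1 : C) = 2%:R by ring.
  by rewrite !pnatr_eq0 /= -leqn0 leqNgt bin_gt0 j3.
have B10 : forall k z, B k 1%N z = 0.
  apply: (zpoly_pairing_eq0 (e := e) (fun k => hB k 1%N)) => z.
  have := b1a z; rewrite a00 mul0r => /eqP; rewrite mulf_eq0 pnatr_eq0 /=.
  by move/eqP.
have BA k j z : B k j z = 0.
  by case: j => [|[|[|j]]]; [exact: B00|exact: B10|exact: B20|exact: Bge3].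
have AA j z : A j z = 0.
  case: j => [|[|j]]; first by rewrite Ha0.
    by have := type_a1 (P0z z); rewrite b0z conjc0 mulr0.
  exact: (type_a_ge2 (P0z z)).
have ptE (x : 'rV[C]_(n + 1)) : x = pt (lsubmx x) (rsubmx x 0 0).
  apply/rowP; elim/ordlr => [k|]; first by rewrite pt_l mxE.
  by rewrite pt_r mxE.
split=> [k x|x]; rewrite (ptE x) ?fB ?gA big1 // => j _.
  by rewrite BA mul0r.
by rewrite AA mul0r.
Qed.

End Kernel.

(** * Expansion of a normal form *)

Section RealCoordinates.
Context {R : realType}.
Local Notation C := R[i].

Definition rc n (z : 'rV[C]_n) (u : R) : 'rV[R]_(n + n + 1) :=
  row_mx (row_mx (\row_k complex.Re (z 0 k)) (\row_k complex.Im (z 0 k))) (const_mx u).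

Lemma real_coords_rc T n (F : 'rV[C]_n -> R -> T) z u : real_coords F (rc z u) = F z u.
Proof.
rewrite /real_coords /rc !row_mxKl !row_mxKr mxE; congr F.
by apply/rowP => k; rewrite !mxE; case: (z 0 k).
Qed.

Lemma rcP n (t : 'rV[R]_(n + n + 1)) : exists z u, t = rc z u.
Proof.
exists (\row_k (lsubmx (lsubmx t) 0 k +i* rsubmx (lsubmx t) 0 k)), (rsubmx t 0 0).
rewrite /rc -[LHS]hsubmxK -[lsubmx t in LHS]hsubmxK; congr (row_mx (row_mx _ _) _).
- by apply/rowP => k; rewrite !mxE.
- by apply/rowP => k; rewrite !mxE.
- by apply/rowP => k; rewrite !mxE (ord1 k).
Qed.

Lemma rc_ind n (P : 'I_(n + n + 1) -> Prop) :
  (forall k : 'I_n, P (lshift 1 (lshift n k))) -> (forall k : 'I_n, P (lshift 1 (rshift n k))) ->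
  P (rshift (n + n) ord0) -> forall i, P i.
Proof.
move=> H1 H2 H3; apply: ordlr => // k; rewrite -(splitK k).
by case: (fintype.split k) => j /=.
Qed.

Lemma rc_re n (z : 'rV[C]_n) u k : rc z u 0 (lshift 1 (lshift n k)) = complex.Re (z 0 k).
Proof. by rewrite /rc row_mxEl row_mxEl mxE. Qed.

Lemma rc_im n (z : 'rV[C]_n) u k : rc z u 0 (lshift 1 (rshift n k)) = complex.Im (z 0 k).
Proof. by rewrite /rc row_mxEl row_mxEr mxE. Qed.

Lemma rc_u n (z : 'rV[C]_n) u k : rc z u 0 (rshift (n + n) k) = u.
Proof. by rewrite /rc row_mxEr mxE. Qed.

(** Three weightings occur: (1, 0) scales z with u as a parameter, (1, 1) is the ordinary degree,
    and (1, 2) is the weighting of the hyperquadric. *)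
Definition uwt n (a b : nat) (i : 'I_(n + n + 1)) : nat := if (i < n + n)%N then a else b.

Lemma uwt_re n a b (k : 'I_n) : uwt a b (lshift 1 (lshift n k)) = a.
Proof. by rewrite /uwt /= (leq_trans (ltn_ord k)) // leq_addr. Qed.
Lemma uwt_im n a b (k : 'I_n) : uwt a b (lshift 1 (rshift n k)) = a.
Proof. by rewrite /uwt /= ltn_add2l ltn_ord. Qed.
Lemma uwt_u n a b k : uwt a b (rshift (n + n) k : 'I_(n + n + 1)) = b.
Proof. by rewrite /uwt /= ltnNge leq_addr. Qed.

Lemma normC_Re (x : C) : `|x| = (complex.Re `|x|)%:C.
Proof. by rewrite RRe_real // ger0_real. Qed.

Lemma normC_real (y : R) : `|y%:C| = `|y|%:C :> C.
Proof. by rewrite normc_def /= expr0n /= addr0 sqrtr_sqr. Qed.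

Lemma normc_ge_Im (x : C) : `|complex.Im x|%:C <= `|x|.
Proof.
have := normc_ge_Re (x * 'i%C); rewrite ReiNIm normrN normrM.
rewrite (_ : `|'i%C : C| = 1) ?mulr1 //.
by rewrite normc_def /= expr0n expr1n add0r sqrtr1.
Qed.

Lemma rc_bound n (z : 'rV[C]_n) u (b : R) : (forall k, `|z 0 k| <= b%:C) -> `|u| <= b ->
  forall i, `|rc z u 0 i| <= b.
Proof.
move=> hz hu; apply: rc_ind => [k|k|]; last by rewrite rc_u.
  by rewrite rc_re -lecR (le_trans (normc_ge_Re _)).
by rewrite rc_im -lecR (le_trans (normc_ge_Im _)).
Qed.

Lemma near0_realC m (Q : 'rV[C]_m -> Prop) :
  (\forall h \near (0 : 'rV[C]_m), Q h) ->
  exists2 d : R, 0 < d & forall h : 'rV[C]_m, (forall i, `|h 0 i| < d%:C) -> Q h.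
Proof. by move=> /near0_rowP[x /ltc0_real[d d0 ->] H]; exists d. Qed.

Lemma near0_C (Q : C -> Prop) : (\forall u \near (0 : C), Q u) ->
  exists2 d : R, 0 < d & forall u : C, `|u| < d%:C -> Q u.
Proof.
move=> /nbhs_ballP[x /= /ltc0_real[d d0 ->] H]; exists d => // u ud; apply: H.
by rewrite /ball /= sub0r normrN.
Qed.

Lemma near0_zu n (Q : 'rV[C]_n -> R -> Prop) :
  (\forall z \near (0 : 'rV[C]_n) & u \near (0 : R), Q z u) ->
  exists2 d : R, 0 < d & forall (z : 'rV[C]_n) u, (forall i, `|z 0 i| < d%:C) -> `|u| < d -> Q z u.
Proof.
move=> [[A B] /= [HA /nbhs_ballP[d2 /= d20 HB]] H].
have [d1 d10 {}HA] := near0_realC HA.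
exists (Num.min d1 d2); first by rewrite lt_min d10.
move=> z u hz hu; apply: (H (z, u)); split => /=.
  by apply: HA => i; apply: lt_le_trans (hz i) _; rewrite lecR ge_min lexx.
apply: HB; rewrite /ball /= sub0r normrN; apply: lt_le_trans hu _.
by rewrite ge_min lexx orbT.
Qed.

End RealCoordinates.

(** * Tails of the series over types *)

Section DoubleSeries.
Context {R : realType}.
Local Notation C := R[i].

Definition low_types (N s t : nat) : bool := [&& (2 <= s)%N, (2 <= t)%N & (s + t < N)%N].

Lemma double_sum_low (x : nat -> nat -> C) N M : (N <= M)%N ->
  \sum_(2 <= s < M) \sum_(2 <= t < M) x s t =
  \sum_(s < N) \sum_(t < N) (if low_types N s t then x s t else 0) +
  \sum_(2 <= s < M) \sum_(2 <= t < M) (if (s + t < N)%N then 0 else x s t).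
Proof.
move=> NM; apply/eqP; rewrite -subr_eq; apply/eqP; rewrite -sumrB.
under eq_bigr => s _.
  rewrite -sumrB; under eq_bigr => t _.
    rewrite (_ : x s t - _ = if (s + t < N)%N then x s t else 0); last first.
      by case: ifP => _; rewrite ?subr0 ?subrr.
    over.
  over.
rewrite big_geq_mkord; apply/esym.
rewrite [LHS](big_ord_widen_cond M predT (fun s => \sum_(t < N) (if low_types N s t then x s t else 0)) NM).
rewrite big_mkcond [RHS]big_mkcond; apply: eq_bigr => s _ /=.
case: ltnP => sN; last first.
  case: ifP => // _; rewrite big_nat big1 // => t _.
  by rewrite ifF //; apply/negbTE; rewrite -leqNgt (leq_trans sN) ?leq_addr.
rewrite (big_ord_widen_cond M predT (fun t => if low_types N s t then x s t else 0) NM).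
rewrite big_geq_mkord; case: ltnP => s2 /=; last first.
  by rewrite big1 // => t _; rewrite /low_types leqNgt ltnS s2.
rewrite big_mkcond [RHS]big_mkcond; apply: eq_bigr => t _ /=; rewrite /low_types s2 /=.
case: ltnP => tN; case: ltnP => t2 //=.
by rewrite ifF //; apply/negbTE; rewrite -leqNgt (leq_trans tN) ?leq_addl.
Qed.

(** Scaling z by [r] multiplies type (s, t) by r^(s + t), so absolute convergence at the unscaled
    point bounds all types with s + t >= N at once. *)
Lemma double_sum_scaled_tail (x : nat -> nat -> C) (l B : C) (r : R) N :
  0 <= r <= 1 ->
  (forall M, \sum_(2 <= s < M) \sum_(2 <= t < M) `|x s t| <= B) ->
  (fun M : nat => \sum_(2 <= s < M) \sum_(2 <= t < M) r%:C ^+ (s + t) * x s t) @ \oo --> l ->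
  `|l - \sum_(s < N) \sum_(t < N) (if low_types N s t then r%:C ^+ (s + t) * x s t else 0)|
    <= B * r%:C ^+ N.
Proof.
move=> /andP[r0 r1] HB Hl.
have B0 : 0 <= B.
  by apply: le_trans (HB 0%N); apply: sumr_ge0 => s _; apply: sumr_ge0 => t _; exact: normr_ge0.
have rc0 : 0 <= r%:C by rewrite ler0c.
have rc1 : r%:C <= 1 :> C by rewrite (_ : 1 = 1%:C) // lecR.
apply: (norm_lim_le _ Hl); first by rewrite mulr_ge0 // exprn_ge0.
exists N => M NM; rewrite (double_sum_low _ NM) addrC addKr.
apply: le_trans (ler_norm_sum _ _ _) _.
rewrite mulrC; apply: le_trans (ler_wpM2l (exprn_ge0 _ rc0) (HB M)).
rewrite mulr_sumr; apply: ler_sum => s _.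
apply: le_trans (ler_norm_sum _ _ _) _; rewrite mulr_sumr; apply: ler_sum => t _.
case: ltnP => st; first by rewrite normr0 mulr_ge0 // exprn_ge0.
by rewrite normrM ler_wpM2r // normrX ger0_norm // ler_wiXn2l.
Qed.

End DoubleSeries.

Section NormalForm.
Context {R : realType}.
Local Notation C := R[i].

Lemma rc_scale n (z : 'rV[C]_n) u (s : R) (a b : nat) :
  \row_i (s ^+ uwt a b i * rc z u 0 i) = rc ((s ^+ a)%:C *: z) (s ^+ b * u).
Proof.
apply/rowP; apply: rc_ind => [k|k|].
- by rewrite mxE uwt_re !rc_re mxE; case: (z 0 k) => x y /=; rewrite mul0r subr0.
- by rewrite mxE uwt_im !rc_im mxE; case: (z 0 k) => x y /=; rewrite mul0r addr0.
- by rewrite mxE uwt_u !rc_u.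
Qed.

Lemma gpoly_lpoly n T I (x : I -> T -> C) om (th : 'rV[C]_n -> T) k f :
  (forall i, lpoly (om i) (fun z => x i (th z))) -> gpoly x om k f ->
  lpoly k (fun z => f (th z)).
Proof.
move=> H; elim=> {k f} [c|k|i|k f g _ h1 _ h2|j k f g _ h1 _ h2] //.
- exact: lpoly_cst.
- by apply: (lpolyW (leq0n k)); exact: lpoly_cst.
- exact: lpolyD.
- exact: lpolyM.
Qed.

Variables (n e : nat) (Fstar : 'rV[C]_n -> R -> R)
  (Fst : nat -> nat -> 'rV[C]_n -> 'rV[C]_n -> C -> C).
Hypothesis Fstar_an : real_analytic_near0 Fstar.
Hypothesis Fstar_sum : \forall z \near (0 : 'rV[C]_n) & u \near (0 : R),
  has_double_sum_ge2 (fun s t => on_diagonal (Fst s t) z u) ((Fstar z u)%:C - herm e z).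
Hypothesis Fst_an : \forall q \near (0 : 'rV[C]_(n + n + 1)), forall s t : nat,
  (2 <= s)%N -> (2 <= t)%N -> analytic_at (uncurry3 (Fst s t)) q.
Hypothesis Fst_type : \forall u \near (0 : C), forall s t : nat,
  (2 <= s)%N -> (2 <= t)%N -> forall (mu nu : C) (z zeta : 'rV[C]_n),
    Fst s t (mu *: z) (nu *: zeta) u = mu ^+ s * nu ^+ t * Fst s t z zeta u.

Definition low_part N (z : 'rV[C]_n) (u : R) (r : C) : C :=
  \sum_(s < N) \sum_(t < N)
    (if low_types N s t then r ^+ (s + t) * on_diagonal (Fst s t) z u else 0).

Lemma Fst_scale : exists2 d : R, 0 < d & forall u : R, `|u| < d -> forall s t,
  (2 <= s)%N -> (2 <= t)%N -> forall (l : C) (z : 'rV[C]_n),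
    on_diagonal (Fst s t) (l *: z) u = l ^+ s * conjc l ^+ t * on_diagonal (Fst s t) z u.
Proof.
have [d d0 H] := near0_C Fst_type; exists d => // u ud s t s2 t2 l z.
rewrite /on_diagonal -H //; last by rewrite normC_real ltcR.
congr (Fst s t); apply/rowP => k; by rewrite !mxE conjcM.
Qed.

Lemma low_part_by_degree N z u : exists y : nat -> C, forall r,
  low_part N z u r = \sum_(d < N) r ^+ d * y d.
Proof.
exists (fun d => \sum_(s < N) \sum_(t < N)
  (if low_types N s t && (s + t == d)%N then on_diagonal (Fst s t) z u else 0)) => r.
rewrite /low_part; under [RHS]eq_bigr => d _ do rewrite mulr_sumr.
rewrite [RHS]exchange_big /=; apply: eq_bigr => s _.
under [RHS]eq_bigr => d _ do rewrite mulr_sumr.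
rewrite [RHS]exchange_big /=; apply: eq_bigr => t _.
case lt: (low_types N s t) => /=; last by rewrite big1 // => d _; rewrite mulr0.
have stN : (s + t < N)%N by case/and3P: lt.
rewrite (bigD1 (Ordinal stN)) //= eqxx big1 ?addr0 // => d dst.
rewrite ifF ?mulr0 //; apply: contraNF dst => /eqP h; apply/eqP/val_inj.
by rewrite /= h.
Qed.

(** The double series gives a remainder bound whose constant may depend on u, while u moves with
    [r]. The fibre expansion has a constant uniform in u but unknown coefficients. For fixed u both
    expand the same function of a scaling parameter [s], so the coefficients agree and the uniform
    bound carries over to the low types. *)
Lemma nf_expansion N z (u : R -> R) : (3 <= N)%N -> vanish 1 (fun r => (u r)%:C) ->
  vanish N (fun r => (Fstar (r%:C *: z) (u r))%:C - herm e (r%:C *: z) - low_part N z (u r) r%:C).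
Proof.
move=> N3 hu; have [c fc] : analytic_at (real_coords Fstar) 0 by exact: nbhs_singleton Fstar_an.
have [e1 e10 He1] := fiber_expansion (uwt 1 0) fc; have [B HB] := He1 N.
have [d1 d10 Hd1] := near0_zu Fstar_sum; have [d2 d20 Hd2] := Fst_scale.
pose m := Num.min e1 d1; have m0 : 0 < m by rewrite lt_min e10.
pose S := 1 + \sum_i complex.Re `|z 0 i|.
have zi0 i : 0 <= complex.Re `|z 0 i| by rewrite -ler0c -normC_Re.
have S0 : 0 < S by rewrite ltr_pwDl // sumr_ge0.
pose eta := m / S; have eta0 : 0 < eta by rewrite divr_gt0.
pose z0 := eta%:C *: z.
have z0m i : `|z0 0 i| < m%:C.
  rewrite mxE normrM normC_real (ger0_norm (ltW eta0)) normC_Re -rmorphM ltcR.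
  rewrite /eta mulrAC -mulrA gtr_pMr // ltr_pdivrMr // mul1r /S (bigD1 i) //.
  by rewrite addrCA ltrDl ltr_pwDl // sumr_ge0.
exists (B / eta ^+ N); near=> r.
have r0 : 0 < r by near: r; exact: nbhs_right_gt.
have re : r <= eta by near: r; exact: nbhs_right_le.
have um : `|u r| < m.
  by rewrite -ltcR -normC_real; near: r; apply: vanish_lt1.
have ud2 : `|u r| < d2.
  by rewrite -ltcR -normC_real; near: r; apply: vanish_lt1.
have zs (s : R) i : 0 <= s <= 1 -> `|(s%:C *: z0) 0 i| < m%:C.
  move=> /andP[s0 s1]; rewrite mxE normrM normC_real (ger0_norm s0).
  apply: le_lt_trans (z0m i); rewrite ler_piMl //.
  by rewrite (_ : 1 = 1%:C) // lecR.
have [q Hq] : exists q : nat -> R, forall s : R, 0 <= s <= 1 ->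
    `|(Fstar (s%:C *: z0) (u r))%:C - \sum_(d < N) s%:C ^+ d * (q d)%:C| <= (B * s ^+ N)%:C.
  have [|q Hq] := HB (rc z0 (u r)).
    move=> i; apply: rc_bound; last by rewrite (le_trans (ltW um)) // ge_min lexx.
    by move=> k; rewrite (le_trans (ltW (z0m k))) // lecR ge_min lexx.
  exists q => s s01; have := Hq s s01; rewrite rc_scale expr1 expr0 mul1r add0r real_coords_rc.
  rewrite -lecR -normC_real; congr (`|_| <= _).
  rewrite rmorphB rmorph_sum; congr (_ - _); apply: eq_bigr => d _.
  by rewrite rmorphM rmorphXn.
have [y Hy] := low_part_by_degree N z0 (u r).
have [D HD] : exists D : R, forall s : R, 0 <= s <= 1 ->
    `|(Fstar (s%:C *: z0) (u r))%:C - herm e (s%:C *: z0) - low_part N z0 (u r) s%:C|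
      <= (D * s ^+ N)%:C.
  have [|//|[D HD] _] := Hd1 z0 (u r).
  - by move=> i; rewrite (lt_le_trans (z0m i)) // lecR ge_min lexx orbT.
  - by rewrite (lt_le_trans um) // ge_min lexx orbT.
  have D0 : 0 <= D.
    by apply: le_trans (HD 0%N); apply: sumr_ge0 => s _; apply: sumr_ge0 => t _; exact: normr_ge0.
  have [D' D'0 DE] := lec0_real D0; exists D' => s s01.
  have [|//|_ Hl] := Hd1 (s%:C *: z0) (u r).
  - by move=> i; rewrite (lt_le_trans (zs _ _ s01)) // lecR ge_min lexx orbT.
  - by rewrite (lt_le_trans um) // ge_min lexx orbT.
  have -> : (D' * s ^+ N)%:C = D * s%:C ^+ N by rewrite DE -rmorphXn -rmorphM.
  apply: (@double_sum_scaled_tail _ (fun s t => on_diagonal (Fst s t) z0 (u r))) => //.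
  apply: cvg_trans Hl; apply: near_eq_cvg; near=> M.
  apply: eq_big_nat => s' /andP[s'2 _]; apply: eq_big_nat => t /andP[t2 _].
  by rewrite Hd2 // conjc_real -exprD.
pose yy d := y d + (if d == 2%N then herm e z0 else 0).
have yyE s : \sum_(d < N) s%:C ^+ d * yy d = herm e (s%:C *: z0) + low_part N z0 (u r) s%:C.
  under eq_bigr => d _ do rewrite mulrDr.
  rewrite big_split -Hy addrC; congr (_ + _).
  rewrite (bigD1 (Ordinal N3)) //= big1 ?addr0 => [|d d2'].
    by rewrite herm_scale conjc_real expr2.
  by rewrite ifF ?mulr0 //; apply: contraNF d2' => /eqP h; apply/eqP/val_inj.
(* Here [r], and with it u, is fixed and only [s] tends to 0, so the constant [D] depending on u
   does no harm. *)
have qy d : (d < N)%N -> (q d)%:C = yy d.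
  move=> dN; apply/eqP; rewrite -subr_eq0; apply/eqP; move: d dN.
  apply: vanish_coef; exists (B + D); near=> s.
  have s01 : 0 <= s <= 1.
    apply/andP; split; first by near: s; exact: nbhs_right_ge.
    by near: s; apply: nbhs_right_le.
  under eq_bigr => d _ do rewrite mulrBr.
  rewrite sumrB yyE; set X := \sum_(d < N) _; set Y := herm _ _; set W := low_part _ _ _ _.
  rewrite (_ : X - _ = ((Fstar (s%:C *: z0) (u r))%:C - Y - W) - ((Fstar (s%:C *: z0) (u r))%:C - X)); last by ring.
  apply: le_trans (ler_normB _ _) _; rewrite addrC mulrDl rmorphD /=.
  by apply: lerD; [exact: Hq|exact: HD].
(* [z0] is [z] shrunk by the fixed factor [eta] into the region of validity; this value of [s]
   brings [s z0] back to [r z]. *)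
pose s := r / eta.
have s01 : 0 <= s <= 1 by rewrite divr_ge0 ?(ltW r0) ?(ltW eta0) //= ler_pdivrMr // mul1r.
have sz : s%:C *: z0 = r%:C *: z.
  by rewrite scalerA -rmorphM /s divfK // lt0r_neq0.
have := Hq s s01.
have -> : \sum_(d < N) s%:C ^+ d * (q d)%:C = herm e (s%:C *: z0) + low_part N z0 (u r) s%:C.
  by rewrite -yyE; apply: eq_bigr => d _; rewrite qy.
rewrite opprD addrA sz.
have -> : low_part N z0 (u r) s%:C = low_part N z (u r) r%:C.
  apply: eq_bigr => s' _; apply: eq_bigr => t _; case: ifP => // /and3P[s2 t2 _].
  rewrite Hd2 // conjc_real -exprD mulrA -exprMn -rmorphM /s divfK //.
  by rewrite lt0r_neq0.
by rewrite /s exprMn exprVn mulrA mulrAC.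
Unshelve. all: by end_near. Qed.

End NormalForm.

(** * Low weights, polynomial components and perturbation of a normal form *)

Section NormalFormConsequences.
Context {R : realType}.
Local Notation C := R[i].

Definition rcx m (i : 'I_m) (t : 'rV[R]_m) : C := (t 0 i)%:C.

Lemma vanish_rX k (c : C) : vanish k (fun r : R => r%:C ^+ k * c).
Proof. by rewrite -[X in vanish X]addn0; apply: vanishM; [exact: vanish_X|exact: vanish_cst]. Qed.

Lemma vanish_rc n a b (z : R -> 'rV[C]_n) (u : R -> R) :
  (forall k, vanish a (fun r => z r 0 k)) -> vanish b (fun r => (u r)%:C) ->
  forall i, vanish (uwt a b i) (fun r => rcx i (rc (z r) (u r))).
Proof.
move=> hz hu; apply: rc_ind => [k|k|].
- rewrite uwt_re; apply: vanish_ext (vanish_Re (hz k)) => r.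
  by rewrite /rcx rc_re.
- rewrite uwt_im; apply: vanish_ext (vanish_Im (hz k)) => r.
  by rewrite /rcx rc_im.
- rewrite uwt_u; apply: vanish_ext hu => r.
  by rewrite /rcx rc_u.
Qed.

Lemma gpoly_rc_scale n a b k f (s : R) (z : 'rV[C]_n) u :
  gpoly (@rcx (n + n + 1)) (@uwt n a b) k f ->
  f (rc ((s ^+ a)%:C *: z) (s ^+ b * u)) = s%:C ^+ k * f (rc z u).
Proof.
apply: gpoly_scale => i; rewrite -rc_scale /rcx mxE rmorphM.
by rewrite rmorphXn.
Qed.

Definition quadratic n (G : 'rV[C]_n -> R -> R) : Prop :=
  exists B d : R, 0 < d /\ forall rho (z : 'rV[C]_n) u, 0 <= rho <= d ->
    (forall k, `|z 0 k| <= rho%:C) -> `|u| <= rho -> `|G z u| <= B * rho ^+ 2.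

Lemma analytic_jet n (G : 'rV[C]_n -> R -> R) a b : (0 < a)%N -> (0 < b)%N ->
  analytic_at (real_coords G) 0 -> exists F : nat -> 'rV[R]_(n + n + 1) -> C,
    has_jet (@rcx (n + n + 1)) (@uwt n a b) (fun t => (real_coords G t)%:C) F.
Proof.
move=> a0 b0 [c fc]; exists (fun k h => (taylor c (@uwt n a b) k h)%:C).
have om0 i : (0 < @uwt n a b i)%N by rewrite /uwt; case: ifP.
have := series_rep_jetR fc om0.
by rewrite (_ : (fun h => (real_coords G (0 + h))%:C) = fun h => (real_coords G h)%:C) //; apply/funext => h; rewrite add0r.
Qed.

(** Order 2 along each ray kills the components of degree 0 and 1 at every point, and then the
    Taylor bound of order 2 is uniform in the direction. *)
Lemma quadratic_of_rays n (G : 'rV[C]_n -> R -> R) : analytic_at (real_coords G) 0 ->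
  (forall z u, vanish 2 (fun r => (G (r%:C *: z) (r * u))%:C)) -> quadratic G.
Proof.
move=> /(@analytic_jet _ _ 1 1 isT isT)[F hF] H; have [gF [B [r0 [r00 HB]]]] := hF.
have om0 i : (0 < @uwt n 1 1 i)%N by rewrite /uwt; case: ifP.
have F0 k t : (k < 2)%N -> F k t = 0.
  have [z [u ->]] := rcP t; move: k.
  apply: (@vanish_coef _ 2 (fun k => F k (rc z u))).
  have hc i : vanish (@uwt n 1 1 i) (fun r => rcx i (rc (r%:C *: z) (r * u))).
    apply: vanish_rc => [k|].
      by apply: vanish_ext (vanish_rX 1 (z 0 k)) => r; rewrite mxE.
    by apply: vanish_ext (vanish_rX 1 u%:C) => r; rewrite expr1 -rmorphM.
  have := vanishB (H z u) (jet_vanish 2 om0 hF hc); apply: vanish_ext => r.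
  rewrite real_coords_rc opprB addrC subrK; apply: eq_bigr => k _.
  by rewrite -(gpoly_rc_scale _ _ _ (gF k)) !expr1.
exists (B / r0 ^+ 2), r0; split => // rho z u hrho hz hu.
have := HB 2 rho (rc z u) hrho; rewrite big1 => [|k _]; last by rewrite F0.
rewrite subr0 real_coords_rc normC_real lecR exprMn exprVn mulrA mulrAC; apply => i.
have -> : uwt 1 1 i = 1%N by rewrite /uwt if_same.
by rewrite expr1 /rcx normC_real lecR; apply: rc_bound.
Qed.

Lemma quadratic_vanish n (G : 'rV[C]_n -> R -> R) j (z : R -> 'rV[C]_n) (u : R -> R) :
  quadratic G -> (0 < j)%N -> (forall k, vanish j (fun r => z r 0 k)) ->
  vanish j (fun r => (u r)%:C) -> vanish (j + j) (fun r => (G (z r) (u r))%:C).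
Proof.
move=> [B [d [d0 HB]]] j0 /(_ _)/vanish_ge0 hz /vanish_ge0[D [D0 HD]].
have [E HE] := choice hz.
pose A := 1 + D + \sum_k E k.
have E0 k : 0 <= E k by have [] := HE k.
have A0 : 0 < A by rewrite ltr_wpDr ?sumr_ge0 // ltr_wpDr.
have DA : D <= A by rewrite /A addrAC lerDr addr_ge0 // sumr_ge0.
have EA k : E k <= A.
  rewrite /A (bigD1 k) //= addrCA lerDl addr_ge0 ?sumr_ge0 //.
  by rewrite addr_ge0.
have hzz : \forall r \near 0^'+, forall k, `|z r 0 k| <= (A * r ^+ j)%:C.
  apply: filter_forall => k; near=> r.
  have r0 : 0 < r by near: r; exact: nbhs_right_gt.
  apply: (@le_trans _ _ (E k * r ^+ j)%:C); first by near: r; have [] := HE k.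
  by rewrite lecR ler_wpM2r ?exprn_ge0 // ltW.
exists (B * A ^+ 2); near=> r.
have r0 : 0 < r by near: r; exact: nbhs_right_gt.
have r1 : r <= 1 by near: r; apply: nbhs_right_le.
have rd : A * r <= d.
  by rewrite mulrC -ler_pdivlMr //; near: r; apply: nbhs_right_le; rewrite divr_gt0.
rewrite normC_real lecR addnn -muln2 exprM -mulrA -exprMn.
apply: HB.
- rewrite mulr_ge0 ?exprn_ge0 ?(ltW r0) ?(ltW A0) //=.
  apply: le_trans rd; rewrite ler_pM2l // -[leRHS]expr1.
  by apply: ler_wiXn2l => //; exact: ltW.
- by near: r.
rewrite -lecR -normC_real; apply: (@le_trans _ _ (D * r ^+ j)%:C); first by near: r.
by rewrite lecR ler_wpM2r ?exprn_ge0 // ltW.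
Unshelve. all: by end_near. Qed.

Variables (n e : nat) (Fstar : 'rV[C]_n -> R -> R)
  (Fst : nat -> nat -> 'rV[C]_n -> 'rV[C]_n -> C -> C).
Hypothesis Fstar_an : real_analytic_near0 Fstar.
Hypothesis Fstar_sum : \forall z \near (0 : 'rV[C]_n) & u \near (0 : R),
  has_double_sum_ge2 (fun s t => on_diagonal (Fst s t) z u) ((Fstar z u)%:C - herm e z).
Hypothesis Fst_an : \forall q \near (0 : 'rV[C]_(n + n + 1)), forall s t : nat,
  (2 <= s)%N -> (2 <= t)%N -> analytic_at (uncurry3 (Fst s t)) q.
Hypothesis Fst_type : \forall u \near (0 : C), forall s t : nat,
  (2 <= s)%N -> (2 <= t)%N -> forall (mu nu : C) (z zeta : 'rV[C]_n),
    Fst s t (mu *: z) (nu *: zeta) u = mu ^+ s * nu ^+ t * Fst s t z zeta u.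

Lemma low_part_small N z u r : (N <= 4)%N -> low_part Fst N z u r = 0.
Proof.
move=> N4; rewrite /low_part big1 // => s _; rewrite big1 // => t _.
by rewrite ifF // /low_types; apply/negP => /and3P[]; lia.
Qed.

Lemma nf_remainder4 z (u : R -> R) : vanish 1 (fun r => (u r)%:C) ->
  vanish 4 (fun r => (Fstar (r%:C *: z) (u r))%:C - herm e (r%:C *: z)).
Proof.
move=> hu; apply: vanish_ext (nf_expansion Fstar_an Fstar_sum Fst_type (N := 4) z isT hu) => r.
by rewrite low_part_small // subr0.
Qed.

Lemma nf_quadratic : quadratic Fstar.
Proof.
apply: quadratic_of_rays; first exact: nbhs_singleton Fstar_an.
move=> z u; have hu : vanish 1 (fun r : R => (r * u)%:C).
  by apply: vanish_ext (vanish_rX 1 u%:C) => r; rewrite expr1 -rmorphM.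
have h1 := vanish_le (isT : (2 <= 4)%N) (nf_remainder4 z hu).
apply: vanish_ext (vanishD h1 (vanish_rX 2 (herm e z))) => r.
by rewrite herm_scale conjc_real -expr2 subrK.
Qed.

(** For frozen u the type condition makes F_st homogeneous of degree s + t along real rays. Being
    analytic at (0, 0, u), it equals the part of that degree of its power series, a polynomial;
    restricting to zeta = conj z gives one in z and conj z. *)
Lemma nf_lpoly : exists2 d : R, 0 < d & forall u : R, `|u| < d -> forall s t,
  (2 <= s)%N -> (2 <= t)%N -> lpoly (s + t) (fun z => on_diagonal (Fst s t) z u).
Proof.
have [d1 d10 H1] := near0_realC Fst_an; have [d2 d20 H2] := Fst_scale Fst_type.
exists (Num.min d1 d2); first by rewrite lt_min d10.
move=> u; rewrite lt_min => /andP[ud1 ud2] s t s2 t2.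
pose q0 : 'rV[C]_(n + n + 1) := pt 0 u%:C.
have [|c fc] := H1 q0 _ s t s2 t2.
  apply: ordlr => [k|]; first by rewrite pt_l mxE normr0 ltcR.
  by rewrite pt_r normC_real ltcR.
pose th (z : 'rV[C]_n) : 'rV[C]_(n + n + 1) := row_mx (row_mx z (map_mx conjc z)) 0.
have om1 (i : 'I_(n + n + 1)) : (0 < (fun=> 1%N) i)%N by [].
have hj := series_rep_jetC fc om1; have [gT _] := hj.
suff E z : on_diagonal (Fst s t) z u = taylor c (fun=> 1%N) (s + t) (th z).
  apply: (lpoly_ext (fun z => esym (E z))).
  apply: gpoly_lpoly (gT _); apply: rc_ind => [k|k|].
  - by apply: lpoly_ext (lpoly_z k) => z; rewrite /th row_mxEl row_mxEl.
  - by apply: lpoly_ext (lpoly_zbar k) => z; rewrite /th row_mxEl row_mxEr mxE.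
  - apply: (lpolyW (leq0n 1)); apply: lpoly_ext (lpoly_cst _ 0) => z.
    by rewrite /th row_mxEr mxE.
have fE (r : R) : uncurry3 (Fst s t) (q0 + r%:C *: th z) =
    r%:C ^+ (s + t) * on_diagonal (Fst s t) z u.
  have -> : r%:C ^+ (s + t) * on_diagonal (Fst s t) z u = on_diagonal (Fst s t) (r%:C *: z) u.
    by rewrite H2 // conjc_real -exprD.
  rewrite /uncurry3 /on_diagonal; congr (Fst s t _ _ _).
  - apply/rowP => k; rewrite mxE mxE mxE pt_l mxE add0r mxE /th row_mxEl row_mxEl.
    by rewrite mxE.
  - apply/rowP => k; rewrite mxE mxE mxE pt_l mxE add0r mxE /th row_mxEl row_mxEr.
    by rewrite !mxE conjcM conjc_real.
  - by rewrite mxE mxE pt_r mxE /th row_mxEr mxE mulr0 addr0.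
have hc i : vanish 1 (fun r => (r%:C *: th z) 0 i).
  by apply: vanish_ext (vanish_rX 1 (th z 0 i)) => r; rewrite [RHS]mxE expr1.
pose a k := taylor c (fun=> 1%N) k (th z) -
  (if k == (s + t)%N then on_diagonal (Fst s t) z u else 0).
have : a (s + t)%N = 0.
  apply: (@vanish_coef _ (s + t).+1 a) => //.
  apply: vanish_ext (vanishN (jet_vanish (s + t).+1 om1 hj hc)) => r.
  rewrite fE /a; under [RHS]eq_bigr => k _ do rewrite mulrBr.
  rewrite opprB sumrB; congr (_ - _).
    by apply: eq_bigr => k _; rewrite taylor_scale1.
  rewrite (bigD1 ord_max) //= eqxx big1 ?addr0 // => k /eqP kst.
  rewrite ifF ?mulr0 //; apply/eqP => h; apply: kst; exact/val_inj.
by rewrite /a eqxx => /eqP; rewrite subr_eq0 => /eqP.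
Qed.

(** In the weighting (1, 2) the only component of weight below 4 is <z, z>. The remaining ones have
    weight at least 4 and gain [d] from the perturbation, so their change is negligible and the
    equation linearizes to that of the hyperquadric. *)
Lemma nf_perturb d (z : 'rV[C]_n) (z2 : R -> 'rV[C]_n) (u2 : R -> R) :
  (forall k, vanish (1 + d) (fun r => z2 r 0 k - (r%:C *: z) 0 k)) ->
  vanish (2 + d) (fun r => (u2 r - r ^+ 2)%:C) ->
  vanish (4 + d) (fun r => (Fstar (z2 r) (u2 r))%:C - (Fstar (r%:C *: z) (r ^+ 2))%:C -
    (herm e (z2 r) - herm e (r%:C *: z))).
Proof.
move=> hz hu.
have [F hF] := @analytic_jet _ _ 1 2 isT isT (nbhs_singleton Fstar_an).
have [gF _] := hF.
have om0 i : (0 < @uwt n 1 2 i)%N by rewrite /uwt; case: ifP.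
have curve w (v : R) i : vanish (@uwt n 1 2 i) (fun r => rcx i (rc (r%:C *: w) (r ^+ 2 * v))).
  apply: vanish_rc => [k|].
    by apply: vanish_ext (vanish_rX 1 (w 0 k)) => r; rewrite [RHS]mxE.
  by apply: vanish_ext (vanish_rX 2 v%:C) => r; rewrite -rmorphXn -rmorphM.
have Flow k w v : (k < 4)%N -> F k (rc w v) = if k == 2%N then herm e w else 0.
  move=> k4; apply/eqP; rewrite -subr_eq0; apply/eqP; move: k k4.
  apply: (@vanish_coef _ 4 (fun k => F k (rc w v) - (if k == 2%N then herm e w else 0))).
  have hv : vanish 1 (fun r : R => (r ^+ 2 * v)%:C).
    apply: (vanish_le (isT : (1 <= 2)%N)).
    by apply: vanish_ext (vanish_rX 2 v%:C) => r; rewrite -rmorphXn -rmorphM.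
  have := vanishB (nf_remainder4 w hv) (jet_vanish 4 om0 hF (curve w v)).
  apply: vanish_ext => r; rewrite real_coords_rc.
  under [RHS]eq_bigr => k _ do rewrite mulrBr.
  rewrite sumrB; have -> : \sum_(k < 4) r%:C ^+ k * F k (rc w v) =
      \sum_(k < 4) F k (rc (r%:C *: w) (r ^+ 2 * v)).
    by apply: eq_bigr => k _; rewrite -(gpoly_rc_scale _ _ _ (gF k)).
  rewrite !big_ord_recl !big_ord0 /= herm_scale conjc_real; ring.
pose t1 (r : R) := rc (r%:C *: z) (r ^+ 2); pose t2 (r : R) := rc (z2 r) (u2 r).
have c1 i : vanish (@uwt n 1 2 i) (fun r => rcx i (t1 r)).
  by apply: vanish_ext (curve z 1 i) => r; rewrite mulr1.
have c12 i : vanish (@uwt n 1 2 i + d) (fun r => rcx i (t2 r) - rcx i (t1 r)).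
  move: i; apply: rc_ind => [k|k|].
  - rewrite uwt_re; apply: vanish_ext (vanish_Re (hz k)) => r.
    by rewrite /rcx !rc_re raddfB rmorphB.
  - rewrite uwt_im; apply: vanish_ext (vanish_Im (hz k)) => r.
    by rewrite /rcx !rc_im raddfB rmorphB.
  - rewrite uwt_u; apply: vanish_ext hu => r.
    by rewrite /rcx !rc_u rmorphB.
have c2 i : vanish (@uwt n 1 2 i) (fun r => rcx i (t2 r)).
  apply: vanish_ext (vanishD (vanish_le (leq_addr d _) (c12 i)) (c1 i)) => r.
  by rewrite subrK.
have j1 := jet_vanish (4 + d) om0 hF c1; have j2 := jet_vanish (4 + d) om0 hF c2.
have js : vanish (4 + d) (fun r => \sum_(k < 4 + d) (F k (t2 r) - F k (t1 r) -
    (if k == 2 :> nat then herm e (z2 r) - herm e (r%:C *: z) else 0))).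
  apply: vanish_sum => k _; case: (ltnP k 4) => k4.
    apply: vanish_ext (vanish0 _) => r; rewrite !Flow //.
    by case: ifP => _; rewrite ?subrr ?subr0 // subrr.
  apply: (vanish_le (leq_add k4 (leqnn d))).
  apply: vanish_ext (gpoly_perturb c1 c12 (gF k)) => r.
  by rewrite ifF ?subr0 //; apply/eqP => h; move: k4; rewrite h.
apply: vanish_ext (vanishD (vanishB j2 j1) js) => r.
rewrite !real_coords_rc sumrB sumrB [X in _ + (_ - _ - X)](_ : _ = herm e (z2 r) - herm e (r%:C *: z)).
  by ring.
have k2 : (2 < 4 + d)%N by [].
rewrite (bigD1 (Ordinal k2)) //= big1 ?addr0 // => k /eqP kne.
by rewrite ifF //; apply/eqP => h; apply: kne; apply/val_inj.
Qed.

End NormalFormConsequences.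

(** * Maps between real hypersurfaces *)

Section Curves.
Context {R : realType}.
Local Notation C := R[i].

Lemma Im_sub (x y : C) : complex.Im (x - y) = complex.Im x - complex.Im y.
Proof. by case: x => a b; case: y. Qed.

Lemma Re_add (x y : C) : complex.Re (x + y) = complex.Re x + complex.Re y.
Proof. by case: x => a b; case: y. Qed.

Lemma Im_add (x y : C) : complex.Im (x + y) = complex.Im x + complex.Im y.
Proof. by case: x => a b; case: y. Qed.

Definition small_curve m (h : R -> 'rV[C]_m) : Prop := forall i, vanish 1 (fun r => h r 0 i).

Lemma near_curve m (Q : 'rV[C]_m -> Prop) (h : R -> 'rV[C]_m) :
  (\forall p \near (0 : 'rV[C]_m), Q p) -> small_curve h -> \forall r \near 0^'+, Q (h r).
Proof.
move=> /near0_realC[d d0 H] hh.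
have : \forall r \near 0^'+, forall i, `|h r 0 i| < d%:C.
  by apply: filter_forall => i; exact: vanish_lt1.
by apply: filterS => r; exact: H.
Qed.

Definition wcurve n (h : R -> 'rV[C]_(n + 1)) : Prop :=
  forall i, vanish (wom i) (fun r => h r 0 i).

Lemma wcurve_small n (h : R -> 'rV[C]_(n + 1)) : wcurve h -> small_curve h.
Proof. by move=> H i; exact: vanish_le (wom_gt0 i) (H i). Qed.

Lemma wcurve_pt n (z : R -> 'rV[C]_n) (w : R -> C) :
  (forall k, vanish 1 (fun r => z r 0 k)) -> vanish 2 w -> wcurve (fun r => pt (z r) (w r)).
Proof.
move=> hz hw; apply: ordlr => [k|].
  by rewrite wom_l; apply: vanish_ext (hz k) => r; rewrite pt_l.
by rewrite wom_r; apply: vanish_ext hw => r; rewrite pt_r.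
Qed.

Lemma jet_at0 T m (x : 'I_m -> T -> C) om f F t0 : (forall i, 0 < om i)%N ->
  has_jet x om f F -> (forall i, x i t0 = 0) -> forall t, F 0%N t = f t0.
Proof.
move=> om0 [gF [B [r0 [r00 H]]]] x0 t; have [c Hc] := gpoly_deg0 om0 (gF 0%N).
have := H 1%N 0 t0; rewrite lexx (ltW r00) => /(_ isT) h.
have {}h := h (fun i => _); rewrite big_ord1 in h.
apply/eqP; rewrite eq_sym -subr_eq0 Hc -(Hc t0) -normr_le0.
apply: le_trans (h _) _ => [i|]; last by rewrite mul0r expr1 mulr0.
by rewrite x0 normr0 ler0c exprn_ge0.
Qed.

Lemma scale_pt n (r : C) (z : 'rV[C]_n) w i : pt (r *: z) (r ^+ 2 * w) 0 i = r ^+ wom i * pt z w 0 i.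
Proof.
by move: i; apply: ordlr => [k|]; rewrite ?wom_l ?wom_r ?pt_l ?pt_r ?mxE ?expr1.
Qed.

Lemma wgpoly_scale n k (f : 'rV[C]_(n + 1) -> C) (r : C) z w :
  gpoly (@xc R (n + 1)) (@wom n) k f -> f (pt (r *: z) (r ^+ 2 * w)) = r ^+ k * f (pt z w).
Proof. by apply: gpoly_scale => i; rewrite /xc scale_pt. Qed.

Lemma ptE n (x : 'rV[C]_(n + 1)) : x = pt (zcoord x) (wcoord x).
Proof.
apply/rowP; apply: ordlr => [k|]; first by rewrite pt_l mxE.
by rewrite pt_r /wcoord mxE.
Qed.

Lemma zcoord_pt n (z : 'rV[C]_n) w : zcoord (pt z w) = z.
Proof. by apply/rowP => k; rewrite mxE pt_l. Qed.

Lemma wcoord_pt n (z : 'rV[C]_n) w : wcoord (pt z w) = w.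
Proof. by rewrite /wcoord mxE pt_r. Qed.

Lemma zcoordE n (p : 'rV[C]_(n + 1)) k : zcoord p 0 k = p 0 (lshift 1 k).
Proof. by rewrite mxE. Qed.

Lemma wcoordE n (p : 'rV[C]_(n + 1)) : wcoord p = p 0 (rshift n ord0).
Proof. by rewrite /wcoord mxE. Qed.

Definition on_graph n (G : 'rV[C]_n -> R -> R) (p : 'rV[C]_(n + 1)) : Prop :=
  complex.Im (wcoord p) = G (zcoord p) (complex.Re (wcoord p)).

(** Mapping one hypersurface into another is recorded only on curves tending to 0, the sole place
    where it is tested; it composes without tracking neighbourhoods. *)
Definition carries n (G G' : 'rV[C]_n -> R -> R) (phi : 'rV[C]_(n + 1) -> 'rV[C]_(n + 1)) :=
  forall h, small_curve h -> (\forall r \near 0^'+, on_graph G (h r)) ->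
    \forall r \near 0^'+, on_graph G' (phi (h r)).

(* [S i k] is the weighted homogeneous component of degree [k] of the [i]-th
   coordinate of [psi] at the origin. *)
Definition map_jet n (psi : 'rV[C]_(n + 1) -> 'rV[C]_(n + 1))
    (S : 'I_(n + 1) -> nat -> 'rV[C]_(n + 1) -> C) : Prop :=
  forall i, has_jet (@xc R (n + 1)) (@wom n) (fun p => psi p 0 i) (S i).

Lemma map_jet_exists n (psi : 'rV[C]_(n + 1) -> 'rV[C]_(n + 1)) :
  (forall i, analytic_at (fun p => psi p 0 i) 0) -> exists S, map_jet psi S.
Proof.
move=> H; have /choice[c Hc] i : exists c, series_rep (fun p => psi p 0 i) 0 c by exact: H.
exists (fun i => taylor (c i) (@wom n)) => i.
have := series_rep_jetC (Hc i) (@wom_gt0 n).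
by rewrite (_ : (fun h => psi (0 + h) 0 i) = fun h => psi h 0 i) //; apply/funext => h; rewrite add0r.
Qed.

Lemma map_jet0 n (psi : 'rV[C]_(n + 1) -> 'rV[C]_(n + 1)) S i t :
  map_jet psi S -> psi 0 = 0 -> S i 0%N t = 0.
Proof.
move=> hS p0; rewrite (jet_at0 (t0 := 0) (@wom_gt0 n) (hS i)) => [|j].
  by rewrite p0 mxE.
by rewrite /xc mxE.
Qed.

Lemma map_small n (psi : 'rV[C]_(n + 1) -> 'rV[C]_(n + 1)) h :
  (forall i, analytic_at (fun p => psi p 0 i) 0) -> psi 0 = 0 ->
  small_curve h -> small_curve (fun r => psi (h r)).
Proof.
move=> H p0 hh i.
have [c Hc] : exists c, series_rep (fun p => psi p 0 i) 0 c by exact: H.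
have om1 (j : 'I_(n + 1)) : (0 < (fun=> 1%N) j)%N by [].
have hj := series_rep_jetC Hc om1.
apply: vanish_ext (jet_vanish 1 om1 hj hh) => r.
rewrite big_ord1 (jet_at0 (t0 := 0) om1 hj) => [|j]; last by rewrite mxE.
by rewrite !add0r p0 mxE subr0.
Qed.

Section Tangent.
Variables (n : nat) (G G' : 'rV[C]_n -> R -> R) (psi : 'rV[C]_(n + 1) -> 'rV[C]_(n + 1)).
Variable S : 'I_(n + 1) -> nat -> 'rV[C]_(n + 1) -> C.
Hypotheses (qG : quadratic G) (qG' : quadratic G').
Hypothesis psi_an : forall i, analytic_at (fun p => psi p 0 i) 0.
Hypothesis psi0 : psi 0 = 0.
Hypothesis hS : map_jet psi S.
Hypothesis cG : carries G G' psi.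
Let gi : 'I_(n + 1) := rshift n ord0.

Lemma graph_curve (z : R -> 'rV[C]_n) (u : R -> R) r :
  on_graph G (pt (z r) (u r +i* G (z r) (u r))).
Proof. by rewrite /on_graph wcoord_pt zcoord_pt. Qed.

Lemma gpoly1_linear (f : 'rV[C]_(n + 1) -> C) : gpoly (@xc R (n + 1)) (@wom n) 1 f ->
  exists b : 'I_n -> C, forall z w, f (pt z w) = \sum_(k < n) b k * z 0 k.
Proof.
move=> /(gpoly_deg1 (@wom_gt0 n))[b Hb]; exists (fun k => b (lshift 1 k)) => z w.
rewrite Hb big_mkcond big_split_ord /= big_ord1 wom_r addr0.
by apply: eq_bigr => k _; rewrite wom_l /= /xc pt_l.
Qed.

(** Both graphs are tangent to Im w = 0. Along the curve over (r y, 0) the image has Im w = O(r^2),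
    so the imaginary part of a complex linear form vanishes. *)
Lemma tangent_gz p : S gi 1 p = 0.
Proof.
have [b Hb] := gpoly1_linear ((hS gi).1 1%N).
suff H (z : 'rV[C]_n) : \sum_(k < n) b k * z 0 k = 0 by rewrite (ptE p) Hb.
have Im0 (y : 'rV[C]_n) : complex.Im (\sum_(k < n) b k * y 0 k) = 0.
  have hz k : vanish 1 (fun r => (r%:C *: y) 0 k).
    by apply: vanish_ext (vanish_rX 1 (y 0 k)) => r; rewrite [RHS]mxE expr1.
  have h0 j : vanish j (fun r : R => (0 : R)%:C) by exact: vanish0.
  have hG := quadratic_vanish (j := 1) qG isT hz (h0 1%N).
  pose w (r : R) : C := 0 +i* G (r%:C *: y) 0.
  have hw : vanish 2 w.
    apply: vanish_ext (vanishZ 'i%C hG) => r.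
    by rewrite /w; simpc.
  have hc := wcurve_pt hz hw; have hsm := wcurve_small hc.
  have hpsi := map_small psi_an psi0 hsm.
  have hrel := cG hsm (nearW _ (graph_curve (fun r => r%:C *: y) (fun=> 0))).
  have hz' k : vanish 1 (fun r => zcoord (psi (pt (r%:C *: y) (w r))) 0 k).
    by apply: vanish_ext (hpsi (lshift 1 k)) => r; rewrite zcoordE.
  have hw' : vanish 1 (fun r => wcoord (psi (pt (r%:C *: y) (w r)))).
    by apply: vanish_ext (hpsi gi) => r; rewrite wcoordE.
  have h1 := quadratic_vanish (j := 1) qG' isT hz' (vanish_Re hw').
  have h2 : vanish 2 (fun r => (complex.Im (wcoord (psi (pt (r%:C *: y) (w r)))))%:C).
    apply: vanish_near h1; near=> r; congr (_%:C).
    by apply/esym; near: r; exact: hrel.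
  have h3 := vanish_Im (jet_vanish 2 (@wom_gt0 n) (hS gi) hc).
  have h4 : vanish 2 (fun r => r%:C ^+ 1 * (complex.Im (\sum_(k < n) b k * y 0 k))%:C).
    apply: vanish_ext (vanishB h2 h3) => r.
    rewrite !big_ord_recl big_ord0 /= addr0 (map_jet0 _ _ hS psi0) add0r Hb.
    rewrite -rmorphB -rmorphXn -rmorphM; congr (_%:C).
    rewrite wcoordE -Im_sub opprB addrC subrK.
    have -> : \sum_(k < n) b k * (r%:C *: y) 0 k = (\sum_(k < n) b k * y 0 k) * r%:C.
      by rewrite mulr_suml; apply: eq_bigr => k _; rewrite mxE; ring.
    by rewrite Im_mulr mulrC expr1.
  by have := vanish_lead h4; case.
(* Replacing z by i z turns the vanishing imaginary part into the real part. *)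
have Re0 : complex.Re (\sum_(k < n) b k * z 0 k) = 0.
  have := Im0 ('i%C *: z); under eq_bigr => k _ do rewrite mxE mulrCA.
  by rewrite -mulr_sumr mulrC ImiRe.
by move: (Im0 z) Re0; case: (\sum_(k < n) _) => x y /= -> ->.
Unshelve. all: by end_near. Qed.

(** Over (0, r^2) every coordinate of the image is O(r^2), so its Im w is O(r^4), beyond the order
    r^2 at which the coefficient of w would show. *)
Lemma tangent_gw : complex.Im (S gi 2 (pt 0 1)) = 0.
Proof.
have hz j k : vanish j (fun r : R => (0 : 'rV[C]_n) 0 k).
  by apply: vanish_ext (vanish0 _) => r; rewrite mxE.
have hu : vanish 2 (fun r => (r ^+ 2)%:C : C).
  by apply: vanish_ext (vanish_X 2) => r; rewrite rmorphXn.
have hG := quadratic_vanish (j := 2) qG isT (hz 2%N) hu.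
pose w (r : R) : C := r ^+ 2 +i* G 0 (r ^+ 2).
have wE r : w r = (r ^+ 2)%:C + 'i%C * (G 0 (r ^+ 2))%:C by rewrite /w; simpc.
have hw4 : vanish 4 (fun r => w r - r%:C ^+ 2 * 1).
  apply: vanish_ext (vanishZ 'i%C hG) => r.
  by rewrite wE mulr1 rmorphXn addrAC subrr add0r.
have hw : vanish 2 w.
  apply: vanish_ext (vanishD (vanish_le (isT : (2 <= 4)%N) hw4) (vanish_rX 2 1)) => r.
  by rewrite subrK.
have hc := wcurve_pt (hz 1%N) hw; have hsm := wcurve_small hc.
have hpsi := map_small psi_an psi0 hsm.
have hrel := cG hsm (nearW _ (graph_curve (fun=> 0) (fun r => r ^+ 2))).
have S1 i r : S i 1 (pt 0 (w r)) = 0.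
  have [b ->] := gpoly1_linear ((hS i).1 1%N).
  by rewrite big1 // => k _; rewrite mxE mulr0.
have hpsi2 i : vanish 2 (fun r => psi (pt 0 (w r)) 0 i).
  apply: vanish_ext (jet_vanish 2 (@wom_gt0 n) (hS i) hc) => r.
  by rewrite !big_ord_recl big_ord0 /= addr0 (map_jet0 _ _ hS psi0) S1 addr0 subr0.
have hz' k : vanish 2 (fun r => zcoord (psi (pt 0 (w r))) 0 k).
  by apply: vanish_ext (hpsi2 (lshift 1 k)) => r; rewrite zcoordE.
have hw' : vanish 2 (fun r => wcoord (psi (pt 0 (w r)))).
  by apply: vanish_ext (hpsi2 gi) => r; rewrite wcoordE.
have h1 := quadratic_vanish (j := 2) qG' isT hz' (vanish_Re hw').
have h2 : vanish 4 (fun r => (complex.Im (wcoord (psi (pt 0 (w r)))))%:C).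
  apply: vanish_near h1; near=> r; congr (_%:C).
  by apply/esym; near: r; exact: hrel.
have h3 := vanish_Im (jet_vanish 3 (@wom_gt0 n) (hS gi) hc).
have hc0 : wcurve (fun r => pt (0 : 'rV[C]_n) (r%:C ^+ 2 * 1)).
  by apply: wcurve_pt (hz 1%N) _; exact: vanish_rX.
have hd i : vanish (wom i + 1) (fun r => xc i (pt 0 (w r)) - xc i (pt (0 : 'rV[C]_n) (r%:C ^+ 2 * 1))).
  move: i; apply: ordlr => [k|].
    by apply: vanish_ext (vanish0 _) => r; rewrite /xc !pt_l subrr.
  rewrite wom_r; apply: (vanish_le (isT : (2 + 1 <= 4)%N)).
  by apply: vanish_ext hw4 => r; rewrite /xc !pt_r.
have h4 := vanish_Im (gpoly_perturb (hc0 : forall i, vanish _ (fun r => xc i _)) hd ((hS gi).1 2%N)).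
have h5 : vanish 3 (fun r => r%:C ^+ 2 * (complex.Im (S gi 2 (pt 0 1)))%:C).
  apply: vanish_ext (vanishB (vanishB (vanish_le (isT : (3 <= 4)%N) h2) h3) h4) => r.
  rewrite !big_ord_recl big_ord0 /= !addr0 (map_jet0 _ _ hS psi0) S1 !add0r.
  have -> : pt 0 (r%:C ^+ 2 * 1) = pt (r%:C *: 0) (r%:C ^+ 2 * 1) :> 'rV[C]_(n + 1).
    by rewrite scaler0.
  rewrite (wgpoly_scale _ _ _ ((hS gi).1 2%N)) wcoordE.
  transitivity (complex.Im (r%:C ^+ 2 * S gi 2%N (pt 0 1)))%:C.
    by rewrite -!rmorphB -!Im_sub; congr (complex.Im _)%:C; ring.
  by rewrite [X in complex.Im X]mulrC -rmorphXn Im_mulr rmorphM mulrC.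
by have := vanish_lead h5; case.
Unshelve. all: by end_near. Qed.

End Tangent.
End Curves.

(** * Derivatives along rays, in the parameter r^2 for w *)

Section Partials.
Context {R : realType}.
Local Notation C := R[i].

Lemma series_rep_ray m (f : 'rV[C]_m -> C) c (v : 'rV[C]_m) N j : (0 < j)%N ->
  series_rep f 0 c ->
  vanish N (fun r => f (r%:C ^+ j *: v) -
    \sum_(k < N) (r%:C ^+ j) ^+ k * taylor c (fun=> 1%N) k v).
Proof.
move=> j0 fc; have om1 (i : 'I_m) : (0 < (fun=> 1%N) i)%N by [].
have hj := series_rep_jetC fc om1.
have hc i : vanish 1 (fun r => (r%:C ^+ j *: v) 0 i).
  by apply: (vanish_le j0); apply: vanish_ext (vanish_rX j (v 0 i)) => r; rewrite [RHS]mxE.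
apply: vanish_ext (jet_vanish N om1 hj hc) => r; rewrite add0r; congr (_ - _).
by apply: eq_bigr => k _; rewrite taylor_scale1.
Qed.

Lemma series_rep_at0 m (f : 'rV[C]_m -> C) c v : series_rep f 0 c ->
  taylor c (fun=> 1%N) 0 v = f 0.
Proof.
move=> fc; have om1 (i : 'I_m) : (0 < (fun=> 1%N) i)%N by [].
rewrite (jet_at0 (t0 := 0) om1 (series_rep_jetC fc om1)) ?addr0 // => i.
by rewrite mxE.
Qed.

Lemma partial_ray m (f : 'rV[C]_m -> C) i : analytic_at f 0 ->
  vanish 2 (fun r => f (r%:C *: delta_mx 0 i) - f 0 - r%:C * partial i f 0).
Proof.
move=> an; have [c fc] : exists c, series_rep f 0 c by exact: an.
apply: vanish_ext (series_rep_ray (delta_mx 0 i) 2 (isT : 0 < 1)%N fc) => r.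
rewrite !big_ord_recl big_ord0 /= (series_rep_at0 _ fc) (series_rep_partial i fc).
by rewrite !expr1 expr0 mul1r addr0 opprD addrA.
Qed.

Lemma partial_ray_sq m (f : 'rV[C]_m -> C) i : analytic_at f 0 ->
  vanish 4 (fun r => f (r%:C ^+ 2 *: delta_mx 0 i) - f 0 - r%:C ^+ 2 * partial i f 0).
Proof.
move=> an; have [c fc] : exists c, series_rep f 0 c by exact: an.
have h := series_rep_ray (delta_mx 0 i) 4 (isT : 0 < 2)%N fc.
pose t k := taylor c (fun=> 1%N) k (delta_mx 0 i).
have h4 : vanish 4 (fun r => r%:C ^+ 4 * (t 2%N) + r%:C ^+ 6 * t 3%N).
  by apply: vanishD; [|apply: (vanish_le (isT : (4 <= 6)%N))]; exact: vanish_rX.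
apply: vanish_ext (vanishD h h4) => r.
rewrite !big_ord_recl big_ord0 /= (series_rep_at0 _ fc) (series_rep_partial i fc) -/(t 1%N).
by rewrite -!exprM /bump /= /t; ring.
Qed.

Lemma partial2_ray_sq m (f : 'rV[C]_m -> C) i : (\forall q \near (0 : 'rV[C]_m), analytic_at f q) ->
  vanish 6 (fun r => f (r%:C ^+ 2 *: delta_mx 0 i) - f 0 - r%:C ^+ 2 * partial i f 0 -
    r%:C ^+ 4 * (partial i (partial i f) 0 / 2%:R)).
Proof.
move=> an; have [c fc] : exists c, series_rep f 0 c by exact: (nbhs_singleton an).
have h := series_rep_ray (delta_mx 0 i) 6 (isT : 0 < 2)%N fc.
pose t k := taylor c (fun=> 1%N) k (delta_mx 0 i).
have h6 : vanish 6 (fun r => r%:C ^+ 6 * (t 3%N) + r%:C ^+ 8 * t 4%N + r%:C ^+ 10 * t 5%N).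
  apply: vanishD; first apply: vanishD; first exact: vanish_rX.
    by apply: (vanish_le (isT : (6 <= 8)%N)); exact: vanish_rX.
  by apply: (vanish_le (isT : (6 <= 10)%N)); exact: vanish_rX.
apply: vanish_ext (vanishD h h6) => r.
rewrite !big_ord_recl big_ord0 /= (series_rep_at0 _ fc) (series_rep_partial i fc).
rewrite (series_rep_partial2 i an fc) -/(t 1%N) -/(t 2%N).
by rewrite -!exprM /bump /= /t; field.
Qed.

End Partials.

(** * The weighted leading part of a map *)

Section Lead.
Context {R : realType}.
Local Notation C := R[i].
Variable n : nat.
Implicit Types (S T : 'I_(n + 1) -> nat -> 'rV[C]_(n + 1) -> C).
Local Notation gi := (rshift n ord0 : 'I_(n + 1)).
Local Notation wpoly := (gpoly (@xc R (n + 1)) (@wom n)).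

Definition lead S (p : 'rV[C]_(n + 1)) : 'rV[C]_(n + 1) := \row_i S i (wom i) p.

Lemma gpoly_lead psi S i : map_jet psi S -> wpoly (wom i) (fun p => xc i (lead S p)).
Proof.
move=> hS; apply: gpoly_ext ((hS i).1 (wom i)) => p.
by rewrite /xc mxE.
Qed.

Lemma gpoly_comp_lead psi S k f : map_jet psi S -> wpoly k f -> wpoly k (fun p => f (lead S p)).
Proof. by move=> hS; apply: gpoly_subst => i; exact: gpoly_lead hS. Qed.

Lemma lead_wcurve psi S h : map_jet psi S -> wcurve h -> wcurve (fun r => lead S (h r)).
Proof. by move=> hS hh i; exact: (gpoly_vanish hh (gpoly_lead i hS)). Qed.

(** The leading part takes weight 1 in f but weight 2 in g; this is the lowest order of g only
    because its weight 1 part vanishes. *)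
Lemma map_lead psi S h : map_jet psi S -> psi 0 = 0 -> (forall p, S gi 1 p = 0) -> wcurve h ->
  forall i, vanish (wom i + 1) (fun r => psi (h r) 0 i - lead S (h r) 0 i).
Proof.
move=> hS p0 S1 hh i.
apply: vanish_ext (jet_vanish (wom i + 1) (@wom_gt0 n) (hS i) hh) => r.
rewrite (addn1 (wom i)) big_ord_recr /= big1 ?add0r ?mxE // => k _.
case: k => -[|[|k]] /= hk.
- exact: (map_jet0 _ _ hS p0).
- move: hk; move: i; apply: ordlr => [k|]; first by rewrite wom_l.
  by move=> _; exact: S1.
- by move: hk; rewrite /wom; case: ifP.
Qed.

Lemma wcurve_near (h h' : R -> 'rV[C]_(n + 1)) d : wcurve h ->
  (forall i, vanish (wom i + d) (fun r => h' r 0 i - h r 0 i)) -> wcurve h'.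
Proof.
move=> hh hd i; apply: vanish_ext (vanishD (vanish_le (leq_addr d _) (hd i)) (hh i)) => r.
by rewrite subrK.
Qed.

Lemma lead_inverse phi psi S T : map_jet psi S -> map_jet phi T ->
  psi 0 = 0 -> phi 0 = 0 -> (forall p, S gi 1 p = 0) -> (forall p, T gi 1 p = 0) ->
  (\forall p \near (0 : 'rV[C]_(n + 1)), psi (phi p) = p) ->
  forall y, lead S (lead T y) = y.
Proof.
move=> hS hT psi0 phi0 S1 T1 inv y.
pose h (r : R) := pt (r%:C *: zcoord y) (r%:C ^+ 2 * wcoord y).
have hE r i : h r 0 i = r%:C ^+ wom i * y 0 i by rewrite /h scale_pt -ptE.
have hh : wcurve h by move=> i; apply: vanish_ext (vanish_rX _ (y 0 i)) => r; rewrite hE.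
have hT1 := map_lead hT phi0 T1 hh.
have hlT := lead_wcurve hT hh.
have hphi := wcurve_near hlT hT1.
have hS1 := map_lead hS psi0 S1 hphi.
apply/rowP => i; apply/eqP; rewrite -subr_eq0; apply/eqP.
apply: (@vanish_lead _ (wom i)); rewrite -[X in vanish X]addn1.
have h2 := gpoly_perturb hlT hT1 (gpoly_lead i hS).
have h3 := vanishD (hS1 i) h2.
have h4 : vanish (wom i + 1) (fun r => h r 0 i - lead S (lead T (h r)) 0 i).
  apply: vanish_near h3; have := near_curve inv (wcurve_small hh); apply: filterS => r E.
  by rewrite E /xc subrKA.
apply: vanish_ext (vanishN h4) => r; rewrite opprB hE mulrBr; congr (_ - _).
have := gpoly_comp_lead hT (gpoly_lead i hS).
by move/(wgpoly_scale r%:C (zcoord y) (wcoord y)); rewrite /xc -ptE => <-.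
Qed.

End Lead.

(** * The induction on the weight *)

Section NormalFormData.
Context {R : realType}.
Local Notation C := R[i].

Definition normal_form_data n e (Fstar : 'rV[C]_n -> R -> R)
    (Fst : nat -> nat -> 'rV[C]_n -> 'rV[C]_n -> C -> C) : Prop :=
  [/\ real_analytic_near0 Fstar,
      (\forall z \near (0 : 'rV[C]_n) & u \near (0 : R),
         has_double_sum_ge2 (fun s t => on_diagonal (Fst s t) z u) ((Fstar z u)%:C - herm e z)),
      (\forall q \near (0 : 'rV[C]_(n + n + 1)), forall s t : nat,
         (2 <= s)%N -> (2 <= t)%N -> analytic_at (uncurry3 (Fst s t)) q),
      (\forall u \near (0 : C), forall s t : nat,
         (2 <= s)%N -> (2 <= t)%N -> forall (mu nu : C) (z zeta : 'rV[C]_n),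
           Fst s t (mu *: z) (nu *: zeta) u = mu ^+ s * nu ^+ t * Fst s t z zeta u) &
      (\forall z \near (0 : 'rV[C]_n) & u \near (0 : R),
         [/\ Lap e (on_diagonal (Fst 2%N 2%N)) z u = 0,
             iter 2%N (Lap e) (on_diagonal (Fst 2%N 3%N)) z u = 0 &
             iter 3%N (Lap e) (on_diagonal (Fst 3%N 3%N)) z u = 0])].

Lemma nf_lap n e Fstar Fst : @normal_form_data n e Fstar Fst ->
  exists2 d : R, 0 < d & forall (z : 'rV[C]_n) u, (forall i, `|z 0 i| < d%:C) -> `|u| < d ->
    [/\ Lapz e (fun z => on_diagonal (Fst 2 2) z u) z = 0,
        iter 2 (Lapz e) (fun z => on_diagonal (Fst 2 3) z u) z = 0 &
        iter 3 (Lapz e) (fun z => on_diagonal (Fst 3 3) z u) z = 0].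
Proof.
move=> [_ _ _ _ /near0_zu[d d0 H]]; exists d => // z u hz hu.
have [h1 h2 h3] := H z u hz hu; split.
- exact: etrans (esym (iter_LapE e 1 (on_diagonal (Fst 2%N 2%N)) z u)) h1.
- exact: etrans (esym (iter_LapE e 2 (on_diagonal (Fst 2%N 3%N)) z u)) h2.
- exact: etrans (esym (iter_LapE e 3 (on_diagonal (Fst 3%N 3%N)) z u)) h3.
Qed.

Lemma low_part_widen n (Fst : nat -> nat -> 'rV[C]_n -> 'rV[C]_n -> C -> C) M N z u r :
  (M <= N)%N -> low_part Fst M z u r = \sum_(s < N) \sum_(t < N)
    (if low_types M s t then r ^+ (s + t) * on_diagonal (Fst s t) z u else 0).
Proof.
move=> MN; rewrite /low_part.
rewrite (big_ord_widen N (fun s => \sum_(t < M)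
  (if low_types M s t then r ^+ (s + t) * on_diagonal (Fst s t) z u else 0)) MN).
rewrite big_mkcond; apply: eq_bigr => s _; case: ltnP => sM; last first.
  rewrite big1 // => t _; rewrite ifF // /low_types.
  by apply/negP => /and3P[_ _]; lia.
rewrite (big_ord_widen N (fun t =>
  (if low_types M s t then r ^+ (s + t) * on_diagonal (Fst s t) z u else 0)) MN).
rewrite big_mkcond; apply: eq_bigr => t _; case: ltnP => tM //.
by rewrite ifF // /low_types; apply/negP => /and3P[_ _]; lia.
Qed.

(* A combination of translates passes to the leading coefficient in [r]. *)
Lemma comb_lead n (Op : ('rV[C]_n -> C) -> 'rV[C]_n -> C) d N (P : 'rV[C]_n -> C)
    (G1 G2 : R -> 'rV[C]_n -> C) z :
  comb d Op -> lpoly d P ->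
  (\forall r \near 0^'+, lpoly d (G1 r) /\ lpoly d (G2 r)) ->
  (forall z, vanish N.+1 (fun r => r%:C ^+ N * P z - r%:C ^+ d * (G2 r z - G1 r z))) ->
  (\forall r \near 0^'+, Op (G1 r) z = 0 /\ Op (G2 r) z = 0) -> Op P z = 0.
Proof.
move=> [s hs] lP lG H H0; apply: (@vanish_lead _ N).
have h1 : vanish N.+1 (fun r => \sum_(cv <- s) cv.1 *
    (r%:C ^+ N * P (z + cv.2) - r%:C ^+ d * (G2 r (z + cv.2) - G1 r (z + cv.2)))).
  by apply: vanish_sum => cv _; apply: vanishZ.
apply: vanish_near h1; near=> r.
have [l1 l2] : lpoly d (G1 r) /\ lpoly d (G2 r) by near: r; exact: lG.
have [z1 z2] : Op (G1 r) z = 0 /\ Op (G2 r) z = 0 by near: r; exact: H0.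
have E : \sum_(cv <- s) cv.1 * (r%:C ^+ N * P (z + cv.2) - r%:C ^+ d * (G2 r (z + cv.2) - G1 r (z + cv.2)))
   = r%:C ^+ N * Op P z - r%:C ^+ d * (Op (G2 r) z - Op (G1 r) z).
  rewrite !hs // !mulr_sumr -sumrB mulr_sumr -sumrB; apply: eq_bigr => cv _; ring.
by rewrite E z1 z2 subr0 mulr0 subr0.
Unshelve. all: by end_near. Qed.

End NormalFormData.

(** * The lowest-order relation between two normalizations *)

Section MainStep.
Context {R : realType}.
Local Notation C := R[i].
Variables (n e : nat) (F F1 F2 : 'rV[C]_n -> R -> R).
Variables (Fst1 Fst2 : nat -> nat -> 'rV[C]_n -> 'rV[C]_n -> C -> C).
Variables (phi1 phi2 psi1 : 'rV[C]_(n + 1) -> 'rV[C]_(n + 1)).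
Variables (T1 T2 S : 'I_(n + 1) -> nat -> 'rV[C]_(n + 1) -> C).
Local Notation gi := (rshift n ord0 : 'I_(n + 1)).
Local Notation wpoly := (gpoly (@xc R (n + 1)) (@wom n)).
Hypothesis nf1 : normal_form_data e F1 Fst1.
Hypothesis nf2 : normal_form_data e F2 Fst2.
Hypothesis hT1 : map_jet phi1 T1.
Hypothesis hT2 : map_jet phi2 T2.
Hypothesis hS : map_jet psi1 S.
Hypothesis psi0 : psi1 0 = 0.
Hypothesis S1 : forall p, S gi 1 p = 0.
Hypothesis c1 : carries F1 F psi1.
Hypothesis c2 : carries F F2 phi2.
Hypothesis inv1 : \forall q \near (0 : 'rV[C]_(n + 1)), phi1 (psi1 q) = q.

Definition TD i k p := T2 i k p - T1 i k p.
Definition Dl (p : 'rV[C]_(n + 1)) i : C := phi2 p 0 i - phi1 p 0 i.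

Lemma TD_jet i : has_jet (@xc R (n + 1)) (@wom n) (fun p => Dl p i) (TD i).
Proof. exact: has_jetB (hT2 i) (hT1 i). Qed.

Variable d : nat.
Hypothesis low : forall i k p, (k < wom i + d)%N -> TD i k p = 0.
Hypothesis init0 : d = 0%N -> forall (k : 'I_n) p, TD (lshift 1 k) 1 p = 0.

Let f (k : 'I_n) (p : 'rV[C]_(n + 1)) := TD (lshift 1 k) d.+1 (lead S p).
Let g (p : 'rV[C]_(n + 1)) := TD gi d.+2 (lead S p).

(** Subtract the equation of phi1(M) at a point from that of phi2(M) at its image under phi2 o
    phi1^-1: the difference of f and g enters linearly through the operator, and everything else of
    weight at most d + 2 is the difference of the two series of types. *)
Lemma main_expansion z : vanish d.+3 (fun r =>
  r%:C ^+ d.+2 * cm_op e f g z -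
  (low_part Fst2 d.+3 z (r ^+ 2) r%:C - low_part Fst1 d.+3 z (r ^+ 2) r%:C)).
Proof.
have [an1 sum1 fan1 ty1 _] := nf1; have [an2 sum2 fan2 ty2 _] := nf2.
have hu : vanish 1 (fun r => (r ^+ 2)%:C : C).
  by apply: (vanish_le (isT : (1 <= 2)%N)); apply: vanish_ext (vanish_X 2) => r; rewrite rmorphXn.
(* [q0] runs over weighted dilates of a hyperquadric point and [q] over points of phi1(M) above the
   same (r z, r^2); they differ in w only, by O(r^4). *)
pose w0 : C := 1 + 'i%C * herm e z.
pose q0 (r : R) := pt (r%:C *: z) (r%:C ^+ 2 * w0).
pose q (r : R) := pt (r%:C *: z) (r ^+ 2 +i* F1 (r%:C *: z) (r ^+ 2)).
have hq0 : wcurve q0.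
  by move=> i; apply: vanish_ext (vanish_rX _ (pt z w0 0 i)) => r; rewrite /q0 scale_pt.
have hqd i : vanish (wom i + 2) (fun r => q r 0 i - q0 r 0 i).
  move: i; apply: ordlr => [k|].
    by apply: vanish_ext (vanish0 _) => r; rewrite /q /q0 !pt_l subrr.
  rewrite wom_r; apply: vanish_ext (vanishZ 'i%C (nf_remainder4 an1 sum1 ty1 z hu)) => r.
  rewrite /q /q0 !pt_r herm_scale conjc_real /w0.
  have -> : r ^+ 2 +i* F1 (r%:C *: z) (r ^+ 2) = r%:C ^+ 2 + 'i%C * (F1 (r%:C *: z) (r ^+ 2))%:C.
    by rewrite -rmorphXn; simpc.
  by ring.
have hq := wcurve_near hq0 hqd.
have hlq0 := lead_wcurve hS hq0.
have hpsi i : vanish (wom i + 1) (fun r => psi1 (q r) 0 i - lead S (q0 r) 0 i).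
  apply: vanish_trans (map_lead hS psi0 S1 hq i) _.
  apply: (@vanish_le _ _ (wom i + 2)); first by rewrite leq_add2l.
  exact: (gpoly_perturb hq0 hqd (gpoly_lead i hS)).
have hpq := wcurve_near hlq0 hpsi.
have hD i : vanish (wom i + d.+1) (fun r => Dl (psi1 (q r)) i -
    r%:C ^+ (wom i + d) * TD i (wom i + d) (lead S (pt z w0))).
  have h1 := jet_vanish (wom i + d.+1) (@wom_gt0 n) (TD_jet i) hpq.
  have h2 := gpoly_perturb hlq0 hpsi ((TD_jet i).1 (wom i + d)%N).
  rewrite -addnA addn1 in h2.
  apply: vanish_ext (vanishD h1 h2) => r.
  rewrite (addnS (wom i)) big_ord_recr /= big1 ?add0r => [|k _]; last exact: low.
  rewrite subrKA; congr (_ - _).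
  by apply: (wgpoly_scale r%:C z w0 (gpoly_comp_lead hS ((TD_jet i).1 (wom i + d)%N))).
have hDf k : vanish d.+2 (fun r => Dl (psi1 (q r)) (lshift 1 k) - r%:C ^+ d.+1 * f k (pt z w0)).
  by have := hD (lshift 1 k); rewrite wom_l.
have hDg : vanish d.+3 (fun r => Dl (psi1 (q r)) gi - r%:C ^+ d.+2 * g (pt z w0)).
  by have := hD gi; rewrite wom_r.
have hDf' k : vanish d.+1 (fun r => Dl (psi1 (q r)) (lshift 1 k)).
  apply: vanish_ext (vanishD (vanish_le (leqnSn _) (hDf k)) (vanish_rX d.+1 (f k (pt z w0)))) => r.
  by rewrite subrK.
have hDg' : vanish d.+2 (fun r => Dl (psi1 (q r)) gi).
  apply: vanish_ext (vanishD (vanish_le (leqnSn _) hDg) (vanish_rX d.+2 (g (pt z w0)))) => r.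
  by rewrite subrK.
(* The term quadratic in the difference has order 2 (d + 1), enough as soon as d >= 1; for d = 0 the
   agreement of the linear parts of f supplies the missing order. *)
have hDD k : vanish d.+3 (fun r => Dl (psi1 (q r)) (lshift 1 k) * conjc (Dl (psi1 (q r)) (lshift 1 k))).
  case: (posnP d) => [d0|dp]; last first.
    apply: (vanish_le _ (vanishM (hDf' k) (vanish_conj (hDf' k)))); lia.
  have h2 : vanish 2 (fun r => Dl (psi1 (q r)) (lshift 1 k)).
    apply: vanish_ext (vanish_le _ (hDf k)) => [r|]; last by rewrite d0.
    by rewrite /f d0 init0 // mulr0 subr0.
  by apply: (vanish_le _ (vanishM h2 (vanish_conj h2))); rewrite d0.
pose z2 r : 'rV[C]_n := zcoord (phi2 (psi1 (q r))).
pose w2 r : C := wcoord (phi2 (psi1 (q r))).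
have near_q : \forall r \near 0^'+, phi1 (psi1 (q r)) = q r.
  exact: near_curve inv1 (wcurve_small hq).
(* Since phi1 o psi1 is the identity, phi2 (psi1 q) is [q] plus the difference phi2 - phi1 evaluated
   at psi1 q. *)
have z2E : \forall r \near 0^'+, forall k, z2 r 0 k = r%:C * z 0 k + Dl (psi1 (q r)) (lshift 1 k).
  apply: filterS near_q => r E k; rewrite /z2 zcoordE /Dl E /q pt_l mxE.
  by rewrite addrC subrK.
have w2E : \forall r \near 0^'+, w2 r = (r ^+ 2 +i* F1 (r%:C *: z) (r ^+ 2)) + Dl (psi1 (q r)) gi.
  apply: filterS near_q => r E; rewrite /w2 wcoordE /Dl E /q pt_r.
  by rewrite addrC subrK.
have graph2 : \forall r \near 0^'+, complex.Im (w2 r) = F2 (z2 r) (complex.Re (w2 r)).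
  apply: c2; first exact: wcurve_small.
  apply: c1; first exact: wcurve_small.
  exact: (nearW _ (graph_curve F1 (fun r => r%:C *: z) (fun r => r ^+ 2))).
have hz2 k : vanish (1 + d) (fun r => z2 r 0 k - (r%:C *: z) 0 k).
  apply: vanish_near (hDf' k); near=> r.
  have -> : z2 r 0 k = r%:C * z 0 k + Dl (psi1 (q r)) (lshift 1 k) by near: r; apply: filterS z2E => r; exact.
  by rewrite mxE addrAC subrr add0r.
have hw2 : vanish (2 + d) (fun r => (complex.Re (w2 r) - r ^+ 2)%:C).
  apply: vanish_near (vanish_Re hDg'); near=> r.
  have -> : w2 r = (r ^+ 2 +i* F1 (r%:C *: z) (r ^+ 2)) + Dl (psi1 (q r)) gi by near: r.
  by rewrite [complex.Re (_ + Dl _ _)]Re_add [complex.Re (_ +i* _)]/= addrAC subrr add0r.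
have le34 : (d.+3 <= 4 + d)%N by lia.
have hP := vanish_le le34 (nf_perturb an2 sum2 ty2 hz2 hw2).
have hN1 := nf_expansion an1 sum1 ty1 (N := d.+3) z isT hu.
have hN2 := nf_expansion an2 sum2 ty2 (N := d.+3) z isT hu.
have hI : vanish d.+3 (fun r => (complex.Im (Dl (psi1 (q r)) gi))%:C -
    r%:C ^+ d.+2 * ((g (pt z w0) - conjc (g (pt z w0))) / (2%:R * 'i%C))).
  have := vanishZ ((2%:R * 'i%C)^-1) (vanishB hDg (vanish_conj hDg)).
  apply: vanish_ext => r; rewrite conjcB conjcM conjcX conjc_real.
  have -> : (complex.Im (Dl (psi1 (q r)) gi))%:C =
      (Dl (psi1 (q r)) gi - conjc (Dl (psi1 (q r)) gi)) / (2%:R * 'i%C).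
    rewrite subcJ -(mulrA 2%:R) (mulrC _ 'i%C) mulrA mulrC mulKf //.
    by rewrite mulf_neq0 ?pnatr_eq0 // eq_complex /= oner_eq0 andbF.
  by ring.
have hH : vanish d.+3 (fun r => (herm e (z2 r) - herm e (r%:C *: z)) -
    r%:C ^+ d.+2 * (pairing e f z w0 + conjc (pairing e f z w0))).
  have hk (k : 'I_n) : vanish d.+3 (fun r => esign e k * (r%:C * (conjc (z 0 k) * (Dl (psi1 (q r)) (lshift 1 k) - r%:C ^+ d.+1 * f k (pt z w0))
     + z 0 k * conjc (Dl (psi1 (q r)) (lshift 1 k) - r%:C ^+ d.+1 * f k (pt z w0))) +
     Dl (psi1 (q r)) (lshift 1 k) * conjc (Dl (psi1 (q r)) (lshift 1 k)))).
    apply: vanishZ; apply: vanishD (hDD k).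
    rewrite -(add1n d.+2); apply: vanishM; first exact: (vanish_X 1).
    by apply: vanishD; apply: vanishZ; [|apply: vanish_conj]; exact: hDf.
  have hs := vanish_sum (index_enum 'I_n) (P := predT) (fun k _ => hk k).
  apply: vanish_near hs; near=> r.
  have zE : forall k, z2 r 0 k = r%:C * z 0 k + Dl (psi1 (q r)) (lshift 1 k) by near: r.
  rewrite /herm /pairing conjc_sum -big_split mulr_sumr -sumrB -sumrB; apply: eq_bigr => k _ /=.
  rewrite zE mxE; move: (Dl (psi1 (q r)) (lshift 1 k)) (f k (pt z w0)) => D0 f0.
  rewrite !(conjcD, conjcN, conjcM, conjcX, conjc_esign, conjcK, conjc_real) !exprS.
  by ring.
apply: vanish_near (vanishD (vanishB hP hI) (vanishD hH (vanishB hN2 hN1))); near=> r.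
have w2r : w2 r = (r ^+ 2 +i* F1 (r%:C *: z) (r ^+ 2)) + Dl (psi1 (q r)) gi by near: r.
have <- : complex.Im (w2 r) = F2 (z2 r) (complex.Re (w2 r)) by near: r.
rewrite w2r [complex.Im (_ + Dl _ _)]Im_add [complex.Im (_ +i* _)]/= rmorphD /cm_op -/w0.
by rewrite -/(w0); ring.
Unshelve. all: by end_near. Qed.

End MainStep.

(** * Solving for the next weight *)

Section InductionStep.
Context {R : realType}.
Local Notation C := R[i].
Variables (n e : nat) (F F1 F2 : 'rV[C]_n -> R -> R).
Variables (Fst1 Fst2 : nat -> nat -> 'rV[C]_n -> 'rV[C]_n -> C -> C).
Variables (phi1 phi2 psi1 : 'rV[C]_(n + 1) -> 'rV[C]_(n + 1)).
Variables (T1 T2 S : 'I_(n + 1) -> nat -> 'rV[C]_(n + 1) -> C).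
Local Notation gi := (rshift n ord0 : 'I_(n + 1)).
Local Notation TD := (TD T1 T2).
Hypothesis n_gt0 : (0 < n)%N.
Hypothesis nf1 : normal_form_data e F1 Fst1.
Hypothesis nf2 : normal_form_data e F2 Fst2.
Hypothesis hT1 : map_jet phi1 T1.
Hypothesis hT2 : map_jet phi2 T2.
Hypothesis hS : map_jet psi1 S.
Hypothesis psi0 : psi1 0 = 0.
Hypothesis S1 : forall p, S gi 1 p = 0.
Hypothesis c1 : carries F1 F psi1.
Hypothesis c2 : carries F F2 phi2.
Hypothesis inv1 : \forall q \near (0 : 'rV[C]_(n + 1)), phi1 (psi1 q) = q.
Hypothesis lead_surj : forall y, exists x, lead S x = y.
Variable beta : R.
Hypothesis lead_w : lead S (pt 0 1) = pt 0 beta%:C.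
Variable d : nat.
Hypothesis low : forall i k p, (k < wom i + d)%N -> TD i k p = 0.
Hypothesis init0 : d = 0%N -> forall (k : 'I_n) p, TD (lshift 1 k) 1 p = 0.
Hypothesis init1 : d = 1%N -> forall k : 'I_n, TD (lshift 1 k) 2 (pt 0 1) = 0.
Hypothesis init2 : d = 2%N -> complex.Re (TD gi 4 (pt 0 1)) = 0.

Lemma iter_Lapz0 j (z : 'rV[C]_n) : iter j (Lapz e) (fun=> 0) z = 0.
Proof.
elim: j z => [//|j IH] z; rewrite iterS (_ : iter j (Lapz e) (fun=> 0) = fun=> 0).
  exact: Lapz_cst.
by apply/funext.
Qed.

Lemma near_sq_lt (x : R) : 0 < x -> \forall r \near 0^'+, `|r ^+ 2 : R| < x.
Proof.
move=> x0; have hu : vanish 1 (fun r => (r ^+ 2)%:C : C).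
  by apply: (vanish_le (isT : (1 <= 2)%N)); apply: vanish_ext (vanish_X 2) => r; rewrite rmorphXn.
by apply: filterS (vanish_lt1 hu x0) => r; rewrite normC_real ltcR.
Qed.

Lemma induction_step :
  (forall (k : 'I_n) p, TD (lshift 1 k) d.+1 p = 0) /\ (forall p, TD gi d.+2 p = 0).
Proof.
have [an1 sum1 fan1 ty1 _] := nf1; have [an2 sum2 fan2 ty2 _] := nf2.
pose f (k : 'I_n) (p : 'rV[C]_(n + 1)) := TD (lshift 1 k) d.+1 (lead S p).
pose g (p : 'rV[C]_(n + 1)) := TD gi d.+2 (lead S p).
have gT i k := (TD_jet hT1 hT2 i).1 k.
have hf k : gpoly (@xc R (n + 1)) (@wom n) d.+2.-1 (f k) by exact: gpoly_comp_lead hS (gT _ _).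
have hg : gpoly (@xc R (n + 1)) (@wom n) d.+2 g by exact: gpoly_comp_lead hS (gT _ _).
have [p [Hp1 Hp2]] := cm_kernel e (isT : (2 <= d.+2)%N) hf hg.
(* The type (s, t) part of the main relation, isolated by replacing z by l z and extracting the
   coefficient of l^s conj l^t. *)
pose X s t (z : 'rV[C]_n) (r : R) : C := r%:C ^+ d.+2 * p s t z -
  (if low_types d.+3 s t then r%:C ^+ (s + t) * (on_diagonal (Fst2 s t) z (r ^+ 2) -
     on_diagonal (Fst1 s t) z (r ^+ 2)) else 0).
have [x1 x10 sc1] := Fst_scale ty1; have [x2 x20 sc2] := Fst_scale ty2.
have HX s t z : vanish d.+3 (X s t z).
  have [N0 HN0] := Hp1 z; pose N := maxn N0 (maxn d.+3 (s + t).+1).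
  have N0N : (N0 <= N)%N by exact: leq_maxl.
  have dN : (d.+3 <= N)%N by rewrite /N maxnA leq_max leq_max leqnn orbT.
  have stN : (s + t < N)%N by rewrite /N !leq_max leqnn !orbT.
  apply: (@vanish_bidegree _ N d.+3 (fun s t => X s t z)); last 2 first.
  - by apply: leq_ltn_trans stN; exact: leq_addr.
  - by apply: leq_ltn_trans stN; exact: leq_addl.
  move=> l; have := main_expansion nf1 nf2 hT1 hT2 hS psi0 S1 c1 c2 inv1 low init0 (l *: z).
  apply: vanish_near; near=> r.
  have u1 : `|r ^+ 2| < x1 by near: r; exact: near_sq_lt.
  have u2 : `|r ^+ 2| < x2 by near: r; exact: near_sq_lt.
  rewrite -/f -/g (HN0 _ N0N) !(low_part_widen _ _ _ _ dN) mulr_sumr -sumrB -sumrB.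
  apply: eq_bigr => s' _; rewrite mulr_sumr -sumrB -sumrB; apply: eq_bigr => t' _.
  rewrite /X; case: ifP => [/and3P[s2 t2 _]|_]; last by ring.
  by rewrite sc1 // sc2 //; ring.
have P0 s t z : ~~ ((2 <= s) && (2 <= t))%N -> p s t z = 0.
  move=> st; apply: (@vanish_lead _ d.+2); apply: vanish_ext (HX s t z) => r.
  rewrite /X ifF ?subr0 //; apply: contraNF st => /and3P[-> -> _] //.
have [l22 l23 l33 Hk] := Hp2 P0.
have [y1 y10 lp1] := nf_lpoly fan1 ty1; have [y2 y20 lp2] := nf_lpoly fan2 ty2.
have lap s t j z : (2 <= s)%N -> (2 <= t)%N -> lpoly (s + t) (p s t) ->
    (\forall r \near 0^'+, iter j (Lapz e) (fun z => on_diagonal (Fst1 s t) z (r ^+ 2)) z = 0 /\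
       iter j (Lapz e) (fun z => on_diagonal (Fst2 s t) z (r ^+ 2)) z = 0) ->
    iter j (Lapz e) (p s t) z = 0.
  (* A type with s + t >= d + 3 receives nothing from the normal forms at this order, so there the
     component of the operator is already zero. *)
  move=> s2 t2 lp H0; case lt: (low_types d.+3 s t); last first.
    rewrite (_ : p s t = fun=> 0) ?iter_Lapz0 //; apply/funext => z'.
    apply: (@vanish_lead _ d.+2); apply: vanish_ext (HX s t z') => r.
    by rewrite /X lt subr0.
  apply: (comb_lead (Op := fun f => iter j (Lapz e) f) (N := d.+2) (comb_iter_Lapz n (s + t) e j) lp
    (G1 := fun r z => on_diagonal (Fst1 s t) z (r ^+ 2))
    (G2 := fun r z => on_diagonal (Fst2 s t) z (r ^+ 2))) => // [|z'].
    near=> r; split; [apply: lp1|apply: lp2] => //; near: r; exact: near_sq_lt.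
  by apply: vanish_ext (HX s t z') => r; rewrite /X lt.
have [v1 v10 L1] := nf_lap nf1; have [v2 v20 L2] := nf_lap nf2.
have Hlap : exists2 eps : R, 0 < eps & forall z : 'rV[C]_n, (forall i, `|z 0 i| < eps%:C) ->
      [/\ Lapz e (p 2 2) z = 0, iter 2 (Lapz e) (p 2 3) z = 0 &
          iter 3 (Lapz e) (p 3 3) z = 0].
  exists (Num.min v1 v2); first by rewrite lt_min v10.
  move=> z hz.
  have hz1 i : `|z 0 i| < v1%:C by rewrite (lt_le_trans (hz i)) // lecR ge_min lexx.
  have hz2 i : `|z 0 i| < v2%:C by rewrite (lt_le_trans (hz i)) // lecR ge_min lexx orbT.
  split.
  - apply: (lap 2 2 1)%N => //; near=> r.
    have u1 : `|r ^+ 2| < v1 by near: r; exact: near_sq_lt.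
    have u2 : `|r ^+ 2| < v2 by near: r; exact: near_sq_lt.
    have [h1 _ _] := L1 z _ hz1 u1; have [h2 _ _] := L2 z _ hz2 u2.
    by split; [exact: h1|exact: h2].
  - apply: (lap 2 3 2)%N => //; near=> r.
    have u1 : `|r ^+ 2| < v1 by near: r; exact: near_sq_lt.
    have u2 : `|r ^+ 2| < v2 by near: r; exact: near_sq_lt.
    have [_ h1 _] := L1 z _ hz1 u1; have [_ h2 _] := L2 z _ hz2 u2.
    by split; [exact: h1|exact: h2].
  - apply: (lap 3 3 3)%N => //; near=> r.
    have u1 : `|r ^+ 2| < v1 by near: r; exact: near_sq_lt.
    have u2 : `|r ^+ 2| < v2 by near: r; exact: near_sq_lt.
    have [_ _ h1] := L1 z _ hz1 u1; have [_ _ h2] := L2 z _ hz2 u2.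
    by split; [exact: h1|exact: h2].
(* The leading part sends (0, 1) to (0, beta), whereas the initial data live at (0, 1). Weighted
   scaling by a square root of [beta] compares the two; the root is complex because [beta] may be
   negative. *)
have ptb i k : TD i k (pt 0 beta%:C) = sqrtc beta%:C ^+ k * TD i k (pt 0 1).
  rewrite -(wgpoly_scale _ _ _ (gT i k)) scaler0 mulr1.
  by rewrite sqr_sqrtc.
have [f0 g0] : (forall k x, f k x = 0) /\ (forall x, g x = 0).
  apply: (Hk n_gt0 Hlap) => [[d0] k z|[d1] k|[d2]].
  - by rewrite /f d0 init0.
  - by rewrite /f lead_w ptb d1 init1 // mulr0.
  - rewrite /g lead_w ptb d2.
    (* The fourth power of the root is beta^2, a real factor, so it passes through the real part. *)
    rewrite (exprM _ 2 2) sqr_sqrtc -rmorphXn mulrC Re_mulr.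
    by rewrite init2 // mul0r.
split=> [k q|q]; have [x <-] := lead_surj q; first exact: f0.
exact: g0.
Unshelve. all: by end_near. Qed.

End InductionStep.

(** * Initial data and uniqueness *)

Section Differential.
Context {R : realType} (m : nat) (a : 'I_m -> R).
Local Notation C := R[i].

Definition lform (h : 'rV[R]_m) : R := \sum_(i < m) a i * h 0 i.

Fact lform_is_linear : linear lform.
Proof.
move=> k x y; rewrite /lform scaler_sumr -big_split; apply: eq_bigr => i _ /=.
by rewrite !mxE mulrDr mulrCA.
Qed.
HB.instance Definition _ := GRing.isLinear.Build R 'rV[R]_m R _ lform lform_is_linear.

Lemma lform_continuous : continuous (lform : 'rV[R]_m -> R).
Proof.
apply: (@continuous_big R 'I_m +%R 0 xpredT (@add_continuous R) 'rV[R]_m _ (fun i h => a i * h 0 i)) => i _ x.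
apply: (@continuousM _ 'rV[R]_m (cst (a i))); [exact: cst_continuous | exact: coord_continuous].
Qed.

End Differential.

Section Quadratic.
Context {R : realType}.
Local Notation C := R[i].

Lemma mxnorm_ge m (h : 'rV[R]_m) i : `|h 0 i| <= `|h|.
Proof. by rewrite [leRHS]/Num.norm /= mx_normrE; apply/bigmax_geP; right => /=; exists (0, i). Qed.

Lemma series_rep_diff0 m (f : 'rV[R]_m -> R) c : series_rep f 0 c -> f 0 = 0 ->
  exists2 a : 'I_m -> R, 'd f (0 : 'rV[R]_m) = lform a :> ('rV[R]_m -> R) &
    exists B r0 : R, 0 < r0 /\ forall r (h : 'rV[R]_m), 0 <= r <= r0 ->
      (forall i, `|h 0 i| <= r) -> `|f h - lform a h| <= B * r ^+ 2.
Proof.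
move=> fc f0; have om1 (i : 'I_m) : (0 < (fun=> 1%N) i)%N by [].
have hj := series_rep_jetR fc om1.
have t0 h : taylor c (fun=> 1%N) 0 h = 0.
  have := jet_at0 (t0 := 0) om1 hj _ h; rewrite addr0 f0 => H.
  by have [] := H (fun i => congr1 (fun y => y%:C) (mxE _ _ _ _ : (0 : 'rV[R]_m) 0 i = 0)).
have [b Hb] := gpoly_deg1 om1 (hj.1 1%N).
pose a i := complex.Re (b i).
have t1 h : taylor c (fun=> 1%N) 1 h = lform a h.
  rewrite -[LHS]/(complex.Re (_)%:C) Hb /lform raddf_sum; apply: eq_bigr => i _.
  by rewrite /a; case: (b i) => x y /=; rewrite mulr0 subr0.
have [B [r0 [r00 B0 H]]] := series_rep_taylor fc om1.
have E r (h : 'rV[R]_m) : 0 <= r <= r0 -> (forall i, `|h 0 i| <= r) ->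
    `|f h - lform a h| <= B / r0 ^+ 2 * r ^+ 2.
  move=> hr hh; have := H 2%N r h hr (fun i => _).
  rewrite !big_ord_recl big_ord0 /= t0 t1 !add0r addr0 expr_div_n mulrA mulrAC; apply.
  by move=> i; rewrite expr1.
exists a; last by exists (B / r0 ^+ 2), r0.
apply: diff_unique; first exact: lform_continuous.
apply/eqaddoP => x x0.
pose D := B / r0 ^+ 2; have D0 : 0 <= D by rewrite divr_ge0 // exprn_ge0 // ltW.
have : \forall h \near (0 : 'rV[R]_m), `|h| <= Num.min r0 (x / (D + 1)).
  by apply: nbhs0_le; rewrite lt_min r00 divr_gt0 // ltr_wpDl.
apply: filterS => h; rewrite le_min => /andP[h1 h2].
have -> : (f \o shift 0 - (cst (f 0) + lform a)) h = f h - lform a h.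
  by rewrite /= !fctE /= addr0 f0 add0r.
apply: le_trans (E `|h| h _ (mxnorm_ge h)) _; first by rewrite normr_ge0.
rewrite expr2 mulrA ler_wpM2r // -/D.
move: h2; rewrite ler_pdivlMr ?ltr_wpDl // mulrDr mulr1 mulrC; apply: le_trans.
by rewrite lerDl.
Qed.

(** The linear part of the power series is a differential, so by uniqueness it is the one assumed to
    vanish. *)
Lemma quadratic_of_diff0 n (G : 'rV[C]_n -> R -> R) : analytic_at (real_coords G) 0 ->
  G 0 0 = 0 -> (forall h, 'd (real_coords G) (0 : 'rV[R]_(n + n + 1)) h = 0) -> quadratic G.
Proof.
move=> an G0 dG; have [c fc] : exists c, series_rep (real_coords G) 0 c by exact: an.
have G00 : real_coords G 0 = 0.
  rewrite -G0 /real_coords !mxE; congr G; apply/rowP => k; by rewrite !mxE.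
have [a da [B [d [d0 H]]]] := series_rep_diff0 fc G00.
exists B, d; split=> // rho z u hr hz hu.
have := H rho (rc z u) hr (rc_bound hz hu).
by rewrite real_coords_rc -da dG subr0.
Qed.

End Quadratic.

(** * Normalizations and their initial data in terms of weighted components *)

Section Normalizations.
Context {R : realType}.
Local Notation C := R[i].

(** Both directions of carrying follow because phi(M) is taken inside the domain where psi inverts
    phi: a point of the second graph has a preimage in M, and psi recovers that preimage. *)
Lemma normalizationP n e (M : set 'rV[C]_(n + 1)) F phi :
  normalization e M phi -> graph_near0 M F ->
  exists F1 Fst (psi : 'rV[C]_(n + 1) -> 'rV[C]_(n + 1)),
  [/\ normal_form_data e F1 Fst, phi 0 = 0, psi 0 = 0,
      (forall i, \forall p \near (0 : 'rV[C]_(n + 1)), analytic_at (fun q => phi q 0 i) p) &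
      (forall i, analytic_at (fun q => psi q 0 i) 0)] /\
  [/\ carries F F1 phi, carries F1 F psi,
      (\forall p \near (0 : 'rV[C]_(n + 1)), psi (phi p) = p) &
      (\forall q \near (0 : 'rV[C]_(n + 1)), phi (psi q) = q)].
Proof.
move=> [p0 [U [V [psi [[oU U0 oV] UV VU [hU hV]
  [F1 [Fst [an gr sm [fan ty] lap]]]]]]]] gM; exists F1, Fst, psi.
have [V0 ps0] := UV 0 U0; rewrite p0 in V0 ps0.
have nU : \forall p \near (0 : 'rV[C]_(n + 1)), U p by exact: open_nbhs_nbhs.
have nV : \forall p \near (0 : 'rV[C]_(n + 1)), V p by exact: open_nbhs_nbhs.
have anU i : \forall p \near (0 : 'rV[C]_(n + 1)), analytic_at (fun q => phi q 0 i) p.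
  by apply: filterS nU => p Up; exact: hU.
have anV i : analytic_at (fun q => psi q 0 i) 0 by exact: hV.
have anU0 i : analytic_at (fun q => phi q 0 i) 0 by exact: hU.
split; split=> //.
- move=> h hh hF.
  have hn := near_curve gr (map_small anU0 p0 hh).
  have hM := near_curve gM hh; have hU' := near_curve nU hh.
  near=> r.
  have /iffLR : (phi @` (M `&` U)) (phi (h r)) <-> on_graph F1 (phi (h r)) by near: r.
  apply; exists (h r) => //; split; last by near: r.
  have /iffRL : M (h r) <-> on_graph F (h r) by near: r.
  by apply; near: r.
- move=> h hh hF.
  have hn := near_curve gr hh; have hM := near_curve gM (map_small anV ps0 hh).
  near=> r.
  have /iffRL : (phi @` (M `&` U)) (h r) <-> on_graph F1 (h r) by near: r.
  case; first by near: r.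
  move=> p [Mp Up] pE.
  have /iffLR : M (psi (h r)) <-> on_graph F (psi (h r)) by near: r.
  by apply; rewrite -pE (UV p Up).2.
- by apply: filterS nU => p /UV[].
- by apply: filterS nV => p /VU[].
Unshelve. all: by end_near. Qed.

Lemma pt_delta n (w : C) : w *: delta_mx 0 (rshift n ord0) = pt 0 w :> 'rV[C]_(n + 1).
Proof.
apply/rowP; apply: ordlr => [k|]; rewrite ?pt_l ?pt_r !mxE /=.
  by rewrite eq_lrshift mulr0.
by rewrite eqxx mulr1.
Qed.

Lemma delta_pt n (k : 'I_n) (a : C) :
  a *: delta_mx 0 (lshift 1 k) = pt (a *: delta_mx 0 k) (a ^+ 2 * 0) :> 'rV[C]_(n + 1).
Proof.
rewrite mulr0; apply/rowP; apply: ordlr => [j|]; rewrite ?pt_l ?pt_r !mxE /=.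
  by rewrite (inj_eq (@lshift_inj _ _)).
by rewrite eq_rlshift mulr0.
Qed.

Lemma fcomp_analytic n (phi : 'rV[C]_(n + 1) -> 'rV[C]_(n + 1)) j :
  (\forall p \near (0 : 'rV[C]_(n + 1)), analytic_at (fun q => phi q 0 (lshift 1 j)) p) ->
  analytic_at (fcomp phi j) 0.
Proof.
move=> /nbhs_singleton; congr (analytic_at _ _); apply/funext => q.
by rewrite /fcomp zcoordE.
Qed.

Lemma gcomp_analytic n (phi : 'rV[C]_(n + 1) -> 'rV[C]_(n + 1)) :
  (\forall p \near (0 : 'rV[C]_(n + 1)), analytic_at (fun q => phi q 0 (rshift n ord0)) p) ->
  \forall p \near (0 : 'rV[C]_(n + 1)), analytic_at (gcomp phi) p.
Proof.
apply: filterS => p; congr (analytic_at _ _); apply/funext => q.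
by rewrite /gcomp wcoordE.
Qed.

Section InitialData.
Variables (n : nat) (phi1 phi2 : 'rV[C]_(n + 1) -> 'rV[C]_(n + 1)).
Variables (T1 T2 : 'I_(n + 1) -> nat -> 'rV[C]_(n + 1) -> C).
Let gi : 'I_(n + 1) := rshift n ord0.
Hypothesis hT1 : map_jet phi1 T1.
Hypothesis hT2 : map_jet phi2 T2.
Hypothesis phi10 : phi1 0 = 0.
Hypothesis phi20 : phi2 0 = 0.
Hypothesis an1 : forall i, \forall p \near (0 : 'rV[C]_(n + 1)), analytic_at (fun q => phi1 q 0 i) p.
Hypothesis an2 : forall i, \forall p \near (0 : 'rV[C]_(n + 1)), analytic_at (fun q => phi2 q 0 i) p.

Let ray_curve (p : 'rV[C]_(n + 1)) : wcurve (fun r => pt (r%:C *: zcoord p) (r%:C ^+ 2 * wcoord p)).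
Proof. by move=> i; apply: vanish_ext (vanish_rX _ (p 0 i)) => r; rewrite scale_pt -ptE. Qed.

Lemma TD_ray i N p : vanish N (fun r =>
  Dl phi1 phi2 (pt (r%:C *: zcoord p) (r%:C ^+ 2 * wcoord p)) i -
  \sum_(k < N) r%:C ^+ k * TD T1 T2 i k p).
Proof.
have hj := TD_jet hT1 hT2 i.
apply: vanish_ext (jet_vanish N (@wom_gt0 n) hj (ray_curve p)) => r.
congr (_ - _); apply: eq_bigr => k _.
by rewrite (wgpoly_scale _ _ _ (hj.1 k)) -ptE.
Qed.

Lemma TD_z (j : 'I_n) : (forall k : 'I_n, dz k (fcomp phi1 j) 0 = dz k (fcomp phi2 j) 0) ->
  forall p, TD T1 T2 (lshift 1 j) 1 p = 0.
Proof.
move=> H p; have hj := TD_jet hT1 hT2 (lshift 1 j).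
have [b Hb] := gpoly1_linear (hj.1 1%N).
rewrite (ptE p) Hb big1 // => k _.
suff -> : b k = 0 by rewrite mul0r.
have <- : TD T1 T2 (lshift 1 j) 1 (pt (delta_mx 0 k) 0) = b k.
  rewrite Hb (bigD1 k) //= big1 ?addr0 ?mxE ?eqxx ?mulr1 // => l /negPf lk.
  by rewrite mxE eqxx lk mulr0.
have h1 := partial_ray (lshift 1 k) (fcomp_analytic (an1 (lshift 1 j))); have h2 := partial_ray (lshift 1 k) (fcomp_analytic (an2 (lshift 1 j))).
have h3 := TD_ray (lshift 1 j) 2 (pt (delta_mx 0 k) 0).
apply: (@vanish_coef _ 2 (fun k' => TD T1 T2 (lshift 1 j) k' (pt (delta_mx 0 k) 0)) _ 1%N isT).
apply: vanish_ext (vanishB (vanishB h2 h1) h3) => r.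
move: (H k); rewrite /dz => ->.
rewrite delta_pt zcoord_pt wcoord_pt /Dl /fcomp !zcoordE phi10 phi20 mxE; ring.
Qed.

Lemma TD_w (j : 'I_n) : dw (fcomp phi1 j) 0 = dw (fcomp phi2 j) 0 ->
  TD T1 T2 (lshift 1 j) 2 (pt 0 1) = 0.
Proof.
move=> H.
have h1 := partial_ray_sq gi (fcomp_analytic (an1 (lshift 1 j))); have h2 := partial_ray_sq gi (fcomp_analytic (an2 (lshift 1 j))).
have h3 := TD_ray (lshift 1 j) 3 (pt 0 1).
apply: (@vanish_coef _ 3 (fun k' => TD T1 T2 (lshift 1 j) k' (pt 0 1)) _ 2%N isT).
apply: vanish_ext (vanishB (vanish_le (isT : (3 <= 4)%N) (vanishB h2 h1)) h3) => r.
move: H; rewrite /dw => ->.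
rewrite pt_delta zcoord_pt wcoord_pt scaler0 mulr1 /Dl /fcomp !zcoordE phi10 phi20 mxE; ring.
Qed.

(** Along (0, r^2) the weight 4 component of g is half the second derivative in w. The derivatives
    enter as arbitrary constants, so only the shape of the two expansions matters. *)
Lemma TD_g4 (a1 a2 b1 b2 : C) :
  vanish 6 (fun r => gcomp phi1 (r%:C ^+ 2 *: delta_mx 0 gi) - gcomp phi1 0 - r%:C ^+ 2 * a1 -
    r%:C ^+ 4 * (b1 / 2%:R)) ->
  vanish 6 (fun r => gcomp phi2 (r%:C ^+ 2 *: delta_mx 0 gi) - gcomp phi2 0 - r%:C ^+ 2 * a2 -
    r%:C ^+ 4 * (b2 / 2%:R)) ->
  TD T1 T2 gi 4 (pt 0 1) = b2 / 2%:R - b1 / 2%:R.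
Proof.
move=> h1 h2; have h3 := TD_ray gi 5 (pt 0 1).
have gE (phi : 'rV[C]_(n + 1) -> 'rV[C]_(n + 1)) p : phi p 0 gi = gcomp phi p by rewrite /gcomp wcoordE.
have g0 (phi : 'rV[C]_(n + 1) -> 'rV[C]_(n + 1)) : phi 0 = 0 -> gcomp phi 0 = 0.
  by move=> p0; rewrite -gE p0 mxE.
pose P k : C := if k == 2%N then a2 - a1 else if k == 4%N then b2 / 2%:R - b1 / 2%:R else 0.
apply/esym/eqP; rewrite -subr_eq0; apply/eqP.
apply: (@vanish_coef _ 5 (fun k' => P k' - TD T1 T2 gi k' (pt 0 1)) _ 4%N isT).
apply: vanish_ext (vanishB h3 (vanish_le (isT : (5 <= 6)%N) (vanishB h2 h1))) => r.
rewrite !big_ord_recl !big_ord0 /P /= /bump /= !addn0 !add1n.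
rewrite pt_delta zcoord_pt wcoord_pt scaler0 mulr1 /Dl !gE !g0 //.
move: (gcomp _ _) (gcomp _ _) (2%:R^-1) => *; ring.
Qed.

Lemma TD_ww : complex.Re (dw (dw (gcomp phi1)) 0) = complex.Re (dw (dw (gcomp phi2)) 0) ->
  complex.Re (TD T1 T2 gi 4 (pt 0 1)) = 0.
Proof.
move=> H; rewrite (TD_g4 (partial2_ray_sq gi (gcomp_analytic (an1 _)))
  (partial2_ray_sq gi (gcomp_analytic (an2 _)))).
suff E (x y : C) : complex.Re x = complex.Re y -> complex.Re (y / 2%:R - x / 2%:R) = 0 by exact: E H.
rewrite -mulrBl; have -> : (2%:R : C)^-1 = (2%:R^-1 : R)%:C by rewrite fmorphV rmorph_nat.
by case: x => x1 x2; case: y => y1 y2 /= ->; rewrite subrr mul0r mulr0 subr0.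
Qed.

End InitialData.
End Normalizations.

Section Uniqueness.
Context {R : realType}.
Local Notation C := R[i].

Lemma lead_w_axis n (S : 'I_(n + 1) -> nat -> 'rV[C]_(n + 1) -> C) psi : map_jet psi S ->
  complex.Im (S (rshift n ord0) 2 (pt 0 1)) = 0 ->
  lead S (pt 0 1) = pt 0 (complex.Re (S (rshift n ord0) 2 (pt 0 1)))%:C.
Proof.
move=> hS im; apply/rowP; apply: ordlr => [k|]; rewrite ?pt_l ?pt_r !mxE.
  rewrite wom_l; have := (hS (lshift 1 k)).1 1%N => /gpoly1_linear[b ->].
  by rewrite big1 // => l _; rewrite mxE mulr0.
by rewrite wom_r; case: (S _ _ _) im => x y /= ->.
Qed.

Lemma jets_determine n (phi1 phi2 : 'rV[C]_(n + 1) -> 'rV[C]_(n + 1)) T1 T2 :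
  map_jet phi1 T1 -> map_jet phi2 T2 -> (forall i k p, TD T1 T2 i k p = 0) ->
  \forall p \near (0 : 'rV[C]_(n + 1)), phi1 p = phi2 p.
Proof.
move=> hT1 hT2 T0.
have H i : \forall p \near (0 : 'rV[C]_(n + 1)), phi2 p 0 i - phi1 p 0 i = 0.
  have [x x0 Hx] := jet_flat (@wom_gt0 n) (TD_jet hT1 hT2 i) (T0 i).
  (* Weights are at most 2 and y <= 1, so the ball of radius y^2 lies in the weighted polydisc of
     size [x]. *)
  pose y := Num.min x 1; have y0 : 0 < y by rewrite lt_min x0 ltr01.
  apply/near0_rowP; exists (y ^+ 2)%:C; first by rewrite ltcR exprn_gt0.
  move=> h hh; apply: Hx => j; apply: le_trans (ltW (hh j)) _; rewrite lecR.
  apply: (@le_trans _ _ (y ^+ wom j)); last first.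
    by apply: lerXn2r; rewrite ?nnegrE ?(ltW y0) ?(ltW x0) // /y ge_min lexx.
  have wj : (wom j <= 2)%N by rewrite /wom; case: ifP.
  by apply: ler_wiXn2l wj; [exact: ltW | rewrite /y ge_min lexx orbT].
have : \forall p \near (0 : 'rV[C]_(n + 1)), forall i, phi2 p 0 i - phi1 p 0 i = 0.
  have := @filter_forall _ _ (fun i (p : 'rV[C]_(n + 1)) => phi2 p 0 i - phi1 p 0 i = 0)
    (nbhs (0 : 'rV[C]_(n + 1))) _ H.
  by apply.
apply: filterS => p Hp; apply/rowP => i; apply/esym/eqP.
by rewrite -subr_eq0 Hp.
Qed.

End Uniqueness.

Theorem theorem0p2 (R : realType) (n e : nat)
    (M : set 'rV[R[i]]_(n + 1)) (F : 'rV[R[i]]_n -> R -> R)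
    (phi1 phi2 : 'rV[R[i]]_(n + 1) -> 'rV[R[i]]_(n + 1))
    (n_gt0 : (0 < n)%N)
    (F_analytic : real_analytic_near0 F)
    (M_def : graph_near0 M F)
    (F0 : F 0 0 = 0)
    (dF0 : forall h, 'd (real_coords F) (0 : 'rV[R]_(n + n + 1)) h = 0)
    (levi_nondegenerate : levi_matrix F \in unitmx)
    (e_range : (n <= e.*2)%N /\ (e <= n)%N)
    (e_signature : has_signature (levi_matrix F) e \/
                   has_signature (- levi_matrix F) e)
    (norm1 : normalization e M phi1)
    (norm2 : normalization e M phi2)
    (eq_fz : forall j k : 'I_n, dz k (fcomp phi1 j) 0 = dz k (fcomp phi2 j) 0)
    (eq_fw : forall j : 'I_n, dw (fcomp phi1 j) 0 = dw (fcomp phi2 j) 0)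
    (eq_gw : complex.Re (dw (gcomp phi1) 0) = complex.Re (dw (gcomp phi2) 0))
    (eq_gww : complex.Re (dw (dw (gcomp phi1)) 0) =
              complex.Re (dw (dw (gcomp phi2)) 0)) :
  \forall p \near (0 : 'rV[R[i]]_(n + 1)), phi1 p = phi2 p.
Proof.
have qF := quadratic_of_diff0 (nbhs_singleton F_analytic) F0 dF0.
have [F1 [Fst1 [psi1 [[nf1 p10 s10 anp1 ans1] [c1 d1 inv1 vni1]]]]] := normalizationP norm1 M_def.
have [F2 [Fst2 [psi2 [[nf2 p20 s20 anp2 ans2] [c2 d2 inv2 vni2]]]]] := normalizationP norm2 M_def.
have qF1 : quadratic F1 by case: nf1 => an sm _ ty _; exact: nf_quadratic an sm ty.
have qF2 : quadratic F2 by case: nf2 => an sm _ ty _; exact: nf_quadratic an sm ty.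
have an1 i := nbhs_singleton (anp1 i); have an2 i := nbhs_singleton (anp2 i).
have [T1 hT1] := map_jet_exists an1; have [T2 hT2] := map_jet_exists an2.
have [S hS] := map_jet_exists ans1.
have T11 := tangent_gz qF qF1 an1 p10 hT1 c1; have T21 := tangent_gz qF qF2 an2 p20 hT2 c2.
have S1 := tangent_gz qF1 qF ans1 s10 hS d1.
have lw := lead_w_axis hS (tangent_gw qF1 qF ans1 s10 hS d1).
have ls y : exists x, lead S x = y by exists (lead T1 y); exact: lead_inverse hS hT1 s10 p10 S1 T11 inv1 y.
apply: (jets_determine hT1 hT2) => i k p.
suff low d : forall i k p, (k < wom i + d)%N -> TD T1 T2 i k p = 0.
  by apply: (low k.+1); rewrite addnS ltnS leq_addl.
(* The base case covers the weights below those of the leading parts: weight 0 vanishes since both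
   maps fix the origin, and weight 1 of g by tangency. *)
elim: d => [|d IH] {}i {}k {}p.
  rewrite addn0 /TD; case: k => [|k]; first by rewrite (map_jet0 _ _ hT1 p10) (map_jet0 _ _ hT2 p20) subrr.
  move: i; apply: ordlr => [j|].
    by rewrite wom_l ltnS ltn0.
  by rewrite wom_r; case: k => [_|k]; [rewrite T11 T21 subrr | rewrite !ltnS ltn0].
have [hz hg] := induction_step n_gt0 nf1 nf2 hT1 hT2 hS s10 S1 d1 c2 vni1 ls lw IH
  (fun _ j => TD_z hT1 hT2 p10 p20 anp1 anp2 (eq_fz j))
  (fun _ j => TD_w hT1 hT2 p10 p20 anp1 anp2 (eq_fw j))
  (fun _ => TD_ww hT1 hT2 p10 p20 anp1 anp2 eq_gww).
(* Only the weight [wom i + d] is new, that is d + 1 for f and d + 2 for g. *)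
rewrite addnS ltnS leq_eqVlt => /orP[/eqP->|]; last exact: IH.
by move: i p; apply: ordlr => [j|] p; rewrite ?wom_l ?wom_r.
Qed.
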